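(* Let $\ell\in\mathbb{R}[x]_{n,2d}^*$ span an extreme ray of $\Sigma_{n,2d}^*$. If $d\ge 3$ and $\operatorname{rank} Q_\ell\le 3d-3$, or $d=2$ and $\operatorname{rank} Q_\ell\le 5$, then $\ell$ is a point evaluation. Furthermore these bounds are tight: for all $d\ge 3$, $n\ge 3$ there exist extreme rays of $\Sigma_{n,2d}^*$ of rank $3d-2$ that do not come from point evaluations, and for $d=2$ and all $n\ge 4$ there exist extreme rays of $\Sigma_{n,4}^*$ of rank $6$ that do not come from point evaluations.
   Context: $\mathbb{R}[x]_{n,m}$ is the vector space of real forms of degree $m$ in $n$ variables. $\Sigma_{n,2d}\subset\mathbb{R}[x]_{n,2d}$ is the cone of sums of squares of forms in $\mathbb{R}[x]_{n,d}$, and $\Sigma_{n,2d}^*=\{\ell\in\mathbb{R}[x]_{n,2d}^* : \ell(p)\ge 0 \text{ for all } p\in\Sigma_{n,2d}\}$. For a linear functional $\ell:\mathbb{R}[x]_{n,2d}\to\mathbb{R}$, $Q_\ell$ is the quadratic form on $\mathbb{R}[x]_{n,d}$ given by $Q_\ell(p)=\ell(p^2)$; the rank of an extreme ray spanned by $\ell$ is $\operatorname{rank} Q_\ell$. A point evaluation is a functional $\ell_v(f)=f(v)$ with $v\in\mathbb{R}^n$. *)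

(* Defs.v *)
From mathcomp Require Import all_boot all_order all_algebra.
From mathcomp Require Import mpoly reals.

Set Implicit Arguments.
Unset Strict Implicit.
Unset Printing Implicit Defensive.

Import GRing.Theory Num.Theory.
Local Open Scope ring_scope.

Section Forms.
Context (R : realType) (n d : nat).

Fact form_sqr_homog (p : dhomog n R d) :
  (p : {mpoly R[n]}) ^+ 2 \is (2 * d).-homog.
Proof. by rewrite mulnC; exact/dhomogMn/dhomog_is_dhomog. Qed.

Definition form_sqr (p : dhomog n R d) : dhomog n R (2 * d) :=
  DHomog (form_sqr_homog p).

Definition is_sos (f : dhomog n R (2 * d)) : Prop :=
  exists s : seq (dhomog n R d), f = \sum_(p <- s) form_sqr p.

Definition in_sos_dual (l : {scalar dhomog n R (2 * d)}) : Prop :=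
  forall f, is_sos f -> 0 <= l f.

Definition spans_extreme_ray (l : {scalar dhomog n R (2 * d)}) : Prop :=
  [/\ exists f, l f != 0,
      in_sos_dual l &
      forall l1 l2 : {scalar dhomog n R (2 * d)},
        in_sos_dual l1 -> in_sos_dual l2 ->
        (forall f, l f = l1 f + l2 f) ->
        (exists2 c, 0 <= c & forall f, l1 f = c * l f) /\
        (exists2 c, 0 <= c & forall f, l2 f = c * l f)].

Definition point_evaluation (l : {scalar dhomog n R (2 * d)}) : Prop :=
  exists v : 'I_n -> R, forall f, l f = (f : {mpoly R[n]}).@[v].

Definition Qform (l : {scalar dhomog n R (2 * d)}) (p : dhomog n R d) : R :=
  l (form_sqr p).

Definition polar (Q : dhomog n R d -> R) (p q : dhomog n R d) : R :=
  (Q (p + q) - Q p - Q q) / 2.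

Definition monom_index := {m : 'X_{1..n < d.+1} | mdeg m == d}.

Fact monom_homog (m : monom_index) :
  ('X_[val m] : {mpoly R[n]}) \is d.-homog.
Proof. by rewrite dhomogX; exact: (valP m). Qed.

Definition monom (m : monom_index) : dhomog n R d := DHomog (monom_homog m).

(* The rank of a quadratic form is read off its symmetric matrix in the basis
   of monomials. A vectType structure on [dhomog n R d] exists only for [n]
   of the form [_.+1], hence the explicit basis. *)
Definition qrank (Q : dhomog n R d -> R) : nat :=
  \rank (\matrix_(i < #|{: monom_index}|, j < #|{: monom_index}|)
           polar Q (monom (enum_val i)) (monom (enum_val j))).

End Forms.

(* Main.v *)
(* Write [ann] for the forms [p] with [l (p q) = 0] for all [q], an ideal whose
   part in degree [d] is the kernel of [Q_l].

   Small rank. If all of [ann] in degree [d] vanishes at a nonzero complex [z],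
   then [f |-> Re f(z)] and [f |-> Im f(z)] are bounded on squares by a multiple
   of [l], so by extremality they are multiples of [l], and [l] is evaluation at
   a real multiple of [z].  To find [z], take a linear form [L] for which the
   rank of [p |-> l (L p .)] on degree [d-1] is maximal: positivity makes [L] a
   nonzerodivisor modulo [ann] up to degree [d-1].  The codimensions [c_k] of
   [ann + (L)] in degree [k] thus add up to [rank Q_l], and since
   [c_k <= 2] persists in higher degrees, the rank bound leaves only [c_d = 0],
   [c_(d-1) <= 2], or [d = 2] with [c = (1,3,1)].  In an orthonormal basis of
   degree [d] adapted to [L], the multiplications [x_i / L] become symmetric
   matrices [T_i], bordered by [A_i]; a suitable lower right block makes the
   bordered matrices commute, and a common eigenvector gives [z].  If [c_d = 2],
   one divides by a linear form spanning degree [d] modulo [ann + (L)] instead.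

   Tightness. The points of an affine grid with [s_i] values in the [i]-th
   coordinate, [\sum_i (s_i - 1) = d + 1] and [s_i <= d], satisfy exactly one
   linear relation [\sum_k w_k f(v_k) = 0] on forms of degree [d], and it has no
   zero weight.  Giving all points but one the weights [w_k^2], and the last one
   the most negative weight keeping the functional nonnegative on squares,
   yields an extreme ray of rank [\prod_i s_i - 2].  The [3 x d] and
   [2 x 2 x 2] grids have ranks [3 d - 2] and [6]. *)
From HB Require Import structures.
Require Import Defs.
From mathcomp Require Import all_boot all_order all_algebra.
From mathcomp Require Import mpoly reals complex.
From mathcomp Require Import ring lra zify.
From mathcomp Require Import boolp.

Set Implicit Arguments.
Unset Strict Implicit.
Unset Printing Implicit Defensive.

Import Order.TTheory GRing.Theory Num.Theory.
Local Open Scope ring_scope.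

(** * Linear algebra modulo a subspace *)

(** Positivity is available only for squares of forms of degree [d], so [L] is a nonzerodivisor only
    up to degree [d-1]. Multiplication by [x_i / L] is thus known on the multiples of [L] in degree
    [d] but not on their complement, of dimension [c_d]; the lower right block is this missing part.

    If [d >= 3] and [c_(d-1) >= 3], then [c_1 >= 2] and [c_2, ..., c_(d-1) >= 3], so degree [d-1]
    alone contributes [1 + 2 + 3 (d - 2) = 3 d - 3], which exhausts the bound and forces [c_d = 0].
    For [d = 2] counting would stop at rank 4; a Jacobi identity settles [(1,3,1)] and raises the
    bound to 5. The first profiles out of reach, [(1,2,3,...,3,1)] and [(1,3,2)], are those of the
    two grids.

    The point [z] is complex because dividing by another linear form produces matrices that need not
    be symmetric.

    For grids, [s_i <= d] puts the equations [\prod_(j < s_i) (x_i - j x_z)] in degree at most [d].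
    A summand of the functional inherits its kernel, so these equations make it again a combination
    of evaluations at the grid. *)

Section Families.
Variables (R : fieldType) (V : lmodType R).
Implicit Types (D P : V -> Prop).

Definition subspace P :=
  P 0 /\ forall (a : R) (u v : V), P u -> P v -> P (a *: u + v).

Lemma subspaceD P u v : subspace P -> P u -> P v -> P (u + v).
Proof. by case=> _ PD Pu Pv; rewrite -[u]scale1r; apply: PD. Qed.

Lemma subspaceZ P a u : subspace P -> P u -> P (a *: u).
Proof. by case=> P0 PD Pu; rewrite -[_ *: _]addr0; apply: PD. Qed.

Lemma subspaceB P u v : subspace P -> P u -> P v -> P (u - v).
Proof. by move=> sP Pu Pv; rewrite -scaleN1r addrC; case: sP => _; apply. Qed.

Lemma subspace_sum P I (r : seq I) (Q : pred I) (F : I -> V) :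
  subspace P -> (forall i, Q i -> P (F i)) -> P (\sum_(i <- r | Q i) F i).
Proof.
by move=> sP PF; elim/big_rec: _ => [|i x /PF Pi Px]; [case: sP|exact: subspaceD].
Qed.

(* [D] is spanned by [j] elements, resp. has [j] independent elements, modulo
   the subspace [P]; the family [m] matters only below [j]. *)
Definition spans D P j := exists2 m : nat -> V, (forall i, (i < j)%N -> D (m i))
  & forall v, D v -> exists c : nat -> R, P (v - \sum_(i < j) c i *: m i).

Definition indep D P j := exists2 m : nat -> V, (forall i, (i < j)%N -> D (m i))
  & forall c : nat -> R, P (\sum_(i < j) c i *: m i) ->
      forall i, (i < j)%N -> c i = 0.

Lemma spansW D P j k : D 0 -> (j <= k)%N -> spans D P j -> spans D P k.
Proof.
move=> D0 le_jk [m Dm Pm]; exists (fun i => if (i < j)%N then m i else 0).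
  by move=> i _; case: ifP => // /Dm.
move=> v /Pm [c Pc]; exists c.
rewrite (big_ord_widen k (fun i => c i *: m i) le_jk) in Pc.
rewrite big_mkcond /= in Pc; congr (P (v - _)): Pc.
by apply: eq_bigr => i _; case: ifP; rewrite ?scaler0.
Qed.

(** An independent family of at most [j] elements cannot span, since it would pad to a spanning
    family of size [j]; so it can be enlarged until it has [j + 1] elements. *)
Lemma not_spans_indep D P j : subspace D -> subspace P ->
  ~ spans D P j -> indep D P j.+1.
Proof.
move=> sD sP nsp.
suff: forall k, (k <= j.+1)%N -> indep D P k by apply.
elim=> [_|k IHk lt_kj]; first by exists (fun=> 0) => // c _ [].
have [m Dm Pm] := IHk (ltnW lt_kj).
have /existsNP [v /not_implyP [Dv /forallNP Nv]] :
    ~ (forall v, D v -> exists c : nat -> R, P (v - \sum_(i < k) c i *: m i)).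
  move=> H; apply: nsp; apply: (@spansW _ _ k) => //; first by case: sD.
  by exists m.
exists (fun i => if i == k then v else m i) => [i|c].
  by rewrite ltnS leq_eqVlt; case: eqP => //= _; apply: Dm.
rewrite big_ord_recr /= eqxx.
rewrite (eq_bigr (fun i : 'I_k => c i *: m i)); last first.
  by move=> i _; rewrite ltn_eqF.
move=> Pc; have ck0 : c k = 0.
  apply: contrapT => /eqP ck_neq0; case: (Nv (fun i => - (c k)^-1 * c i)).
  have := subspaceZ (c k)^-1 sP Pc.
  rewrite scalerDr scalerA mulVf // scale1r addrC scaler_sumr -sumrN.
  by congr (P (_ + _)); apply: eq_bigr => i _; rewrite scalerA mulNr scaleNr opprK.
move=> i; rewrite ltnS leq_eqVlt => /predU1P[->//|].
by apply: (Pm c); move: Pc; rewrite ck0 scale0r addr0.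
Qed.

End Families.

(** * Homogeneous polynomials *)

Section Forms.
Variables (R : fieldType) (n : nat).
Implicit Types (p q f g : {mpoly R[n]}).

Lemma homog_ind k (P : {mpoly R[n]} -> Prop) :
  P 0 -> (forall f g, P f -> P g -> P (f + g)) ->
  (forall a f, P f -> P (a *: f)) ->
  (forall m : 'X_{1..n}, mdeg m = k -> P 'X_[m]) ->
  forall f, f \is k.-homog -> P f.
Proof.
move=> P0 PD PZ PX f /dhomogP fk; rewrite [f]mpolyE big_seq.
by elim/big_rec: _ => // m g /fk mk; apply: PD; apply/PZ/PX.
Qed.

Lemma homogX i : ('X_i : {mpoly R[n]}) \is 1.-homog.
Proof. by rewrite dhomogX /= mdeg1. Qed.

Lemma homogM1 k p q : p \is 1.-homog -> q \is k.-homog -> p * q \is k.+1.-homog.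
Proof. exact: dhomogM. Qed.

Lemma homogXM k i q : q \is k.-homog -> 'X_i * q \is k.+1.-homog.
Proof. exact/homogM1/homogX. Qed.

Lemma mnm_split k (m : 'X_{1..n}) : mdeg m = k.+1 ->
  exists i (m' : 'X_{1..n}), mdeg m' = k /\ m = (U_(i) + m')%MM.
Proof.
move=> mk; have /existsP [i mi] : [exists i, m i != 0%N].
  apply: contra_eqT mk; rewrite negb_exists => /forallP m0.
  by rewrite mdegE big1 // => i _; apply/eqP; rewrite -[_ == _]negbK m0.
have le_im : (U_(i) <= m)%MM by rewrite lep1mP.
exists i, (m - U_(i))%MM; rewrite addmC submK //; split=> //.
by apply/eqP; rewrite -eqSS -mk -{2}(submK le_im) mdegD mdeg1 addn1.
Qed.

Lemma homog_gen k f : f \is k.+1.-homog ->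
  exists2 q : 'I_n -> {mpoly R[n]}, (forall i, q i \is k.-homog)
  & f = \sum_i 'X_i * q i.
Proof.
move: f; apply: homog_ind => [|f g [q qk ->] [r rk ->]|a f [q qk ->]|m /mnm_split].
- by exists (fun=> 0) => [i|]; rewrite ?rpred0// big1// => i; rewrite mulr0.
- exists (fun i => q i + r i) => [i|]; first exact: rpredD.
  by rewrite -big_split; apply: eq_bigr => i _; rewrite mulrDr.
- exists (fun i => a *: q i) => [i|]; first exact: rpredZ.
  by rewrite scaler_sumr; apply: eq_bigr => i _; rewrite scalerAr.
case=> i [m' [mk ->]]; exists (fun j => (i == j)%:R *: 'X_[m']) => [j|].
  by apply: rpredZ; rewrite dhomogX /= mk.
rewrite (bigD1 i) //= eqxx scale1r big1 ?addr0 ?mpolyXD // => j.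
by rewrite eq_sym => /negPf->; rewrite scale0r mulr0.
Qed.

Lemma homog_lin f : f \is 1.-homog ->
  exists c : 'I_n -> R, f = \sum_i c i *: 'X_i.
Proof.
move=> /homog_gen [q q0 ->]; exists (fun i => (q i)@_0%MM).
apply: eq_bigr => i _; rewrite {1}[q i](_ : _ = ((q i)@_0%MM)%:MP).
  by rewrite mulrC mul_mpolyC.
apply/mpolyP => m; rewrite mcoeffC; case: eqVneq => [->|m0]; rewrite ?mulr1//.
by rewrite mulr0 (dhomog_nemf_coeff (q0 i)) // mdeg_eq0.
Qed.

Lemma homog_subspace k : subspace (fun f : {mpoly R[n]} => is_true (f \is k.-homog)).
Proof. by split=> [|a u v uk vk]; rewrite ?rpred0// rpredD// rpredZ. Qed.
End Forms.

(** * Comparison of spanning and independent families *)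

Section Exchange.
Variables (R : fieldType) (V : lmodType R).
Implicit Types (D P : V -> Prop).

(** The coefficients of [j + 1] elements in a spanning family of size [j] form a matrix with more
    rows than columns; a vector of its left kernel is a dependence modulo [P]. *)
Lemma spans_dep D P j : subspace P -> spans D P j -> ~ indep D P j.+1.
Proof.
move=> sP [m Dm Pm] [a Da Pa].
have /boolp.choice [A AP] : forall i : 'I_j.+1, exists c : nat -> R,
    P (a i - \sum_(k < j) c k *: m k) by move=> i; apply/Pm/Da.
pose M := \matrix_(i < j.+1, k < j) A i k.
have : kermx M != 0.
  by rewrite kermx_eq0 /row_free neq_ltn ltnS rank_leq_col.
move=> /rowV0Pn [c /sub_kermxP cM] /eqP; apply; apply/rowP => i; rewrite mxE.
pose c' k := c 0 (inord k).
have c'E (k : 'I_j.+1) : c' k = c 0 k by rewrite /c' inord_val.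
have := Pa c' _ i (ltn_ord i); rewrite c'E; apply.
have: P (\sum_(k < j.+1) c' k *: (a k - \sum_(l < j) A k l *: m l)).
  by apply: subspace_sum => // k _; apply: subspaceZ.
under eq_bigr do rewrite scalerBr; rewrite sumrB.
rewrite [X in _ - X](_ : _ = 0) ?subr0 //.
under eq_bigr do rewrite scaler_sumr; rewrite exchange_big big1 // => l _.
under eq_bigr do rewrite scalerA; rewrite -scaler_suml.
have /rowP/(_ l) := cM; rewrite !mxE => cMl.
rewrite [X in X *: _](_ : _ = 0) ?scale0r // -[RHS]cMl.
by apply: eq_bigr => k _; rewrite mxE c'E.
Qed.

Lemma indep_gen D P j (a : nat -> V) : subspace P -> spans D P j ->
  (forall i, (i < j)%N -> D (a i)) ->
  (forall c : nat -> R, P (\sum_(i < j) c i *: a i) ->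
      forall i, (i < j)%N -> c i = 0) ->
  forall v, D v -> exists c : nat -> R, P (v - \sum_(i < j) c i *: a i).
Proof.
move=> sP spj Da Pa v Dv; apply: contrapT => /forallNP Nv.
apply: (spans_dep sP spj); exists (fun i => if i == j then v else a i) => [i|c].
  by rewrite ltnS leq_eqVlt; case: eqP => //= _; apply: Da.
rewrite big_ord_recr /= eqxx.
rewrite (eq_bigr (fun i : 'I_j => c i *: a i)); last first.
  by move=> i _; rewrite ltn_eqF.
move=> Pc; have ck0 : c j = 0.
  apply: contrapT => /eqP ck_neq0; case: (Nv (fun i => - (c j)^-1 * c i)).
  have := subspaceZ (c j)^-1 sP Pc.
  rewrite scalerDr scalerA mulVf // scale1r addrC scaler_sumr -sumrN.
  by congr (P (_ + _)); apply: eq_bigr => i _; rewrite scalerA mulNr scaleNr opprK.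
move=> i; rewrite ltnS leq_eqVlt => /predU1P[->//|].
by apply: (Pa c); move: Pc; rewrite ck0 scale0r addr0.
Qed.

Lemma indep2 P (a b : V) : subspace P ->
  ~ P a -> (forall c : R, ~ P (b - c *: a)) ->
  forall c e : R, P (c *: a + e *: b) -> c = 0 /\ e = 0.
Proof.
move=> sP Na Nb c e Pce; suff e0 : e = 0.
  split=> //; apply: contrapT => /eqP c0; apply: Na.
  have := subspaceZ c^-1 sP Pce.
  by rewrite e0 scale0r addr0 scalerA mulVf // scale1r.
apply: contrapT => /eqP e0; apply: (Nb (- (e^-1 * c))).
have := subspaceZ e^-1 sP Pce.
by rewrite scalerDr !scalerA mulVf // scale1r scaleNr opprK addrC.
Qed.
End Exchange.

(** * Growth of the codimensions *)

Section Macaulay.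
Variables (R : fieldType) (n : nat).
Implicit Types (f p q : {mpoly R[n]}).

Lemma notin_gen1 (J : {mpoly R[n]} -> Prop) e f : subspace J ->
  f \is e.+1.-homog -> ~ J f ->
  exists i, exists2 q, q \is e.-homog & ~ J ('X_i * q).
Proof.
move=> sJ /homog_gen [q qe ->] NJ; apply: contrapT => H; apply: NJ.
apply: subspace_sum => // i _; apply: contrapT => NJ.
by apply: H; exists i, (q i).
Qed.

Lemma subspace_mulr (J : {mpoly R[n]} -> Prop) p :
  subspace J -> subspace (fun q => J (p * q)).
Proof.
move=> [J0 JD]; split=> [|a u v Ju Jv]; first by rewrite mulr0.
by rewrite mulrDr -scalerAr; apply: JD.
Qed.

Lemma notin_gen2 (J : {mpoly R[n]} -> Prop) e f : subspace J ->
  f \is e.+2.-homog -> ~ J f ->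
  exists i j, exists2 q, q \is e.-homog & ~ J ('X_i * ('X_j * q)).
Proof.
move=> sJ /notin_gen1 H /H [//|i [q qe NJ]].
have [j [r re NJr]] := notin_gen1 (subspace_mulr 'X_i sJ) qe NJ.
by exists i, j, r.
Qed.

Lemma subspace_add1 (J : {mpoly R[n]} -> Prop) a : subspace J ->
  subspace (fun f => exists c : R, J (f - c *: a)).
Proof.
move=> sJ; split=> [|e u v [c Jc] [c' Jc']].
  by exists 0; rewrite scale0r subr0; case: sJ.
exists (e * c + c'); have [_ /(_ e _ _ Jc Jc')] := sJ.
by congr J; rewrite scalerDl scalerBr -scalerA opprD addrACA.
Qed.

(* If [a = x x' q1] and [b = y y' q2] span modulo [J], then one of
   [x], [x'], [y], [y'], [x + y] works as [M]. *)
Lemma codim2_restrict (J : {mpoly R[n]} -> Prop) k : subspace J ->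
  spans (fun f => is_true (f \is k.+2.-homog)) J 2 ->
  exists2 M : {mpoly R[n]}, M \is 1.-homog &
    forall f, f \is k.+2.-homog -> exists2 q, q \is k.+1.-homog & J (f - M * q).
Proof.
move=> sJ sp2; apply: contrapT => /forall2NP NM.
have {}NM (M : {mpoly R[n]}) : M \is 1.-homog ->
    ~ forall f, f \is k.+2.-homog -> exists2 q, q \is k.+1.-homog & J (f - M * q).
  by move=> M1; case: (NM M).
have [J0 JD] := sJ.
have [f /not_implyP [fk NJ]] : exists f, ~ (f \is k.+2.-homog -> J f).
  apply/existsNP => JH; apply: (NM 0); first exact: rpred0.
  by move=> f fk; exists 0; rewrite ?rpred0// mul0r subr0; apply: JH.
have [i [i' [q1 q1k Na]]] := notin_gen2 sJ fk NJ.
set a := 'X_i * _ in Na.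
have [g /not_implyP [gk NJg]] : exists g, ~ (g \is k.+2.-homog -> exists c : R, J (g - c *: a)).
  apply/existsNP => JH; apply: (NM 'X_i); first exact: homogX.
  move=> g /JH [c Jc]; exists (c *: ('X_i' * q1)); last by rewrite -scalerAr.
  by apply/rpredZ/homogXM.
have [j [j' [q2 q2k Nb]]] := notin_gen2 (subspace_add1 a sJ) gk NJg.
set b := 'X_j * _ in Nb.
have {}Nb (c : R) : ~ J (b - c *: a) by move=> Jc; apply: Nb; exists c.
have ind := indep2 sJ Na Nb.
have ab_gen v : v \is k.+2.-homog -> exists c e : R, J (v - (c *: a + e *: b)).
  move=> vk; pose m l := if l is 0 then a else b.
  have [|c|c] := indep_gen (a := m) sJ sp2 _ _ vk.
  - by case=> [|l] _; do 2?apply: homogXM.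
  - rewrite big_ord_recl big_ord1 /= => /ind [c0 c1] l.
    by case: l => [//|[|l]].
  by rewrite big_ord_recl big_ord1 /=; exists (c 0), (c 1).
have NS (y : 'I_n) (M r s : {mpoly R[n]}) : M \is 1.-homog ->
    r \is k.+1.-homog -> s \is k.+1.-homog ->
    J (a - M * r) -> J (b - M * s) -> False.
  move=> M1 rk sk Ja Jb; apply: (NM M) => // v /ab_gen [c [e Jv]].
  exists (c *: r + e *: s); first by rewrite rpredD ?rpredZ.
  have := subspaceD sJ Jv (JD c _ _ Ja (subspaceZ e sJ Jb)).
  by congr J; rewrite -!mul_mpolyC; ring.
(* If some [X_y * q] had a nonzero component along [b], then both [a] and [b] would be multiples of
   [X_y] modulo [J] and [M = X_y] would do. So multiplication by a factor of [a] lands on the line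
   of [a]. *)
have Ha y r : r \is k.+1.-homog -> 'X_y * r = a -> forall q, q \is k.+1.-homog ->
    exists c : R, J ('X_y * q - c *: a).
  move=> rk rE q qk; have [c [e Jq]] := ab_gen _ (homogXM y qk).
  have [e0|e0] := eqVneq e 0; first by exists c; rewrite e0 scale0r addr0 in Jq.
  case: (NS y 'X_y r (e^-1 *: (q - c *: r))) => //; first exact: homogX.
  - by rewrite rpredZ// rpredB// rpredZ.
  - by rewrite rE subrr.
  have := subspaceZ (- e^-1) sJ Jq.
  have ee : e^-1%:MP * e%:MP = 1 :> {mpoly R[n]} by rewrite -mpolyCM mulVf.
  by congr J; rewrite -rE -!mul_mpolyC mpolyCN; ring: ee.
have Hb y r : r \is k.+1.-homog -> 'X_y * r = b -> forall q, q \is k.+1.-homog ->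
    exists c : R, J ('X_y * q - c *: b).
  move=> rk rE q qk; have [c [e Jq]] := ab_gen _ (homogXM y qk).
  have [c0|c0] := eqVneq c 0; first by exists e; rewrite c0 scale0r add0r in Jq.
  case: (NS y 'X_y (c^-1 *: (q - e *: r)) r) => //; first exact: homogX.
  - by rewrite rpredZ// rpredB// rpredZ.
  - have := subspaceZ (- c^-1) sJ Jq.
    have cc : c^-1%:MP * c%:MP = 1 :> {mpoly R[n]} by rewrite -mpolyCM mulVf.
    by congr J; rewrite -rE -!mul_mpolyC mpolyCN; ring: cc.
  by rewrite rE subrr.
(* This product lies on the line of [a] and on the line of [b], hence in [J]. *)
have Hab y y' r s q : r \is k.+1.-homog -> s \is k.+1.-homog -> q \is k.-homog ->
    'X_y * r = a -> 'X_y' * s = b -> J ('X_y * ('X_y' * q)).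
  move=> rk sk qk rE sE.
  have [c Jc] := Ha y r rk rE _ (homogXM y' qk).
  have [e] := Hb y' s sk sE _ (homogXM y qk).
  rewrite mulrCA => Je; have [|c0 _] := ind c (- e); last first.
    by move: Jc; rewrite c0 scale0r subr0.
  have := subspaceB sJ Je Jc.
  by congr J; rewrite -!mul_mpolyC mpolyCN; ring.
(* The cross terms of [X_i + X_j] with the two cofactors lie in [J] by [Hab], so this linear form
   produces both [a] and [b]. *)
apply: (NS i ('X_i + 'X_j) ('X_i' * q1) ('X_j' * q2)).
- by rewrite rpredD ?homogX.
- exact: homogXM.
- exact: homogXM.
- rewrite (_ : _ - _ = 0 - 'X_j * ('X_i' * q1)); last by rewrite /a; ring.
  apply: subspaceB => //; rewrite mulrCA; apply: (Hab i' j ('X_i * q1) ('X_j' * q2)) => //.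
  + exact: homogXM.
  + exact: homogXM.
  + by rewrite mulrCA.
rewrite (_ : _ - _ = 0 - 'X_i * ('X_j' * q2)); last by rewrite /b; ring.
apply: subspaceB => //; apply: (Hab i j' ('X_i' * q1) ('X_j * q2)) => //; try exact: homogXM.
by rewrite mulrCA.
Qed.
End Macaulay.

Lemma max_nat (P : nat -> Prop) N : P 0%N -> (forall k, P k -> (k <= N)%N) ->
  exists k, P k /\ ~ P k.+1.
Proof.
move=> P0 PN; apply: contrapT => /forallNP H.
have PS k : P k -> P k.+1 by move=> Pk; apply: contrapT => NP; apply: (H k).
have : P N.+1 by elim: N.+1.
by move=> /PN; rewrite ltnn.
Qed.

Lemma nonroot (R : numDomainType) (p : {poly R}) : p != 0 -> exists2 t, t != 0 & p.[t] != 0.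
Proof.
move=> p0; apply: contrapT => /forall2NP H.
have X0 : 'X * p != 0 by rewrite mulf_neq0 ?polyX_eq0.
have := @max_poly_roots _ _ [seq i%:R | i <- iota 0 (size ('X * p)).+1] X0.
rewrite size_map size_iota ltnNge leqnSn => H'; suff : false by []; apply: H'.
  apply/allP => _ /mapP [i _ ->]; rewrite /root hornerM hornerX.
  have [->|i0] := eqVneq (i%:R : R) 0; first by rewrite mul0r.
  by case: (H i%:R) => [|/negP]; rewrite ?i0// negbK => /eqP->; rewrite mulr0.
rewrite map_inj_uniq ?iota_uniq // => i j /eqP.
by rewrite eqr_nat => /eqP.
Qed.

(** * The annihilator of a functional nonnegative on squares *)

Section Functional.
Variables (R : realType) (n D : nat) (lam : {scalar {mpoly R[n]}}).
Implicit Types (p q f g L : {mpoly R[n]}).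
Local Notation H k := (fun f : {mpoly R[n]} => is_true (f \is k.-homog)).

Hypothesis lam_homog : forall e f, f \is e.-homog -> e <> (2 * D)%N -> lam f = 0.

Definition ann p := forall q, lam (p * q) = 0.

Lemma ann_subspace : subspace ann.
Proof.
split=> [|a p q pa qa] r; first by rewrite mul0r linear0.
by rewrite mulrDl -scalerAl linearD linearZ /= pa qa mulr0 addr0.
Qed.
Hint Resolve ann_subspace : core.

Lemma annM p q : ann p -> ann (q * p).
Proof. by move=> pa r; rewrite [q * p]mulrC -mulrA pa. Qed.

Lemma ann_homog k e p : p \is k.-homog -> (k + e = 2 * D)%N ->
  (forall q, q \is e.-homog -> lam (p * q) = 0) -> ann p.
Proof.
move=> pk keD pe q; rewrite [q](@pihomog_partitionE _ _ mdeg (msize q)) //.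
rewrite mulr_sumr linear_sum big1 // => i _.
have [ie|ie] := eqVneq (i : nat) e; first by rewrite pe// -ie pihomogP.
rewrite (@lam_homog (k + i)) //; first by apply/dhomogM/pihomogP.
by rewrite -keD => /addnI /eqP; rewrite (negPf ie).
Qed.

Lemma ann_step k p : p \is k.-homog -> (k < 2 * D)%N ->
  (forall i, ann ('X_i * p)) -> ann p.
Proof.
move=> pk kD pX; apply: (ann_homog (e := (2 * D - k.+1).+1) pk).
  by rewrite -addSnnS subnKC.
move=> q /homog_gen [r rk ->]; rewrite mulr_sumr linear_sum big1 // => i _.
by rewrite mulrCA mulrA pX.
Qed.

Hypothesis psd : forall p, p \is D.-homog -> 0 <= lam (p * p).

(** As [lam (p * p) = 0], the value at the square of [t p + q] is affine in [t]. Being nonnegative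
    it has slope zero: otherwise [t = - (c + 1) / (2 b)] would give [-1]. *)
Lemma ann_sqr p : p \is D.-homog -> lam (p * p) = 0 -> ann p.
Proof.
move=> pD p0; apply: (ann_homog (e := D) pD); first by rewrite mul2n addnn.
move=> q qD.
pose b := lam (p * q); pose c := lam (q * q).
have E t : 0 <= c + t * (2 * b).
  have := psd (rpredD (rpredZ t pD) qD).
  suff -> : lam ((t *: p + q) * (t *: p + q)) = c + t * (2 * b) by [].
  have -> : (t *: p + q) * (t *: p + q) =
      (t * t) *: (p * p) + (2 * t) *: (p * q) + q * q.
    by rewrite -!mul_mpolyC !mpolyCM; ring.
  by rewrite 2!linearD 2!linearZ /= p0 -/b -/c; ring.
apply/eqP; rewrite -/b; apply/eqP; apply: contrapT => /eqP b0.
have := E (- (c + 1) / (2 * b)); rewrite mulfVK ?mulf_neq0 ?pnatr_eq0 //.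
by rewrite opprD addNKr oppr_ge0 ler10.
Qed.

(** Independence becomes the nonvanishing of a determinant, a polynomial condition that survives
    perturbation. Positivity enters through [ann_sqr]: a kernel vector of the Gram matrix gives an
    isotropic combination, which must then lie in the annihilator. *)
Lemma gram_indep k (u : nat -> {mpoly R[n]}) :
  (forall i, (i < k)%N -> u i \is D.-homog) ->
  (forall c : nat -> R, ann (\sum_(i < k) c i *: u i) ->
     forall i, (i < k)%N -> c i = 0) <->
  \det (\matrix_(i < k, j < k) lam (u i * u j)) != 0.
Proof.
move=> uD; set G := \matrix_(_, _) _.
have GE1 (c : nat -> R) j :
    (\row_(i < k) c i *m G) 0 j = lam ((\sum_(i < k) c i *: u i) * u j).
  rewrite !mxE mulr_suml linear_sum; apply: eq_bigr => l _.
  by rewrite !mxE -scalerAl linearZ.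
have GE2 (c : nat -> R) : lam ((\sum_(i < k) c i *: u i) * (\sum_(i < k) c i *: u i))
    = (\row_(i < k) c i *m G *m (\row_(i < k) c i)^T) 0 0.
  rewrite mulr_sumr linear_sum mxE; apply: eq_bigr => l _.
  by rewrite -scalerAr linearZ /= GE1 !mxE mulrC.
split=> [ind|det0 c ac].
  apply/negP => /det0P [c c0 cG]; case/negP: c0; apply/eqP/rowP => i; rewrite mxE.
  pose c' l := if insub l is Some j then c 0 j else 0.
  have cE : \row_(i < k) c' i = c.
    by apply/rowP => j; rewrite mxE /c' valK.
  have -> : c 0 i = c' i by rewrite /c' valK.
  refine (ind c' _ i (ltn_ord i)); apply: ann_sqr.
    by rewrite rpred_sum // => l _; rewrite rpredZ ?uD.
  by rewrite GE2 cE cG mul0mx mxE.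
have cG : \row_(i < k) c i *m G = 0.
  by apply/rowP => j; rewrite GE1 ac mxE.
have /rowP c0 : \row_(i < k) c i = 0.
  apply/eqP; apply: contraNT det0 => c0; apply/det0P.
  by exists (\row_(i < k) c i).
by move=> i ik; have := c0 (Ordinal ik); rewrite !mxE.
Qed.

(** The Gram determinant of the [u i + t v i] is a polynomial in [t] that is nonzero at 0, so it is
    nonzero at some [t != 0]. *)
Lemma indep_perturb k (u v : nat -> {mpoly R[n]}) :
  (forall i, (i < k)%N -> u i \is D.-homog /\ v i \is D.-homog) ->
  (forall c : nat -> R, ann (\sum_(i < k) c i *: u i) ->
     forall i, (i < k)%N -> c i = 0) ->
  exists2 t : R, t != 0 & forall c : nat -> R,
    ann (\sum_(i < k) c i *: (u i + t *: v i)) -> forall i, (i < k)%N -> c i = 0.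
Proof.
move=> uvD /gram_indep; move=> /(_ (fun i ik => (uvD i ik).1)) det0.
pose G := \matrix_(i < k, j < k) ((lam (u i * u j))%:P +
  (lam (u i * v j) + lam (v i * u j))%:P * 'X + (lam (v i * v j))%:P * 'X^2).
have GE t : (\det G).[t] = \det (\matrix_(i < k, j < k)
    lam ((u i + t *: v i) * (u j + t *: v j))).
  rewrite -horner_evalE -det_map_mx; congr (\det _); apply/matrixP => i j.
  rewrite !mxE /= /horner_eval !hornerE.
  have -> : (u i + t *: v i) * (u j + t *: v j) = u i * u j +
      t *: (u i * v j + v i * u j) + (t * t) *: (v i * v j).
    by rewrite -!mul_mpolyC !mpolyCM; ring.
  by rewrite 2!linearD 2!linearZ /= linearD /=; ring.
have G0 : \det G != 0.
  apply: contraNneq det0 => G0; have := GE 0; rewrite G0 horner0 => ->.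
  by apply/eqP; congr (\det _); apply/matrixP => i j; rewrite !mxE !scale0r !addr0.
have [t t0 Gt] := nonroot G0; exists t => //.
rewrite GE in Gt; apply: (proj2 (gram_indep (u := fun i => u i + t *: v i) _)) => //.
by move=> i /uvD [ui vi]; rewrite rpredD ?rpredZ.
Qed.

Variable N : nat.
Hypothesis rankN : forall k, indep (H D) ann k -> (k <= N)%N.

(* For [L] of maximal rank, [L p] in the annihilator makes every ['X_i p]
   orthogonal to [L R_(D-1)]; were ['X_i p] nonzero, perturbing [L] to
   [L + t 'X_i] would increase the rank. *)
Lemma exists_nzd e : D = e.+1 -> exists2 L, L \is 1.-homog &
  forall p, p \is e.-homog -> ann (L * p) -> ann p.
Proof.
move=> De; pose P k := exists2 L, L \is 1.-homog & indep (H e) (fun f => ann (L * f)) k.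
have mulD L f : L \is 1.-homog -> f \is e.-homog -> L * f \is D.-homog.
  by move=> L1 fe; rewrite De; apply: homogM1.
have [||k [[L L1 [f fe find]] NP]] := @max_nat P N.
- by exists 0; [exact: rpred0 | exists (fun=> 0) => // c _ []].
- move=> k [L L1 [f fe find]]; apply: rankN; exists (fun i => L * f i) => [i ik|c].
    exact/mulD/fe.
  under eq_bigr do rewrite scalerAr; rewrite -mulr_sumr; exact: find.
exists L => // p pe Lp; apply: contrapT => Np; apply: NP.
have [i NXp] : exists i, ~ ann ('X_i * p).
  apply/existsNP => H; apply: Np; apply: (ann_step pe) => //.
  by rewrite De mul2n -addnn ltn_addl.
have Xp0 : lam ('X_i * p * ('X_i * p)) != 0.
  by apply/eqP => /ann_sqr/NXp; apply; apply/mulD => //; exact: homogX.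
(* Modulo the annihilator, [L + t x_i] times the [f j] and [p] gives the [u j + t v j], up to the
   factor [t] on the last one, because [L p] is in the annihilator. *)
pose u j := if j == k then 'X_i * p else L * f j.
pose v j := if j == k then 0 else 'X_i * f j.
have uvD j : (j < k.+1)%N -> u j \is D.-homog /\ v j \is D.-homog.
  rewrite /u /v ltnS leq_eqVlt; case: eqP => [_ _|_ /= /fe fj].
    by split; [apply/mulD => //; exact: homogX | exact: rpred0].
  by split; apply/mulD => //; exact: homogX.
have sumk (c : nat -> R) (g : nat -> {mpoly R[n]}) a : (forall j, (j < k)%N -> g j = a * f j) ->
    \sum_(j < k) c j *: g j = a * \sum_(j < k) c j *: f j.
  by move=> ga; rewrite mulr_sumr; apply: eq_bigr => j _; rewrite ga// scalerAr.
have u_ind (c : nat -> R) : ann (\sum_(j < k.+1) c j *: u j) ->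
    forall j, (j < k.+1)%N -> c j = 0.
  rewrite big_ord_recr /= {2}/u eqxx (@sumk _ _ L); last first.
    by move=> j jk; rewrite /u ltn_eqF.
  set s := \sum_(j < k) _ => cs.
  have ck : c k = 0.
    have := cs ('X_i * p); rewrite mulrDl linearD /=.
    have -> : L * s * ('X_i * p) = L * p * ('X_i * s) by ring.
    rewrite Lp add0r -scalerAl linearZ /= => /eqP.
    by rewrite mulf_eq0 (negPf Xp0) orbF => /eqP.
  move=> j; rewrite ltnS leq_eqVlt => /predU1P[->//|jk].
  by apply: find jk; rewrite -/s; move: cs; rewrite ck scale0r addr0.
have [t t0 tind] := indep_perturb uvD u_ind.
exists (L + t *: 'X_i); first by rewrite rpredD ?rpredZ ?homogX.
exists (fun j => if j == k then p else f j) => [j|c].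
  by rewrite ltnS leq_eqVlt; case: eqP => //= _ /fe.
rewrite big_ord_recr /= eqxx (eq_bigr (fun j : 'I_k => c j *: f j)); last first.
  by move=> j _; rewrite ltn_eqF.
set s := \sum_(j < k) _ => cs.
(* The coefficient of [p] picks up the factor [t], as [(L + t x_i) p] is [t x_i p] modulo the
   annihilator. *)
pose c' j := if j == k then c k * t else c j.
have c'0 : forall j, (j < k.+1)%N -> c' j = 0.
  apply: tind; rewrite big_ord_recr /= {2}/c' {2}/u {2}/v eqxx scaler0 addr0.
  rewrite (eq_bigr (fun j : 'I_k => c j *: (u j + t *: v j))); last first.
    by move=> j _; rewrite /c' ltn_eqF.
  rewrite (_ : \sum_(j < k) _ = (L + t *: 'X_i) * s); last first.
    by apply: (sumk c (fun j => u j + t *: v j)) => j jk; rewrite /u /v ltn_eqF // mulrDl scalerAl.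
  have := subspaceB ann_subspace cs (subspaceZ (c k) ann_subspace Lp).
  by congr ann; rewrite -!mul_mpolyC mpolyCM; ring.
have ck : c k = 0.
  by have := c'0 k (leqnn _); rewrite /c' eqxx => /eqP; rewrite mulf_eq0 (negPf t0) orbF => /eqP.
move=> j; rewrite ltnS leq_eqVlt => /predU1P[->//|jk].
by have := c'0 j (ltnW jk); rewrite /c' ltn_eqF.
Qed.

(** * Dimension count along a nonzerodivisor *)

Section NonZeroDivisor.
Variables (e : nat) (L : {mpoly R[n]}).
Hypotheses (De : D = e.+1) (L1 : L \is 1.-homog).
Hypothesis L_nzd : forall p, p \is e.-homog -> ann (L * p) -> ann p.

(** Descending induction on the degree: with [L p], every [L x_i p] is in the annihilator, hence
    every [x_i p], and [ann_step] returns to [p]. *)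
Lemma nzd_lower k p : (k <= e)%N -> p \is k.-homog -> ann (L * p) -> ann p.
Proof.
move=> ke; rewrite -(subKn ke); elim: (e - k)%N (leq_subr k e) p => [|j IHj] je p.
  by rewrite subn0; apply: L_nzd.
move=> pk Lp; apply: (ann_step pk) => [|i].
  by rewrite De mul2n -addnn ltn_addl// ltnS leq_subr.
apply: IHj; [exact: ltnW | | by rewrite mulrCA; apply: annM].
by rewrite -(subnSK je); apply: homogXM.
Qed.

(* The part of degree [k.+1] of the ideal generated by [ann] and [L]. *)
Definition annL k f := exists2 q, q \is k.-homog & ann (f - L * q).

Lemma annL_subspace k : subspace (annL k).
Proof.
split=> [|a f g [p pk fp] [q qk gq]].
  by exists 0; [exact: rpred0 | rewrite mulr0 subr0; case: ann_subspace].
exists (a *: p + q); first by rewrite rpredD ?rpredZ.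
have [_ /(_ a _ _ fp gq)] := ann_subspace.
by congr ann; rewrite -!mul_mpolyC; ring.
Qed.

Lemma annLM k M f : M \is 1.-homog -> annL k f -> annL k.+1 (M * f).
Proof.
move=> M1 [q qk fq]; exists (M * q); first exact: homogM1.
by rewrite mulrCA -mulrBr; apply: annM.
Qed.

Lemma annL_L k q : q \is k.-homog -> annL k (L * q).
Proof. by move=> qk; exists q; rewrite // subrr; case: ann_subspace. Qed.

(** If [m = x_j r] spans a degree, then [x_i m = x_j (x_i r)] is a multiple of [x_j m] in the next
    one. *)
Lemma growth1 k : spans (H k.+1) (annL k) 1 -> spans (H k.+2) (annL k.+1) 1.
Proof.
move=> sp1; have sJ := annL_subspace k; have sJ' := annL_subspace k.+1.
have [JH|/existsNP [f /not_implyP [fk Nf]]] := pselect (forall f, H k.+1 f -> annL k f).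
  exists (fun=> 0) => [i _|f /homog_gen [q qk ->]]; first exact: rpred0.
  exists (fun=> 0); rewrite big_ord1 scaler0 subr0; apply: subspace_sum => // i _.
  by apply: annLM; [exact: homogX | exact: JH].
have [j [r rk Nr]] := notin_gen1 sJ fk Nf.
pose m := 'X_j * r; have mk : m \is k.+1.-homog by exact: homogXM.
have span_m g : g \is k.+1.-homog -> exists c : R, annL k (g - c *: m).
  move=> gk; have [|c|c] := indep_gen (a := fun=> m) sJ sp1 _ _ gk => //.
    rewrite big_ord1 => Jcm [|//] _; apply: contrapT => /eqP c0; apply: Nr.
    have := subspaceZ (c 0%N)^-1 sJ Jcm.
    by rewrite scalerA mulVf // scale1r.
  by rewrite big_ord1; exists (c 0%N).
exists (fun=> 'X_j * m) => [i _|g /homog_gen [s sk ->]]; first exact: homogXM.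
suff [c Jc] : exists c : R, annL k.+1 ((\sum_i 'X_i * s i) - c *: ('X_j * m)).
  by exists (fun=> c); rewrite big_ord1.
apply: (subspace_sum _ (subspace_add1 ('X_j * m) sJ')) => i _.
have [c Jc] := span_m _ (sk i); have [c' Jc'] := span_m _ (homogXM i rk).
exists (c * c').
have := subspaceD sJ' (annLM (homogX _ i) Jc) (subspaceZ c sJ' (annLM (homogX _ j) Jc')).
by congr annL; rewrite /m -!mul_mpolyC mpolyCM; ring.
Qed.

(** With [M] from [codim2_restrict], every form is some [M q], and [x_i (M q) = M (x_i q)] lies in
    the span of the [M m]. The statement starts in degree 2: from degree 1 to degree 2 the
    codimension can grow from 2 to 3. *)
Lemma growth2 k : spans (H k.+2) (annL k.+1) 2 -> spans (H k.+3) (annL k.+2) 2.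
Proof.
move=> sp2; have sJ := annL_subspace k.+1; have sJ' := annL_subspace k.+2.
have [M M1 Mgen] := codim2_restrict sJ sp2; have [m mk mE] := sp2.
exists (fun i => M * m i) => [i /mk|g /homog_gen [s sk ->]]; first exact: homogM1.
pose span_m f := exists c : nat -> R, annL k.+2 (f - \sum_(i < 2) c i *: (M * m i)).
suff : span_m (\sum_i 'X_i * s i) by [].
apply: subspace_sum => [|i _].
  split=> [|a u v [c Jc] [c' Jc']].
    by exists (fun=> 0); rewrite big1 ?subr0; [case: sJ' | move=> i; rewrite scale0r].
  exists (fun i => a * c i + c' i); have [_ /(_ a _ _ Jc Jc')] := sJ'.
  by congr annL; rewrite !big_ord_recl !big_ord0 -!mul_mpolyC !mpolyCD !mpolyCM; ring.
have [q qk Jq] := Mgen _ (sk i); have [c Jc] := mE _ (homogXM i qk).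
exists c; have := subspaceD sJ' (annLM (homogX _ i) Jq) (annLM M1 Jc).
by congr annL; rewrite !big_ord_recl !big_ord0 -!mul_mpolyC; ring.
Qed.

(** Multiplication by [L] is injective modulo the annihilator in degree [k], so an independent
    family there, multiplied by [L], can be joined to one that is independent modulo the multiples
    of [L]. *)
Lemma indep_step k a b : (k <= e)%N ->
  indep (H k) ann a -> indep (H k.+1) (annL k) b -> indep (H k.+1) ann (a + b).
Proof.
move=> ke [f fk find] [g gk gind].
exists (fun i => if (i < a)%N then L * f i else g (i - a)%N) => [i iab|c].
  by case: ltnP => ia; [exact/homogM1/fk | apply: gk; rewrite ltn_subLR].
rewrite big_split_ord /= (eq_bigr (fun i : 'I_a => L * (c i *: f i))); last first.
  by move=> i _; rewrite ltn_ord scalerAr.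
rewrite -mulr_sumr (eq_bigr (fun i : 'I_b => c (a + i)%N *: g i)); last first.
  by move=> i _; rewrite ltnNge leq_addr /= addKn.
set sf := \sum_(i < a) _; set sg := \sum_(i < b) _ => cs.
have sfk : sf \is k.-homog by apply: rpred_sum => i _; rewrite rpredZ ?fk.
have cg : forall i, (i < b)%N -> c (a + i)%N = 0.
  apply: (gind (fun i => c (a + i)%N)); exists (- sf); first by rewrite rpredN.
  by rewrite mulrN opprK addrC.
have cf : forall i, (i < a)%N -> c i = 0.
  apply: find; rewrite -/sf; apply: (nzd_lower ke sfk).
  move: cs; rewrite /sg big1 ?addr0 // => i _; by rewrite cg ?scale0r.
move=> i iab; have [/cf//|ai] := ltnP i a.
by rewrite -(subnKC ai) cg // ltn_subLR.
Qed.

Lemma not_ann1 : (exists f, f \is D.-homog /\ ~ ann f) -> indep (H 0) ann 1.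
Proof.
move=> [f [fD Nf]]; exists (fun=> 1) => [i _|c]; first exact: dhomog1.
rewrite big_ord1 => c1 [|//] _; apply: contrapT => /eqP c0; apply: Nf.
have := annM (p := c 0%N *: 1) ((c 0%N)^-1 *: f) c1.
by congr ann; rewrite -!mul_mpolyC mulr1 mulrAC -mpolyCM mulVf // mul1r.
Qed.

(* When [h 0 = 1], [c 1 >= 2] and [c i >= 3] for [2 <= i <= k], the rank in
   degree [k] is at least [3 k]. *)
Lemma indep_growth k : (1 <= k <= e)%N ->
  (exists f, f \is D.-homog /\ ~ ann f) ->
  ~ spans (H k) (annL k.-1) (if k == 1%N then 1 else 2) -> indep (H k) ann (3 * k).
Proof.
case: k => // k /andP [_ ke] nz; elim: k ke => [|k IHk] ke Nsp.
  apply: (@indep_step 0 1 2 (leq0n _)); first exact: not_ann1.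
  by apply: not_spans_indep => //; [exact: homog_subspace | exact: annL_subspace].
have H3 : indep (H k.+2) (annL k.+1) 3.
  by apply: not_spans_indep => //; [exact: homog_subspace | exact: annL_subspace].
have -> : (3 * k.+2 = 3 * k.+1 + 3)%N by lia.
apply: indep_step => //; first exact: ltnW.
apply: IHk; first exact: ltnW.
case: k ke Nsp H3 => [|k] ke Nsp _ sp; apply: Nsp => /=.
  by apply: spansW (growth1 sp); rewrite ?rpred0.
exact: growth2.
Qed.

End NonZeroDivisor.
End Functional.

(** * Base points from common eigenvectors *)

Section PointFunctional.
Variables (R : realType) (n : nat).
Local Notation C := R[i].
Local Notation ev z := (mmap (real_complex R) z).
Implicit Types (f q : {mpoly R[n]}) (z : 'I_n -> C).

Definition clinear (psi : {mpoly R[n]} -> C) :=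
  forall a f g, psi (a *: f + g) = real_complex R a * psi f + psi g.

Lemma clinear0 psi : clinear psi -> psi 0 = 0.
Proof.
move=> psiL; have := psiL 1 0 0; rewrite scale1r addr0 rmorph1 mul1r.
by move=> /eqP; rewrite -subr_eq0 opprD addrA subrr add0r oppr_eq0 => /eqP.
Qed.

Lemma clinear_sum psi I (r : seq I) (P : pred I) F : clinear psi ->
  psi (\sum_(i <- r | P i) F i) = \sum_(i <- r | P i) psi (F i).
Proof.
move=> psiL; apply: (big_morph psi _ (clinear0 psiL)) => f g.
by rewrite -[f]scale1r psiL rmorph1 mul1r scale1r.
Qed.

Lemma clinear_lam (lam : {scalar {mpoly R[n]}}) (I : finType) (v : I -> C) (w : I -> {mpoly R[n]}) :
  clinear (fun f => \sum_i v i * real_complex R (lam (f * w i))).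
Proof.
move=> a f g /=; rewrite mulr_sumr -big_split; apply: eq_bigr => i _ /=.
by rewrite mulrDl -scalerAl linearD linearZ /= rmorphD rmorphM mulrDr mulrCA.
Qed.

Lemma homogXn i k : ('X_i : {mpoly R[n]}) ^+ k \is k.-homog.
Proof. by have := dhomogMn k (homogX R i); rewrite mul1n. Qed.

Lemma evM1 z i f : ev z ('X_i * f) = z i * ev z f.
Proof. by rewrite rmorphM /= mmapX mmap1U. Qed.

(* A functional on forms of degree [e.+1] which factors as
   [psi (x_i q) = z_i theta q] is a multiple of the evaluation at [z]. *)
Lemma point_functional psi e z (theta : {mpoly R[n]} -> C) : clinear psi ->
  (forall i q, q \is e.-homog -> psi ('X_i * q) = z i * theta q) ->
  (exists2 f, f \is e.+1.-homog & psi f != 0) ->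
  (exists i, z i != 0) /\ (forall f, f \is e.+1.-homog -> psi f = 0 -> ev z f = 0).
Proof.
move=> psiL psiX [g ge pg].
have psi_gen f (q : 'I_n -> {mpoly R[n]}) k : f = \sum_i 'X_i * q i ->
    psi (k * f) = \sum_i psi ('X_i * (k * q i)).
  move=> ->; rewrite mulr_sumr clinear_sum //; apply: eq_bigr => i _.
  by rewrite mulrCA.
have [j zj] : exists j, z j != 0.
  apply: contrapT => /forallNP z0; case/negP: pg; apply/eqP.
  have [q qe gq] := homog_gen ge; rewrite -[g]mul1r (psi_gen _ _ _ gq).
  rewrite big1 // => i _; rewrite mul1r psiX //.
  by have /negP := z0 i; rewrite negbK => /eqP->; rewrite mul0r.
split=> [|f fe pf]; first by exists j.
(* Exchanging a factor [x_i] for [x_j] costs [z_i / z_j]. Doing so for all [k] factors of each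
   monomial of [f] leaves a power of [x_j] alone. *)
have key k : (k <= e.+1)%N -> forall f, f \is k.-homog ->
    psi ('X_j ^+ (e.+1 - k) * f) * z j ^+ k = ev z f * psi ('X_j ^+ e.+1).
  elim: k => [_|k IHk ke] h.
    move=> h0; have -> : h = h@_0%MM *: 1.
      apply/mpolyP => m; rewrite mcoeffZ mcoeff1; case: eqVneq => [->|m0].
        by rewrite mulr1.
      by rewrite mulr0 (dhomog_nemf_coeff h0) //= mdeg_eq0.
    rewrite subn0 -scalerAr -[_ *: _]addr0 psiL clinear0 // addr0 mulr1.
    by rewrite mmapZ rmorph1 !mulr1.
  move=> /homog_gen [q qk hq]; rewrite (psi_gen _ _ _ hq) hq rmorph_sum /=.
  rewrite !mulr_suml; apply: eq_bigr => i _; rewrite psiX; last first.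
    by have := dhomogM (homogXn j (e.+1 - k.+1)) (qk i); rewrite subSS subnK.
  rewrite evM1 -mulrA -mulrA -(IHk (ltnW ke) _ (qk i)); congr (_ * _).
  rewrite subSS (subSn (m := k)) // ['X_j ^+ _.+1]exprS -mulrA psiX.
    by rewrite exprS -mulrA mulrCA.
  by have := dhomogM (homogXn j (e - k)) (qk i); rewrite subnK.
have keyE h : h \is e.+1.-homog -> psi h * z j ^+ e.+1 = ev z h * psi ('X_j ^+ e.+1).
  by move=> he; have := key e.+1 (leqnn _) h he; rewrite subnn expr0 mul1r.
have := keyE _ fe; rewrite pf mul0r => /esym/eqP; rewrite mulf_eq0.
case/orP=> /eqP // p0; case/negP: pg.
have /eqP := keyE _ ge; rewrite p0 mulr0 mulf_eq0 expf_eq0 (negPf zj) andbF orbF.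
by [].
Qed.

End PointFunctional.

(** * Orthonormal families modulo the annihilator *)

Section Orthonormal.
Variables (R : realType) (n D N : nat) (lam : {scalar {mpoly R[n]}}).
Implicit Types (p q f g L : {mpoly R[n]}).
Local Notation H k := (fun f : {mpoly R[n]} => is_true (f \is k.-homog)).
Local Notation ann := (ann lam).
Hypothesis lam_homog : forall e f, f \is e.-homog -> e <> (2 * D)%N -> lam f = 0.
Hypothesis psd : forall p, p \is D.-homog -> 0 <= lam (p * p).
Hypothesis rankN : forall k, indep (H D) ann k -> (k <= N)%N.

Lemma lam_sum I (r : seq I) (P : pred I) (c : I -> R) F g :
  lam ((\sum_(i <- r | P i) c i *: F i) * g) = \sum_(i <- r | P i) c i * lam (F i * g).
Proof.
by rewrite mulr_suml linear_sum; apply: eq_bigr => i _; rewrite -scalerAl linearZ.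
Qed.

Lemma sum_delta k (c : nat -> R) j : (j < k)%N -> \sum_(i < k) c i * ((i : nat) == j)%:R = c j.
Proof.
move=> jk; rewrite (bigD1 (Ordinal jk)) //= eqxx mulr1 big1 ?addr0 // => i.
by rewrite -val_eqE /= => /negPf->; rewrite mulr0.
Qed.

(** An orthonormal family is independent, so [rankN] yields a maximal one. A remainder outside the
    annihilator has positive square by [ann_sqr]; normalized, it could be adjoined. *)
Lemma orthonormal_basis (Q : {mpoly R[n]} -> Prop) : subspace Q ->
  (forall f, Q f -> f \is D.-homog) ->
  exists r (P : nat -> {mpoly R[n]}), [/\ forall i, (i < r)%N -> Q (P i),
    forall i j, (i < r)%N -> (j < r)%N -> lam (P i * P j) = (i == j)%:R &
    forall f, Q f -> ann (f - \sum_(i < r) lam (f * P i) *: P i)].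
Proof.
move=> sQ QD; pose S r := exists2 P : nat -> {mpoly R[n]}, forall i, (i < r)%N -> Q (P i) &
  forall i j, (i < r)%N -> (j < r)%N -> lam (P i * P j) = (i == j)%:R.
have [||r [[P QP P1] NS]] := @max_nat S N.
- by exists (fun=> 0).
- move=> k [P QP P1]; apply: rankN; exists P => [i /QP/QD//|c ac i ik].
  have := ac (P i); rewrite lam_sum => <-.
  rewrite -[LHS](sum_delta _ ik); apply: eq_bigr => l _.
  by rewrite P1.
exists r, P; split=> // f Qf; set w := _ - _; apply: contrapT => Nw; apply: NS.
have Qw : Q w.
  by apply: subspaceB => //; apply: subspace_sum => // i _; apply: subspaceZ => //; apply: QP.
have wP j : (j < r)%N -> lam (w * P j) = 0.
  move=> jr; rewrite mulrBl linearB /= lam_sum.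
  rewrite (eq_bigr (fun i : 'I_r => lam (f * P i) * ((i : nat) == j)%:R)).
    by rewrite (sum_delta (fun i => lam (f * P i)) jr) subrr.
  by move=> i _; rewrite P1.
have w0 : 0 < lam (w * w).
  rewrite lt_neqAle psd ?QD // andbT; apply/eqP => /esym w0; apply: Nw.
  exact: (ann_sqr lam_homog psd (QD _ Qw) w0).
pose s := Num.sqrt (lam (w * w)).
have s0 : s != 0 by rewrite gt_eqF // sqrtr_gt0.
have ss : s * s = lam (w * w) by rewrite -expr2 sqr_sqrtr // ltW.
exists (fun i => if i == r then s^-1 *: w else P i) => [i|i j].
  by rewrite ltnS leq_eqVlt; case: eqP => [_ _|_ /= /QP//]; apply: subspaceZ.
rewrite ltnS leq_eqVlt [(j < _)%N]ltnS [(j <= _)%N]leq_eqVlt.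
case: (eqVneq i r) => [->|ir] /=; case: (eqVneq j r) => [->|jr] //=.
- by rewrite -scalerAl -scalerAr !linearZ /= -ss mulKf // mulVf // eqxx.
- by move=> _ jltr; rewrite -scalerAl linearZ /= wP // mulr0.
- by move=> iltr _; rewrite -scalerAr linearZ /= [_ * w]mulrC wP // mulr0 (negPf ir).
exact: P1.
Qed.

End Orthonormal.

(** * Multiplication by [x_i / L] *)

Section Operators.
Variables (R : realType) (n e N : nat) (lam : {scalar {mpoly R[n]}}).
Implicit Types (p q f g L : {mpoly R[n]}).
Local Notation D := e.+1.
Local Notation H k := (fun f : {mpoly R[n]} => is_true (f \is k.-homog)).
Local Notation ann := (ann lam).
Hypothesis lam_homog : forall e f, f \is e.-homog -> e <> (2 * D)%N -> lam f = 0.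
Hypothesis psd : forall p, p \is D.-homog -> 0 <= lam (p * p).
Hypothesis rankN : forall k, indep (H D) ann k -> (k <= N)%N.
Variable L : {mpoly R[n]}.
Hypothesis L1 : L \is 1.-homog.
Hypothesis L_nzd : forall p, p \is e.-homog -> ann (L * p) -> ann p.

(* The [L fp i] are an orthonormal basis of the multiples of [L] in degree [D]
   modulo [ann], and the [fu j] one of their orthogonal complement. *)
Record frame h c := Frame {
  fp : 'I_h -> {mpoly R[n]};
  fu : 'I_c -> {mpoly R[n]};
  fp_homog : forall i, fp i \is e.-homog;
  fu_homog : forall i, fu i \is D.-homog;
  fp_orth : forall i j, lam (L * fp i * (L * fp j)) = (i == j)%:R;
  fu_orth : forall i j, lam (fu i * fu j) = (i == j)%:R;
  fpu_orth : forall j q, q \is e.-homog -> lam (L * q * fu j) = 0;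
  fp_gen : forall q, q \is e.-homog ->
    ann (q - \sum_i lam (L * q * (L * fp i)) *: fp i);
  fu_gen : forall f, f \is D.-homog ->
    ann (f - \sum_i lam (f * (L * fp i)) *: (L * fp i) - \sum_j lam (f * fu j) *: fu j)
}.

Lemma frame_exists : exists h c, inhabited (frame h c).
Proof.
pose Q1 f := exists2 p, p \is e.-homog & f = L * p.
have sQ1 : subspace Q1.
  split=> [|a f g [p pe ->] [q qe ->]]; first by exists 0; rewrite ?rpred0// mulr0.
  by exists (a *: p + q); rewrite ?rpredD ?rpredZ// mulrDr scalerAr.
have Q1D f : Q1 f -> f \is D.-homog by case=> p pe ->; apply: homogM1.
have [h [P [QP P1 Pg]]] := orthonormal_basis lam_homog psd rankN sQ1 Q1D.
pose Q2 f := f \is D.-homog /\ forall q, q \is e.-homog -> lam (L * q * f) = 0.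
have sQ2 : subspace Q2.
  split=> [|a f g [fD f0] [gD g0]]; first by split=> [|q _]; rewrite ?rpred0// mulr0 linear0.
  split=> [|q qe]; first by rewrite rpredD ?rpredZ.
  by rewrite mulrDr -scalerAr linearD linearZ /= f0 // g0 // mulr0 addr0.
have Q2D f : Q2 f -> f \is D.-homog by case.
have [c [u [Qu u1 ug]]] := orthonormal_basis lam_homog psd rankN sQ2 Q2D.
have /boolp.choice [p pP] : forall i, exists q,
    (i < h)%N -> q \is e.-homog /\ P i = L * q.
  move=> i; have [/QP [q qe Pq]|_] := boolP (i < h)%N; first by exists q.
  by exists 0.
exists h, c; constructor.
have pE (i : 'I_h) : P i = L * p i by case: (pP i (ltn_ord i)).
have sumE f : \sum_(i < h) lam (f * (L * p i)) *: (L * p i) = \sum_(i < h) lam (f * P i) *: P i.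
  by apply: eq_bigr => i _; rewrite pE.
apply: (@Frame h c (fun i => p i) (fun i => u i)) => [i|i|i j|i j|j q qe|q qe|f fD].
- by case: (pP i (ltn_ord i)).
- by case: (Qu i (ltn_ord i)).
- by rewrite -!pE P1.
- by rewrite u1.
- by case: (Qu j (ltn_ord j)) => _; apply.
- apply: L_nzd; first by rewrite rpredB// rpred_sum// => i _;
    case: (pP i (ltn_ord i)) => *; rewrite rpredZ.
  have := Pg (L * q); rewrite -sumE mulrBr mulr_sumr.
  under [X in _ -> ann (_ - X)]eq_bigr do rewrite -scalerAr.
  by apply; exists q.
rewrite sumE; set g := f - _.
have Q2g : Q2 g.
  have sP : \sum_(i < h) lam (f * P i) *: P i \is D.-homog.
    by apply: rpred_sum => i _; rewrite rpredZ// Q1D//; apply: QP.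
  split; first by rewrite rpredB.
  move=> q qe; have := Pg (L * q) (ex_intro2 _ _ q qe erefl) g.
  rewrite mulrBl linearB /= lam_sum [X in _ - X]big1 ?subr0 // => i _.
  rewrite [P i * g]mulrC /g mulrBl linearB /= lam_sum.
  rewrite (eq_bigr (fun l : 'I_h => lam (f * P l) * ((l : nat) == i)%:R)).
    by rewrite (sum_delta (fun l => lam (f * P l)) (ltn_ord i)) subrr mulr0.
  by move=> l _; rewrite P1.
have := ug g Q2g; congr (ann (_ - _)); apply: eq_bigr => j _.
rewrite /g mulrBl linearB /= lam_sum big1 ?subr0 // => i _.
by case: (Qu j (ltn_ord j)) => _ u0; rewrite pE u0 ?mulr0 //; case: (pP i (ltn_ord i)).
Qed.

Local Notation C := R[i].
Local Notation ev z := (mmap (real_complex R) z).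

Definition base_point := exists z : 'I_n -> C, (exists i, z i != 0) /\
  forall f, f \is D.-homog -> ann f -> ev z f = 0.

Lemma base_pointP psi z (theta : {mpoly R[n]} -> C) : clinear psi ->
  (forall i q, q \is e.-homog -> psi ('X_i * q) = z i * theta q) ->
  (exists2 f, f \is D.-homog & psi f != 0) ->
  (forall f, f \is D.-homog -> ann f -> psi f = 0) -> base_point.
Proof.
move=> psiL psiX psi0 psi_ann.
have [z0 zf] := point_functional psiL psiX psi0.
by exists z; split=> // f fD /(psi_ann f fD); apply: zf.
Qed.

(** The functional [lam (f * u)] itself factors as [w i] times a function of [q], so the real point
    [w] is a base point. *)
Lemma base_point_rank1 u (w : 'I_n -> R) : u \is D.-homog -> ~ ann u ->
  (forall q, q \is e.-homog -> exists t, forall i, lam ('X_i * q * u) = w i * t) ->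
  base_point.
Proof.
move=> uD Nu uX.
have /boolp.choice [th thE] : forall q, exists t, q \is e.-homog ->
    forall i, lam ('X_i * q * u) = w i * t.
  move=> q; have [qe|_] := boolP (q \is e.-homog); last by exists 0.
  by have [t tE] := uX q qe; exists t.
pose psi f := \sum_(i < 1) 1 * real_complex R (lam (f * u)).
apply: (@base_pointP psi (fun i => real_complex R (w i)) (fun q => real_complex R (th q))).
- exact: (clinear_lam lam (fun=> 1) (fun=> u)).
- by move=> i q qe; rewrite /psi big_ord1 mul1r thE // rmorphM.
- exists u => //; rewrite /psi big_ord1 mul1r fmorph_eq0.
  by apply/eqP => /(ann_sqr lam_homog psd uD).
by move=> f _ af; rewrite /psi big_ord1 af rmorph0 mulr0.
Qed.

Section Frame.
Variables (h c : nat) (F : frame h c).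
Local Notation p := (fp F).
Local Notation u := (fu F).

Lemma parseval f g : f \is D.-homog -> g \is D.-homog -> lam (f * g) =
  \sum_i lam (f * (L * p i)) * lam (g * (L * p i)) + \sum_j lam (f * u j) * lam (g * u j).
Proof.
move=> fD gD; have := fu_gen F fD g; rewrite !mulrBl !linearB /= !lam_sum => /eqP.
rewrite -addrA -opprD subr_eq0 => /eqP ->.
by congr (_ + _); apply: eq_bigr => i _; rewrite [_ * g]mulrC.
Qed.

(** Row [k] of [opT] and [opA] together holds the coordinates of [x_i p_k], the image of [L p_k]
    under multiplication by [x_i / L], along the multiples of [L] and along the [fu j]. *)
Definition opT i : 'M[R]_h := \matrix_(k, l) lam ('X_i * p k * (L * p l)).
Definition opA i : 'M[R]_(h, c) := \matrix_(k, j) lam ('X_i * p k * u j).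

Lemma opT_sym i : (opT i)^T = opT i.
Proof. by apply/matrixP => k l; rewrite !mxE; congr (lam _); ring. Qed.

(** By Parseval both sides are the matrix of the [lam (x_i p_k x_j p_l)], symmetric in [i] and
    [j]. *)
Lemma op_comm i j : opT i *m opT j + opA i *m (opA j)^T =
  opT j *m opT i + opA j *m (opA i)^T.
Proof.
have E i' j' : opT i' *m opT j' + opA i' *m (opA j')^T =
    \matrix_(k, l) lam ('X_i' * p k * ('X_j' * p l)).
  apply/matrixP => k l; rewrite !mxE parseval ?homogXM ?fp_homog //.
  congr (_ + _); apply: eq_bigr => m _; last by rewrite !mxE.
  by rewrite -[in LHS](opT_sym j') !mxE.
by rewrite !E; apply/matrixP => k l; rewrite !mxE; congr (lam _); ring.
Qed.

(** The first [h] columns hold the [lam (x_i p_k w_t)], where [b] does not occur. Read there, a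
    common left eigenvector [v] says [psi (x_i q) = z_i psi (L q)], the factorization that
    [base_pointP] asks for. *)
Lemma base_point_commuting (b : 'I_n -> 'M[R]_c) : (0 < h + c)%N ->
  (forall i j, comm_mx (block_mx (opT i) (opA i) (opA i)^T (b i))
                       (block_mx (opT j) (opA j) (opA j)^T (b j))) ->
  base_point.
Proof.
move=> hc0 Xcomm; pose X i := block_mx (opT i) (opA i) (opA i)^T (b i).
pose XC i := map_mx (real_complex R) (X i).
have [|v v0 /allP vX] := common_eigenvector (As := [seq XC i | i <- enum 'I_n]) hc0.
  move=> _ _ /mapP [i _ ->] /mapP [j _ ->].
  by rewrite /comm_mx -!map_mxM /= -/(X i) -/(X j) (Xcomm i j).
have /boolp.choice [z zE] : forall i, exists a, v *m XC i = a *: v.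
  by move=> i; apply/sub_rVP/vX/map_f; rewrite mem_enum.
pose w t := match split t with inl k => L * p k | inr j => u j end.
pose psi f := \sum_t v 0 t * real_complex R (lam (f * w t)).
have wD t : w t \is D.-homog.
  by rewrite /w; case: split => k; [apply/homogM1/fp_homog | apply: fu_homog].
have ww s t : lam (w s * w t) = (s == t)%:R.
  rewrite /w -[s in s == t]splitK -[t in _ == t]splitK.
  case: (split s) => i; case: (split t) => j /=.
  - by rewrite fp_orth -val_eqE.
  - by rewrite fpu_orth ?fp_homog// -val_eqE /= ltn_eqF // ltn_addr.
  - by rewrite mulrC fpu_orth ?fp_homog// -val_eqE /= gtn_eqF // ltn_addr.
  - by rewrite fu_orth -[in RHS]val_eqE /= eqn_add2l.
have Xw i k t : X i t (lshift c k) = lam ('X_i * p k * w t).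
  rewrite /w; case: (fintype.splitP t) => j tj.
    rewrite (_ : t = lshift c j) ?block_mxEul; last exact: val_inj.
    by rewrite -opT_sym !mxE.
  rewrite (_ : t = rshift h j) ?block_mxEdl; last exact: val_inj.
  by rewrite !mxE.
apply: (@base_pointP psi z (fun q => \sum_l v 0 (lshift c l) *
    real_complex R (lam (L * q * (L * p l))))).
- exact: (clinear_lam lam (v 0) w).
- move=> i q qe; rewrite mulr_sumr.
  have XqE t : lam ('X_i * q * w t) = \sum_l lam (L * q * (L * p l)) * X i t (lshift c l).
    under eq_bigr do rewrite Xw.
    have := annM ('X_i) (fp_gen F qe) (w t).
    rewrite mulrBr mulrBl linearB /= => /eqP; rewrite subr_eq0 => /eqP ->.
    rewrite mulr_sumr mulr_suml linear_sum; apply: eq_bigr => l _.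
    by rewrite -scalerAr -scalerAl linearZ.
  rewrite /psi; under eq_bigr do rewrite XqE rmorph_sum mulr_sumr.
  rewrite exchange_big; apply: eq_bigr => l _ /=.
  have /rowP/(_ (lshift c l)) := zE i; rewrite !mxE => zl.
  rewrite [RHS]mulrA -zl mulr_suml; apply: eq_bigr => t _.
  by rewrite rmorphM mulrCA mulrC !mxE.
- have /rV0Pn [t vt] := v0; exists (w t) => //; congr (_ != 0): vt.
  rewrite /psi (bigD1 t) //= ww eqxx rmorph1 mulr1 big1 ?addr0 // => s st.
  by rewrite ww eq_sym (negPf st) rmorph0 mulr0.
by move=> f _ af; rewrite /psi big1 // => t _; rewrite af rmorph0 mulr0.
Qed.

End Frame.
End Operators.

(** * Commuting bordered matrices *)

Section CommutingExtension.
Variables (R : realFieldType) (n h : nat) (T : 'I_n -> 'M[R]_h) (r : 'I_n -> 'rV[R]_h).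
Hypothesis Tsym : forall i, (T i)^T = T i.
Hypothesis Tcomm : forall i j,
  T i *m T j + (r i)^T *m r j = T j *m T i + (r j)^T *m r i.

(** The upper left blocks agree by [Tcomm], the two scalar corners by symmetry of the dot product,
    and the off-diagonal blocks by the equation on [b] and its transpose. *)
Lemma comm_block (b : 'I_n -> R) :
  (forall i j, r j *m T i - r i *m T j = b i *: r j - b j *: r i) ->
  forall i j, comm_mx (block_mx (T i) (r i)^T (r i) (b i)%:M)
                      (block_mx (T j) (r j)^T (r j) (b j)%:M).
Proof.
move=> bP i j; rewrite /comm_mx !mulmx_block Tcomm !mul_scalar_mx !mul_mx_scalar.
have bE : r i *m T j + b i *: r j = r j *m T i + b j *: r i.
  by have /eqP := bP i j; rewrite subr_eq => /eqP ->; rewrite addrAC subrK addrC.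
have bEt := congr1 trmx bE; rewrite !linearD !linearZ /= !trmx_mul !Tsym in bEt.
rewrite bE; congr block_mx.
  by rewrite bEt.
rewrite -[b i *: _]mul_scalar_mx -[b j *: _]mul_scalar_mx -!scalar_mxM [b j * _]mulrC.
by congr (_ + _); apply/matrixP => x y; rewrite !ord1 !mxE;
  apply: eq_bigr => k _; rewrite !mxE mulrC.
Qed.

Definition bracket i j := r j *m T i - r i *m T j.

Lemma comm_bracket i j : T i *m T j - T j *m T i = (r j)^T *m r i - (r i)^T *m r j.
Proof. by apply/eqP; rewrite subr_eq addrAC -subr_eq opprK Tcomm addrC. Qed.

(** The Jacobi identity for the [T i], with each inner commutator replaced by the matrix of
    [comm_bracket], which involves only the rows [r]. *)
Lemma jacobi_bracket i j k :
  (r k)^T *m bracket i j + (bracket i j)^T *m r k +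
  ((r i)^T *m bracket j k + (bracket j k)^T *m r i) +
  ((r j)^T *m bracket k i + (bracket k i)^T *m r j) = 0.
Proof.
pose K i j := (r j)^T *m r i - (r i)^T *m r j.
have jac : (T k *m K i j - K i j *m T k) + (T i *m K j k - K j k *m T i) +
    (T j *m K k i - K k i *m T j) = 0.
  rewrite /K -!comm_bracket !mulmxBr !mulmxBl !mulmxA.
  by apply/matrixP => x y; rewrite !mxE; ring.
rewrite -[RHS]oppr0 -jac /K /bracket.
rewrite !mulmxBr !mulmxBl ![(_ - _)^T]linearB /= !trmx_mul !Tsym ?mulmxBr ?mulmxBl !mulmxA.
by apply/matrixP => x y; rewrite !mxE; ring.
Qed.

(* Pairing the Jacobi identity with the dual basis [d] shows that the brackets
   have no component outside the span and that their coefficients cohere. *)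
Lemma bracket3 (f : 'I_3 -> 'I_n) (d : 'I_3 -> 'cV[R]_h) :
  (forall k l, r (f k) *m d l = (k == l)%:R%:M) ->
  exists b : 'I_3 -> R, forall k l,
    bracket (f k) (f l) = b k *: r (f l) - b l *: r (f k).
Proof.
have := jacobi_bracket; have : forall i j, bracket i j = - bracket j i.
  by move=> i j; rewrite /bracket opprB.
move: bracket => br anti jac dual.
pose B k l m := (br (f k) (f l) *m d m) 0 0.
have bd k l m : br (f k) (f l) *m d m = (B k l m)%:M by rewrite [LHS]mx11_scalar.
have bdT k l m : (d m)^T *m (br (f k) (f l))^T = (B k l m)%:M.
  by rewrite -trmx_mul bd tr_scalar_mx.
have dT k l : (d l)^T *m (r (f k))^T = (k == l)%:R%:M.
  by rewrite -trmx_mul dual tr_scalar_mx.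
have E i j k : i != j -> j != k -> k != i ->
    br (f i) (f j) = - (B j k k *: r (f i)) - B k i k *: r (f j).
  move=> ij jk ki.
  have := congr1 (fun M => (d k)^T *m M) (jac (f i) (f j) (f k)).
  rewrite mulmx0 !mulmxDr !mulmxA !dT !bdT eqxx (negPf jk) eq_sym (negPf ki).
  rewrite !mul_scalar_mx /= mulr1n !mulr0n !scale0r scale1r !add0r => Eq.
  have Bk : B i j k = 0.
    have := congr1 (fun M : 'rV_h => (M *m d k) 0 0) Eq.
    rewrite !mulmxDl -!scalemxAl !dual eqxx (negPf jk) [i == k]eq_sym (negPf ki) bd.
    rewrite mul0mx !mxE eqxx /= !mulr1n !mulr0n !mulr0 !addr0 mulr1 => /eqP.
    by rewrite -mulr2n mulrn_eq0 /= => /eqP.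
  have /matrixP Eq' := Eq; apply/matrixP => x y; have := Eq' x y.
  by rewrite Bk !mxE; lra.
have coh i j k : i != j -> j != k -> k != i -> B j k k = - B i j i.
  move=> ij jk ki; rewrite {2}/B (E i j k) // mulmxBl mulNmx -!scalemxAl !dual.
  by rewrite eqxx [j == i]eq_sym (negPf ij) !mxE /= !mulr1n mulr0n mulr0 mulr1 subr0 opprK.
have coh2 i j k : i != j -> j != k -> k != i -> B k i k = - B i j j.
  move=> ij jk ki; rewrite {2}/B (E i j k) // mulmxBl mulNmx -!scalemxAl !dual.
  by rewrite eqxx (negPf ij) !mxE /= !mulr1n mulr0n mulr0 mulr1 oppr0 add0r opprK.
pose o (k : nat) : 'I_3 := inord k.
have oE (k : 'I_3) : [\/ k = o 0%N, k = o 1%N | k = o 2%N].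
  by case: k => -[|[|[|//]]] ?; [constructor 1|constructor 2|constructor 3];
     apply: val_inj; rewrite /= inordK.
have [n01 n12 n20] : [/\ o 0%N != o 1%N, o 1%N != o 2%N & o 2%N != o 0%N].
  by rewrite -!val_eqE /= !inordK.
have br0 i : br i i = 0.
  apply/matrixP => x y; have /matrixP/(_ x y) := anti i i.
  by rewrite !mxE => ?; lra.
have E01 := E _ _ _ n01 n12 n20.
have E12 := E _ _ _ n12 n20 n01.
have E20 := E _ _ _ n20 n01 n12.
have c1 := coh _ _ _ n01 n12 n20.
have c2 := coh2 _ _ _ n01 n12 n20.
have c3 := coh _ _ _ n12 n20 n01.
(* [b k] is the coefficient of [r l] in the bracket of [k] with its cyclic successor [l]; [coh] and
   [coh2] make the reading from the other neighbour agree. *)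
pose b (k : 'I_3) := nth 0 [:: B (o 0%N) (o 1%N) (o 1%N); B (o 1%N) (o 2%N) (o 2%N);
                              B (o 2%N) (o 0%N) (o 0%N)] k.
have b0 : b (o 0%N) = B (o 0%N) (o 1%N) (o 1%N) by rewrite /b inordK.
have b1 : b (o 1%N) = B (o 1%N) (o 2%N) (o 2%N) by rewrite /b inordK.
have b2 : b (o 2%N) = B (o 2%N) (o 0%N) (o 0%N) by rewrite /b inordK.
have F01 : br (f (o 0%N)) (f (o 1%N)) = b (o 0%N) *: r (f (o 1%N)) - b (o 1%N) *: r (f (o 0%N)).
  by rewrite E01 b0 b1 c2 scaleNr opprK addrC.
have F12 : br (f (o 1%N)) (f (o 2%N)) = b (o 1%N) *: r (f (o 2%N)) - b (o 2%N) *: r (f (o 1%N)).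
  by rewrite E12 b2 b1 c1 scaleNr addrC.
have F20 : br (f (o 2%N)) (f (o 0%N)) = b (o 2%N) *: r (f (o 0%N)) - b (o 0%N) *: r (f (o 2%N)).
  by rewrite E20 b0 b2 c3 scaleNr addrC.
exists b => k l; have [->|->|->] := oE k; have [->|->|->] := oE l;
  by rewrite ?br0 ?subrr ?F01 ?F12 ?F20 // anti ?F01 ?F12 ?F20 opprB.
Qed.

(* [T0] commutes with [T i] and [T j], hence with their commutator. *)
Lemma bracket_eigen (T0 : 'M[R]_h) (i j : 'I_n) (d1 d2 : 'cV[R]_h) :
  T0^T = T0 -> T0 *m T i = T i *m T0 -> T0 *m T j = T j *m T0 ->
  r i *m d1 = 1%:M -> r i *m d2 = 0 -> r j *m d1 = 0 -> r j *m d2 = 1%:M ->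
  let s := (r i *m T0 *m d1) 0 0 in r i *m T0 = s *: r i /\ r j *m T0 = s *: r j.
Proof.
move=> T0s T0i T0j i1 i2 j1 j2 s.
have K : T0 *m (T i *m T j - T j *m T i) = (T i *m T j - T j *m T i) *m T0.
  by rewrite mulmxBr mulmxBl !mulmxA T0i T0j -!mulmxA T0i T0j.
rewrite comm_bracket mulmxBr mulmxBl !mulmxA in K.
have KT k l : T0 *m (r k)^T *m r l = (r k *m T0)^T *m r l by rewrite trmx_mul T0s.
rewrite !KT -!mulmxA in K.
pose x k (d : 'cV[R]_h) := (r k *m T0 *m d) 0 0.
have xE k d : r k *m T0 *m d = (x k d)%:M by rewrite [LHS]mx11_scalar.
have xT k d : d^T *m (r k *m T0)^T = (x k d)%:M by rewrite -trmx_mul xE tr_scalar_mx.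
have K1 : r j *m T0 = x i d1 *: r j - x j d1 *: r i.
  have := congr1 (fun M => d1^T *m M) K.
  rewrite !mulmxBr ![d1^T *m (_ *m _)]mulmxA !xT -!trmx_mul i1 j1 trmx0 tr_scalar_mx.
  rewrite mul0mx mul1mx !mul_scalar_mx sub0r => /(congr1 -%R).
  by rewrite opprK opprB => ->.
have K2 : r i *m T0 = x j d2 *: r i - x i d2 *: r j.
  have := congr1 (fun M => d2^T *m M) K.
  rewrite !mulmxBr ![d2^T *m (_ *m _)]mulmxA !xT -!trmx_mul i2 j2 trmx0 tr_scalar_mx.
  by rewrite mul0mx mul1mx !mul_scalar_mx subr0 => ->.
have xj1 : x j d1 = 0.
  have : x j d1 = - x j d1.
    by rewrite {1}/x K1 mulmxBl -!scalemxAl j1 i1 scaler0 !mxE /= mulr1n mulr1 sub0r.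
  by move=> ?; lra.
have xi2 : x i d2 = 0.
  have : x i d2 = - x i d2.
    by rewrite {1}/x K2 mulmxBl -!scalemxAl j2 i2 scaler0 !mxE /= mulr1n mulr1 sub0r.
  by move=> ?; lra.
rewrite xi2 scale0r subr0 in K2; rewrite xj1 scale0r subr0 in K1.
have -> : s = x i d1 by [].
by split=> //; rewrite K2 {2}/x K2 -scalemxAl i1 !mxE /= mulr1n mulr1.
Qed.

Section Residual.
Variables (m : nat) (f : 'I_m -> 'I_n) (d : 'I_m -> 'cV[R]_h) (w : 'I_n -> 'I_m -> R).
Hypothesis m_gt1 : (1 < m)%N.
Hypothesis dual : forall k l, r (f k) *m d l = (k == l)%:R%:M.
Hypothesis wE : forall i, r i = \sum_k w i k *: r (f k).

(** The operator of the linear form [x_i - \sum_k w_k x_(f k)], whose border row is zero; this is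
    why it commutes with every [T j]. *)
Definition residual i := T i - \sum_k w i k *: T (f k).
Local Notation T0 := residual.

Lemma residual_sym i : (T0 i)^T = T0 i.
Proof.
rewrite linearB linear_sum /= Tsym; congr (_ - _).
by apply: eq_bigr => k _; rewrite linearZ /= Tsym.
Qed.

Lemma residual_comm i j : T0 i *m T j = T j *m T0 i.
Proof.
apply/eqP; rewrite -subr_eq0; apply/eqP.
transitivity ((T i *m T j - T j *m T i) -
    \sum_k w i k *: (T (f k) *m T j - T j *m T (f k))).
  under [in RHS]eq_bigr do rewrite scalerBr scalemxAl scalemxAr.
  rewrite sumrB -mulmx_suml -mulmx_sumr mulmxBl mulmxBr !opprB.
  by rewrite [_ - T j *m T i]addrC addrACA [- _ + _]addrC.
under eq_bigr do rewrite comm_bracket scalerBr scalemxAr scalemxAl -[w i _ *: (_^T)]linearZ /=.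
rewrite comm_bracket sumrB -mulmx_sumr -mulmx_suml -linear_sum /= -wE.
by rewrite subrr.
Qed.

Lemma residual_eigen i : exists s : R, forall k, r (f k) *m T0 i = s *: r (f k).
Proof.
pose k0 := Ordinal (ltnW m_gt1); pose k1 := Ordinal m_gt1.
have T0s := residual_sym i; have T0c := residual_comm i.
exists ((r (f k0) *m T0 i *m d k0) 0 0) => k.
have [->|kk0] := eqVneq k k0.
  have [] := @bracket_eigen (T0 i) (f k0) (f k1) (d k0) (d k1) T0s (T0c _) (T0c _);
    by rewrite ?dual ?eqxx //= ?raddf0.
have [||||_ //] := @bracket_eigen (T0 i) (f k0) (f k) (d k0) (d k) T0s (T0c _) (T0c _).
- by rewrite dual eqxx.
- by rewrite dual eq_sym (negPf kk0) raddf0.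
- by rewrite dual (negPf kk0) raddf0.
- by rewrite dual eqxx.
Qed.

(** [T i] is a combination of the [T (f k)] plus the residual, which acts on all the rows as one
    scalar [s i]. Bilinearity then dictates [b' i = \sum_k w i k * b k + s i]. *)
Lemma bracket_extend (b : 'I_m -> R) :
  (forall k l, bracket (f k) (f l) = b k *: r (f l) - b l *: r (f k)) ->
  exists b' : 'I_n -> R, forall i j, bracket i j = b' i *: r j - b' j *: r i.
Proof.
move=> bE; have /boolp.choice [s sE] := residual_eigen.
exists (fun i => \sum_k w i k * b k + s i) => i j.
have rT i' j' : r j' *m T i' = \sum_k \sum_l (w i' k * w j' l) *: (r (f l) *m T (f k)) + s i' *: r j'.
  have TE : T i' = \sum_k w i' k *: T (f k) + T0 i' by rewrite addrC subrK.
  rewrite TE mulmxDr mulmx_sumr; congr (_ + _).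
    apply: eq_bigr => k _; rewrite {1}(wE j') mulmx_suml; apply: eq_bigr => l _.
    by rewrite -scalemxAl -scalemxAr scalerA mulrC.
  rewrite [in LHS](wE j') [in RHS](wE j') mulmx_suml scaler_sumr; apply: eq_bigr => l _.
  by rewrite -scalemxAl sE !scalerA mulrC.
rewrite /bracket !rT [X in _ - (X + _)]exchange_big /=.
transitivity (\sum_k \sum_l (w i k * w j l) *: bracket (f k) (f l) + s i *: r j - s j *: r i).
  rewrite opprD addrACA -sumrB addrA; congr (_ + _ - _); apply: eq_bigr => k _.
  by rewrite -sumrB; apply: eq_bigr => l _; rewrite /bracket scalerBr [w j _ * _]mulrC.
have -> : \sum_k \sum_l (w i k * w j l) *: bracket (f k) (f l) =
    (\sum_k w i k * b k) *: r j - (\sum_l w j l * b l) *: r i.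
  rewrite [in RHS](wE j) [in RHS](wE i) !scaler_suml.
  transitivity (\sum_k \sum_l (w i k * b k * w j l) *: r (f l) -
                \sum_k \sum_l (w i k * (w j l * b l)) *: r (f k)).
    rewrite -sumrB; apply: eq_bigr => k _; rewrite -sumrB; apply: eq_bigr => l _.
    by rewrite bE scalerBr !scalerA mulrAC mulrA.
  congr (_ - _).
    by apply: eq_bigr => k _; rewrite scaler_sumr; apply: eq_bigr => l _; rewrite scalerA.
  rewrite exchange_big; apply: eq_bigr => l _; rewrite scaler_sumr.
  by apply: eq_bigr => k _; rewrite scalerA mulrC.
by rewrite !scalerDl opprD addrACA addrA.
Qed.

End Residual.

End CommutingExtension.

(** * Small codimension modulo a linear form *)

Section SmallCorank.
Variables (R : realType) (n e N : nat) (lam : {scalar {mpoly R[n]}}).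
Implicit Types (p q f g L : {mpoly R[n]}).
Local Notation D := e.+2.
Local Notation H k := (fun f : {mpoly R[n]} => is_true (f \is k.-homog)).
Local Notation ann := (ann lam).
Hypothesis lam_homog : forall e f, f \is e.-homog -> e <> (2 * D)%N -> lam f = 0.
Hypothesis psd : forall p, p \is D.-homog -> 0 <= lam (p * p).
Hypothesis rankN : forall k, indep (H D) ann k -> (k <= N)%N.
Variable L : {mpoly R[n]}.
Hypothesis L1 : L \is 1.-homog.
Hypothesis L_nzd : forall p, p \is e.+1.-homog -> ann (L * p) -> ann p.
Local Notation annL := (annL lam L).
Local Notation base_point := (base_point e.+1 lam).

(** * Complement of dimension one *)

Section Corank1.
Variables (h : nat) (F : frame e.+1 lam L h 1).
Local Notation p := (fp F).
Local Notation u := (fu F ord0).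
Local Notation T := (opT F).
Let r i := (opA F i)^T.

Lemma opT1_comm i j : T i *m T j + (r i)^T *m r j = T j *m T i + (r j)^T *m r i.
Proof. by rewrite !trmxK op_comm. Qed.

Lemma base_point_bracket (b : 'I_n -> R) :
  (forall i j, bracket T r i j = b i *: r j - b j *: r i) -> base_point.
Proof.
move=> bE; apply: (base_point_commuting L1 (F := F) (b := fun i => (b i)%:M)).
  by rewrite addn1.
move=> i j; have := comm_block (opT_sym F) opT1_comm bE i j.
by rewrite !trmxK.
Qed.

Definition coord q : 'cV[R]_h := \col_k lam (L * q * (L * p k)).

Lemma coord_sum I (s : seq I) (c : I -> R) G :
  coord (\sum_(i <- s) c i *: G i) = \sum_(i <- s) c i *: coord (G i).
Proof.
apply/colP => k; rewrite summxE mxE mulr_sumr mulr_suml linear_sum.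
by apply: eq_bigr => i _; rewrite !mxE -scalerAr -scalerAl linearZ.
Qed.

Lemma coordB q1 q2 : coord (q1 - q2) = coord q1 - coord q2.
Proof. by apply/colP => k; rewrite !mxE mulrBr mulrBl linearB. Qed.

Lemma coordZ a q : coord (a *: q) = a *: coord q.
Proof. by apply/colP => k; rewrite !mxE -scalerAr -scalerAl linearZ. Qed.

Lemma coord_ann q : ann q -> coord q = 0.
Proof. by move=> aq; apply/colP => k; rewrite !mxE (annM L aq). Qed.

Lemma coord_eq0 q : q \is e.+1.-homog -> coord q = 0 -> ann q.
Proof.
move=> qe /colP k0; have := fp_gen F qe.
by rewrite big1 ?subr0 // => i _; have := k0 i; rewrite !mxE => ->; rewrite scale0r.
Qed.

Lemma coord_fp l : coord (p l) = delta_mx l 0.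
Proof. by apply/colP => k; rewrite !mxE fp_orth eqxx andbT eq_sym. Qed.

Lemma mul_r_coord i q : q \is e.+1.-homog -> r i *m coord q = (lam ('X_i * q * u))%:M.
Proof.
move=> qe; rewrite [LHS]mx11_scalar; congr (_%:M); rewrite mxE.
have := annM 'X_i (fp_gen F qe) u; rewrite mulrBr mulrBl linearB /= => /eqP.
rewrite subr_eq0 => /eqP ->; rewrite mulr_sumr mulr_suml linear_sum.
apply: eq_bigr => l _; rewrite !mxE -scalerAr -scalerAl linearZ /=.
by rewrite mulrC.
Qed.

Lemma mul_T_coord i s : s \is e.-homog -> T i *m coord (L * s) = coord ('X_i * s).
Proof.
move=> se; apply/colP => k; rewrite !mxE.
have Ls : L * s \is e.+1.-homog by exact: homogM1.
have := annM ('X_i * (L * p k)) (fp_gen F Ls) 1; rewrite mulrBr mulrBl linearB /= => /eqP.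
rewrite subr_eq0 !mulr1 => /eqP Eq.
transitivity (lam ('X_i * (L * p k) * (L * s))); last by congr (lam _); ring.
rewrite Eq mulr_sumr linear_sum; apply: eq_bigr => l _.
rewrite !mxE -scalerAr linearZ /= mulrC; congr (_ * lam _); ring.
Qed.

(* The functionals on degree [e.+1], in coordinates, which vanish on multiples
   of [L]. *)
Definition annE (v : 'rV[R]_h) := forall f, annL e f -> f \is e.+1.-homog -> v *m coord f = 0.

Lemma annEP (v : 'rV[R]_h) : (forall s, s \is e.-homog -> v *m coord (L * s) = 0) -> annE v.
Proof.
move=> v0 f [s se af] fe; have := coord_ann af; rewrite coordB => /eqP.
by rewrite subr_eq0 => /eqP ->; apply: v0.
Qed.

Lemma annE_r i : annE (r i).
Proof.
apply: annEP => s se; rewrite mul_r_coord; last exact: homogM1.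
by rewrite mulrCA fpu_orth ?raddf0 //; apply: homogXM.
Qed.

(** On [coord (L * s)] both terms evaluate to [lam (x_i x_j s u)] and cancel. *)
Lemma annE_bracket i j : annE (bracket T r i j).
Proof.
apply: annEP => s se; rewrite mulmxBl -!mulmxA !mul_T_coord //.
rewrite !mul_r_coord; try exact: homogXM.
by rewrite [in X in _ - X]mulrCA subrr.
Qed.

Lemma annE_sub m (A : 'M[R]_(m, h)) (v : 'rV[R]_h) :
  (forall k, annE (row k A)) -> (v <= A)%MS -> annE v.
Proof.
move=> EA /submxP [c ->] f Jf fe; rewrite -mulmxA.
rewrite (_ : A *m coord f = 0) ?mulmx0 //; apply/row_matrixP => k.
by rewrite row_mul EA // row0.
Qed.

(** [annE] is dual to degree [e+1] modulo [annL e]: a spanning family of size [j] gives a matrix [K]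
    injective on it, which bounds its dimension by [j]. *)
Lemma annE_gen j m (A : 'M[R]_(m, h)) : spans (H e.+1) (annL e) j ->
  row_free A -> (forall k, annE (row k A)) ->
  (m <= j)%N /\ (m = j -> forall v, annE v -> (v <= A)%MS).
Proof.
move=> [mm mk mE] Afree EA.
pose K := \matrix_(k < h, l < j) coord (mm l) k 0.
have E0 (v : 'rV[R]_h) : annE v -> v *m K = 0 -> v = 0.
  move=> Ev vK; apply/rowP => k; rewrite mxE.
  have [c Jc] := mE _ (fp_homog F k).
  have sk : \sum_(i < j) c i *: mm i \is e.+1.-homog.
    by apply: rpred_sum => i _; rewrite rpredZ ?mk.
  have := Ev _ Jc (rpredB (fp_homog F k) sk).
  rewrite coordB coord_fp mulmxBr coord_sum mulmx_sumr [X in _ - X]big1 ?subr0.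
    by move=> /matrixP/(_ 0 0); rewrite -colE !mxE.
  move=> l _; rewrite -scalemxAr (_ : v *m coord (mm l) = 0) ?scaler0 //.
  apply/matrixP => x y; rewrite !ord1; have /rowP/(_ l) := vK; rewrite !mxE => vKl.
  by rewrite -[RHS]vKl; apply: eq_bigr => t _; rewrite !mxE.
have AKfree : row_free (A *m K).
  apply: inj_row_free => c; rewrite mulmxA => cAK.
  have /(congr1 (fun M => M *m pinvmx A)) := E0 _ (annE_sub EA (submxMl c A)) cAK.
  by rewrite -mulmxA mulmxVp // mulmx1 mul0mx.
have mj : (m <= j)%N by move: AKfree; rewrite /row_free => /eqP <-; apply: rank_leq_col.
split=> // mEj v Ev; subst j.
have AKu : A *m K \in unitmx by rewrite -row_free_unit.
have := E0 (v - v *m K *m invmx (A *m K) *m A).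
rewrite mulmxBl -!mulmxA mulVmx // mulmx1 subrr => /(_ _ erefl) vE.
have -> : v = v *m K *m invmx (A *m K) *m A.
  apply/eqP; rewrite -subr_eq0; apply/eqP; rewrite -!mulmxA; apply: vE.
  move=> f Jf fe; rewrite mulmxBl Ev // sub0r !mulmxA.
  by rewrite (annE_sub EA (submxMl _ A)) // oppr0.
exact: submxMl.
Qed.

Lemma r_basis : exists m (f : 'I_m -> 'I_n) (w : 'I_n -> 'I_m -> R),
  row_free (\matrix_k r (f k)) /\ forall i, r i = \sum_k w i k *: r (f k).
Proof.
pose M := \matrix_i r i; exists (\rank M), (maxrankfun M).
have AE : \matrix_k r (maxrankfun M k) = rowsub (maxrankfun M) M.
  by apply/row_matrixP => k; rewrite rowK row_rowsub rowK.
have /boolp.choice [w wE] : forall i, exists w : 'I_(\rank M) -> R,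
    r i = \sum_k w k *: r (maxrankfun M k).
  move=> i; have : (r i <= rowsub (maxrankfun M) M)%MS.
    by rewrite eq_maxrowsub -[r i](rowK r) row_sub.
  case/submxP => c rc; exists (c 0); rewrite {1}rc mulmx_sum_row.
  by apply: eq_bigr => k _; rewrite row_rowsub rowK.
by exists w; rewrite AE maxrowsub_free.
Qed.

Lemma r_dual m (f : 'I_m -> 'I_n) : row_free (\matrix_k r (f k)) ->
  exists d : 'I_m -> 'cV[R]_h, forall k l, r (f k) *m d l = (k == l)%:R%:M.
Proof.
move=> fr; exists (fun l => col l (pinvmx (\matrix_k r (f k)))) => k l.
have := congr1 (row k) (mulmxVp fr); rewrite row_mul rowK row1 colE.
rewrite (mulmxA _ (pinvmx _)) => ->.
rewrite mul_delta_mx_cond; apply/matrixP => x y; rewrite !ord1 !mxE.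
by case: (k == l); rewrite ?mulr1n ?mulr0n ?mxE.
Qed.

Lemma corank1_rank_le1 m (f : 'I_m -> 'I_n) w : (m <= 1)%N ->
  (forall i, r i = \sum_k w i k *: r (f k)) -> base_point.
Proof.
move=> m1 wE; have uD := fu_homog F ord0.
have Nu : ~ ann u.
  by move=> /(_ u) /eqP; rewrite fu_orth eqxx oner_eq0.
have [w0 [t0 wt]] : exists w0 (t0 : 'rV[R]_h), forall i, r i = w0 i *: t0.
  case: m m1 f w wE => [|[|//]] _ f w wE.
    by exists (fun=> 0), 0 => i; rewrite wE big_ord0 scaler0.
  by exists (fun i => w i ord0), (r (f ord0)) => i; rewrite wE big_ord1.
apply: (base_point_rank1 lam_homog psd (w := w0) uD Nu) => q qe.
exists ((t0 *m coord q) 0 0) => i; have := mul_r_coord i qe.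
by rewrite wt -scalemxAl => /matrixP/(_ 0 0); rewrite !mxE eqxx mulr1n => <-.
Qed.

(** Two independent rows have a single bracket up to sign; once it lies in their plane, its two
    coordinates are the required [b]. *)
Lemma corank1_rank2 (f : 'I_2 -> 'I_n) w : row_free (\matrix_k r (f k)) ->
  (forall i, r i = \sum_k w i k *: r (f k)) ->
  (bracket T r (f ord0) (f ord_max) <= \matrix_k r (f k))%MS -> base_point.
Proof.
move=> fr wE /submxP [c cE]; have [d dual] := r_dual fr.
rewrite mulmx_sum_row big_ord_recl big_ord1 !rowK in cE.
rewrite (_ : lift _ _ = ord_max) in cE; last exact: val_inj.
pose b (k : 'I_2) := if k == ord0 then c 0 ord_max else - c 0 ord0.
have br0 i : bracket T r i i = 0 by rewrite /bracket subrr.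
have brN i j : bracket T r i j = - bracket T r j i by rewrite /bracket opprB.
have ord2 (k : 'I_2) : k = ord0 \/ k = ord_max.
  by case: k => -[|[|//]] ?; [left|right]; apply: val_inj.
have [|b' bE] := bracket_extend (opT_sym F) opT1_comm (isT : (1 < 2)%N) dual wE (b := b).
  move=> k l; case: (ord2 k) => ->; case: (ord2 l) => ->; rewrite ?br0 ?subrr //.
    by rewrite cE /b /= scaleNr opprK addrC.
  by rewrite brN cE /b /= scaleNr opprD addrC.
exact: base_point_bracket bE.
Qed.

Lemma corank1_rank3 (f : 'I_3 -> 'I_n) w : row_free (\matrix_k r (f k)) ->
  (forall i, r i = \sum_k w i k *: r (f k)) -> base_point.
Proof.
move=> fr wE; have [d dual] := r_dual fr.
have [b bE] := bracket3 (opT_sym F) opT1_comm dual.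
have [b'] := bracket_extend (opT_sym F) opT1_comm (isT : (1 < 3)%N) dual wE bE.
exact: base_point_bracket.
Qed.

(* If the bracket is not in the plane spanned by the [r i], then [annE] is
   spanned by eigenvectors of every residual operator [T0] for one eigenvalue;
   its orthogonal line is stable too, so [T0 (coord L)] is a multiple of [coord L]. *)
Lemma corank1_rank2_span (f : 'I_2 -> 'I_n) w : e = 0%N -> row_free (\matrix_k r (f k)) ->
  (forall i, r i = \sum_k w i k *: r (f k)) ->
  spans (H e.+1) (annL e) 3 -> ~ spans (H e.+1) (annL e) 2 ->
  (bracket T r (f ord0) (f ord_max) <= \matrix_k r (f k))%MS.
Proof.
move=> e0 fr wE sp3 Nsp2; apply: contrapT => /negP Nb; apply: Nsp2.
have [d dual] := r_dual fr; set b := bracket _ _ _ _ in Nb.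
pose A := \matrix_k r (f k).
have Bfree : row_free (col_mx A b).
  apply: inj_row_free => v; rewrite -[v]hsubmxK mul_row_col => vAb.
  have v1 : rsubmx v = 0.
    apply: contraNeq Nb => v1.
    have v10 : v 0 (rshift 2 ord0) != 0.
      apply: contra v1 => /eqP v10; apply/eqP/matrixP => x y.
      by rewrite !ord1 !mxE v10.
    have rv : rsubmx v = (v 0 (rshift 2 ord0))%:M.
      by rewrite [LHS]mx11_scalar; congr (_%:M); rewrite !mxE.
    move: vAb; rewrite rv mul_scalar_mx => /eqP.
    rewrite addr_eq0 eq_sym eqr_oppLR => /eqP /(congr1 (fun M => (v 0 (rshift 2 ord0))^-1 *: M)).
    rewrite scalerA mulVf // scale1r => ->.
    by rewrite -scaleN1r !scalemx_sub // submxMl.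
  move: vAb; rewrite v1 mul0mx addr0 => /(congr1 (fun M => M *m pinvmx A)).
  by rewrite -mulmxA mulmxVp // mulmx1 mul0mx => ->; rewrite row_mx0.
have EB k : annE (row k (col_mx A b)).
  rewrite -[k]splitK; case: (split k) => l /=.
    by rewrite rowKu rowK; apply: annE_r.
  by rewrite rowKd row_id; apply: annE_bracket.
have [_ /(_ erefl) Bgen] := annE_gen sp3 Bfree EB.
have := residual_eigen (opT_sym F) opT1_comm (isT : (1 < 2)%N) dual wE.
move=> /boolp.choice [s sE]; have T0c := residual_comm opT1_comm wE.
pose T0 := residual T f w.
have ET0 v i : annE v -> v *m T0 i = s i *: v.
  move=> /Bgen /submxP [c ->]; rewrite -mulmxA mul_col_mx.
  have -> : A *m T0 i = s i *: A.
    by apply/row_matrixP => k; rewrite row_mul linearZ /= rowK sE.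
  have -> : b *m T0 i = s i *: b.
    by rewrite mulmxBl -!mulmxA -!T0c !mulmxA !sE -!scalemxAl -scalerBr.
  by rewrite -scale_col_mx -scalemxAr.
have H1 : (1 : {mpoly R[n]}) \is e.-homog by rewrite e0 dhomog1.
pose y i := 'X_i - \sum_k w i k *: 'X_(f k).
have yE i : T0 i *m coord L = coord (y i).
  have TX j : T j *m coord L = coord 'X_j.
    by have := mul_T_coord j H1; rewrite !mulr1.
  rewrite mulmxBl coordB TX coord_sum mulmx_suml; congr (_ - _).
  by apply: eq_bigr => k _; rewrite -scalemxAl TX.
have EL v : annE v -> v *m coord L = 0.
  move=> Ev; apply: Ev; last by rewrite e0.
  by have := annL_L lam L H1; rewrite mulr1.
have LE v : v *m coord L = 0 -> annE v.
  move=> vL; apply: annEP => g ge.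
  have -> : g = g@_0%MM *: 1.
    apply/mpolyP => m; rewrite mcoeffZ mcoeff1; case: eqVneq => [->|m0].
      by rewrite mulr1.
    by rewrite mulr0 (dhomog_nemf_coeff ge) //= e0 mdeg_eq0.
  by rewrite -scalerAr mulr1 coordZ -scalemxAr vL scaler0.
have sqr0 (x : 'cV[R]_h) : x^T *m x = 0 -> x = 0.
  move=> /matrixP/(_ 0 0); rewrite !mxE => /psumr_eq0P xx.
  apply/colP => k; have := xx _ k isT; rewrite !mxE => x0; apply/eqP.
  by rewrite -sqrf_eq0 expr2 x0 // => l _; rewrite !mxE -expr2 sqr_ge0.
(* With [t] from the orthogonal projection, the remainder [v] is orthogonal to [coord L], so it is
   in [annE] and an eigenvector of [T0 i]. Then [v] pairs to zero with
   [T0 i *m coord L = coord (y i)] too, so [v] is orthogonal to itself. *)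
have yL i : exists t, coord (y i - t *: L) = 0.
  pose t := ((coord L)^T *m coord (y i)) 0 0 / ((coord L)^T *m coord L) 0 0.
  exists t; apply/(sqr0 _); set v := (coord _)^T.
  have vL : v *m coord L = 0.
    have [kL0|kL0] := eqVneq (coord L) 0; first by rewrite kL0 mulmx0.
    rewrite /v coordB coordZ linearB linearZ /= mulmxBl -scalemxAl.
    rewrite [_ *m coord L]mx11_scalar [X in t *: X]mx11_scalar -mul_scalar_mx -scalar_mxM.
    rewrite /t mulfVK; last first.
      apply: contra kL0 => /eqP k0; apply/eqP/sqr0.
      by rewrite [LHS]mx11_scalar k0 raddf0.
    rewrite (_ : ((coord (y i))^T *m _) 0 0 = ((coord L)^T *m coord (y i)) 0 0) ?subrr //.
    by rewrite !mxE; apply: eq_bigr => k _; rewrite !mxE mulrC.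
  have Ev := LE _ vL.
  rewrite coordB coordZ mulmxBr -scalemxAr vL scaler0 subr0.
  by rewrite -yE mulmxA ET0 // -scalemxAl vL scaler0.
have sJ := annL_subspace lam L e.
(* Modulo [L] and the annihilator every [x_i] is now [\sum_k w i k x_(f k)], so two variables span
   degree 1. *)
exists (fun k => 'X_(f (inord k))) => [k _|q qe]; first by rewrite e0 homogX.
have [c ->] : exists c : 'I_n -> R, q = \sum_i c i *: 'X_i.
  by apply: homog_lin; rewrite e0 in qe.
pose S g := exists c : nat -> R, annL e (g - \sum_(k < 2) c k *: 'X_(f (inord k))).
have sS : subspace S.
  split=> [|a g g' [c1 Jc1] [c2 Jc2]].
    by exists (fun=> 0); rewrite big1 ?subr0; [case: sJ | move=> k; rewrite scale0r].
  exists (fun k => a * c1 k + c2 k); have [_ /(_ a _ _ Jc1 Jc2)] := sJ.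
  by congr annL; rewrite !big_ord_recl !big_ord0 -!mul_mpolyC !mpolyCD !mpolyCM; ring.
apply: (subspace_sum _ sS) => i _; apply: (subspaceZ _ sS).
have [t yt] := yL i; exists (fun k => w i (inord k)).
under eq_bigr do rewrite inord_val.
exists (t *: 1); first by rewrite rpredZ.
rewrite -scalerAr mulr1; apply: coord_eq0 => //.
by rewrite e0 !rpredB ?rpredZ ?homogX // rpred_sum // => k _; rewrite rpredZ ?homogX.
Qed.

Lemma corank1_base_point j : spans (H e.+1) (annL e) j -> (j <= 2)%N \/
  [/\ j = 3%N, e = 0%N & ~ spans (H e.+1) (annL e) 2] -> base_point.
Proof.
move=> spj jP; have [m [f [w [fr wE]]]] := r_basis.
have [|mj mjE] := annE_gen spj fr; first by move=> k; rewrite rowK; apply: annE_r.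
have [m1|m1] := leqP m 1; first exact: corank1_rank_le1 wE.
have [m2|m2] := eqVneq m 2.
  subst m; apply: (corank1_rank2 fr wE).
  case: jP => [j2|[j3 e0 N2]].
    by apply: mjE; [apply/eqP; rewrite eqn_leq mj j2 | apply: annE_bracket].
  by rewrite j3 in spj; apply: corank1_rank2_span.
case: jP => [j2|[j3 _ _]]; first by have := leq_trans mj j2; rewrite leqNgt ltn_neqAle eq_sym m2 m1.
have m3 : m = 3%N by apply/eqP; rewrite eqn_leq -{1}j3 mj /= ltn_neqAle eq_sym m2.
by subst m; apply: corank1_rank3 fr wE.
Qed.

End Corank1.
End SmallCorank.

(** * Complement of dimension two *)

Section Corank2.
Variables (R : realType) (n e : nat) (lam : {scalar {mpoly R[n]}}).
Implicit Types (p q f g L M : {mpoly R[n]}).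
Local Notation D := e.+2.
Local Notation H k := (fun f : {mpoly R[n]} => is_true (f \is k.-homog)).
Local Notation ann := (ann lam).
Variable L : {mpoly R[n]}.
Hypothesis L1 : L \is 1.-homog.
Local Notation annL := (annL lam L).
Local Notation base_point := (base_point e.+1 lam).
Variables (h : nat) (F : frame e.+1 lam L h 2).
Local Notation u := (fu F).

Variable m : 'I_2 -> {mpoly R[n]}.
Hypothesis m_homog : forall l, m l \is e.+1.-homog.
Hypothesis m_gen : forall q, q \is e.+1.-homog ->
  exists c : 'cV[R]_2, annL e (q - \sum_l c l 0 *: m l).

(** Multiplication by [g] from degree [e+1] to degree [e+2] modulo [annL], the source being
    described by the spanning pair [m] and the target by pairing with [u]. *)
Definition mulC g : 'M[R]_2 := \matrix_(k, l) lam (g * m l * u k).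

Lemma annL_fu M f k : M \is 1.-homog -> annL e f -> lam (M * f * u k) = 0.
Proof.
move=> M1 [s se af]; have := annM M af (u k).
rewrite mulrBr mulrBl linearB /= => /eqP; rewrite subr_eq0 => /eqP ->.
by rewrite mulrCA fpu_orth //; apply: homogM1.
Qed.

Lemma mulC_coord M q (c : 'cV[R]_2) : M \is 1.-homog ->
  annL e (q - \sum_l c l 0 *: m l) -> mulC M *m c = \col_k lam (M * q * u k).
Proof.
move=> M1 Jq; apply/colP => k; have := annL_fu k M1 Jq.
rewrite mulrBr mulrBl linearB /= => /eqP; rewrite subr_eq0 !mxE => /eqP ->.
rewrite mulr_sumr mulr_suml linear_sum; apply: eq_bigr => l _.
by rewrite !mxE -scalerAr -scalerAl linearZ mulrC.
Qed.

(** A left kernel vector gives a combination [w] of the [u k] orthogonal to all [M q] as well as to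
    all [L s]. These fill degree [e+2] modulo the annihilator, so [w] has zero coordinates. *)
Lemma mulC_unit M : M \is 1.-homog ->
  (forall f, f \is D.-homog -> exists2 q, q \is e.+1.-homog & annL e.+1 (f - M * q)) ->
  mulC M \in unitmx.
Proof.
move=> M1 Mgen; rewrite -row_free_unit; apply: inj_row_free => v vM.
pose w := \sum_k v 0 k *: u k.
have wE g : lam (g * w) = \sum_k v 0 k * lam (g * u k).
  by rewrite mulr_sumr linear_sum; apply: eq_bigr => k _; rewrite -scalerAr linearZ.
have w0 f : f \is D.-homog -> lam (f * w) = 0.
  move=> /Mgen [q qe [s se af]]; have := af w.
  rewrite !mulrBl !linearB /= => /eqP; rewrite subr_eq0 subr_eq => /eqP ->.
  have -> : lam (L * s * w) = 0.
    by rewrite wE big1 // => k _; rewrite fpu_orth ?mulr0.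
  have [c Jq] := m_gen qe; have := mulC_coord M1 Jq => /(congr1 (mulmx v)).
  rewrite mulmxA vM mul0mx => /matrixP/(_ 0 0); rewrite !mxE add0r => E0.
  by rewrite wE [RHS]E0; apply: eq_bigr => k _; rewrite !mxE.
apply/rowP => k; rewrite mxE -(w0 _ (fu_homog F k)) wE (bigD1 k) //=.
rewrite fu_orth eqxx mulr1 big1 ?addr0 // => l lk.
by rewrite fu_orth eq_sym (negPf lk) mulr0.
Qed.

(** [M] takes over the role of [L]: a common left eigenvector of the matrices [B i] gives
    [psi (x_i q) = z_i psi (M q)]. *)
Lemma corank2_pencil M : mulC M \in unitmx ->
  (forall i j, mulC 'X_i *m invmx (mulC M) *m mulC 'X_j =
               mulC 'X_j *m invmx (mulC M) *m mulC 'X_i) -> base_point.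
Proof.
move=> Mu Mcomm; pose B i := mulC 'X_i *m invmx (mulC M).
pose BC i := map_mx (real_complex R) (B i).
have [||v v0 /allP vB] := @common_eigenvector _ 2 [seq BC i | i <- enum 'I_n] => //.
  move=> _ _ /mapP [i _ ->] /mapP [j _ ->].
  by rewrite /comm_mx -!map_mxM /= /B !mulmxA Mcomm.
have /boolp.choice [z zE] : forall i, exists a, v *m BC i = a *: v.
  by move=> i; apply/sub_rVP/vB/map_f; rewrite mem_enum.
have /boolp.choice [cf cfE] : forall q, exists c : 'cV[R]_2, q \is e.+1.-homog ->
    annL e (q - \sum_l c l 0 *: m l).
  move=> q; have [qe|_] := boolP (q \is e.+1.-homog); last by exists 0.
  by have [c Jc] := m_gen qe; exists c.
pose psi f := \sum_k v 0 k * real_complex R (lam (f * u k)).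
pose theta q := (v *m map_mx (real_complex R) (mulC M *m cf q)) 0 0.
apply: (@base_pointP _ _ _ _ psi z theta).
- exact: (clinear_lam lam (v 0) u).
- move=> i q qe.
  have -> : psi ('X_i * q) = (v *m map_mx (real_complex R) (mulC 'X_i *m cf q)) 0 0.
    rewrite (mulC_coord (homogX R i) (cfE _ qe)) mxE.
    by apply: eq_bigr => k _; rewrite !mxE.
  have -> : mulC 'X_i *m cf q = B i *m (mulC M *m cf q) by rewrite /B mulmxA mulmxKV.
  by rewrite map_mxM mulmxA -/(BC i) zE -scalemxAl mxE.
- have /rV0Pn [t vt] := v0; exists (u t); first exact: fu_homog.
  congr (_ != 0): vt; rewrite /psi (bigD1 t) //= fu_orth eqxx rmorph1 mulr1.
  by rewrite big1 ?addr0 // => s st; rewrite fu_orth eq_sym (negPf st) rmorph0 mulr0.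
by move=> f _ af; rewrite /psi big1 // => t _; rewrite af rmorph0 mulr0.
Qed.

End Corank2.

Section Corank2Main.
Variables (R : realType) (n : nat) (lam : {scalar {mpoly R[n]}}).
Implicit Types (p q f g L M : {mpoly R[n]}).
Local Notation H k := (fun f : {mpoly R[n]} => is_true (f \is k.-homog)).
Local Notation ann := (ann lam).
Variable L : {mpoly R[n]}.
Hypothesis L1 : L \is 1.-homog.
Local Notation annL := (annL lam L).

Lemma spans2_ord k (P : {mpoly R[n]} -> Prop) : spans (H k) P 2 ->
  exists2 m : 'I_2 -> {mpoly R[n]}, forall l, m l \is k.-homog &
    forall q, q \is k.-homog -> exists c : 'cV[R]_2, P (q - \sum_l c l 0 *: m l).
Proof.
move=> [m mk mE]; exists (fun l => m l) => [l|q /mE [c Jc]]; first exact: mk.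
by exists (\col_l c l); congr P: Jc; congr (_ - _); apply: eq_bigr => l _; rewrite mxE.
Qed.

(* In the basis [m l = M s_l], multiplication by [x_j / M] is defined on the quotient. *)
Lemma corank2_base_point e h : frame e.+2 lam L h 2 ->
  spans (H e.+2) (annL e.+1) 2 -> base_point e.+2 lam.
Proof.
move=> F sp2; have sJ := annL_subspace lam L e.+1; have sJ' := annL_subspace lam L e.+2.
have [M M1 Mgen] := codim2_restrict sJ sp2.
have [m0 m0k m0E] := spans2_ord sp2.
have /boolp.choice [s sE] : forall l, exists s, s \is e.+1.-homog /\ annL e.+1 (m0 l - M * s).
  by move=> l; have [s] := Mgen _ (m0k l); exists s.
pose m l := M * s l.
have mk l : m l \is e.+2.-homog by apply: homogM1 => //; case: (sE l).
have mE q : q \is e.+2.-homog -> exists c : 'cV[R]_2, annL e.+1 (q - \sum_l c l 0 *: m l).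
  move=> /m0E [c Jc]; exists c.
  have Js : annL e.+1 (\sum_l c l 0 *: (m0 l - M * s l)).
    by apply: subspace_sum => // l _; apply: subspaceZ => //; case: (sE l).
  have := subspaceD sJ Jc Js; congr annL.
  under [X in _ + X = _]eq_bigr do rewrite scalerBr.
  by rewrite sumrB addrA subrK.
have MgenD f : f \is e.+3.-homog -> exists2 q, q \is e.+2.-homog & annL e.+2 (f - M * q).
  move=> /homog_gen [q qk ->].
  have /boolp.choice [t tE] : forall i, exists t, t \is e.+1.-homog /\ annL e.+1 (q i - M * t).
    by move=> i; have [t] := Mgen _ (qk i); exists t.
  exists (\sum_i 'X_i * t i); first by rewrite rpred_sum// => i _; apply: homogXM; case: (tE i).
  rewrite mulr_sumr -sumrB; apply: subspace_sum => // i _.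
  rewrite mulrCA -mulrBr; apply: annLM; first exact: homogX.
  by case: (tE i).
have Mu := mulC_unit F mE M1 MgenD.
apply: (corank2_pencil mE Mu) => i j.
have /boolp.choice [c cE] : forall jl : 'I_n * 'I_2, exists c : 'cV[R]_2,
    annL e.+1 ('X_jl.1 * s jl.2 - \sum_r c r 0 *: m r).
  by move=> [k l]; apply: mE; apply: homogXM; case: (sE l).
pose C j := \matrix_(r, l) c (j, l) r 0.
have AC g k : g \is 1.-homog -> mulC F m g *m C k = \matrix_(t, l) lam (g * ('X_k * s l) * fu F t).
  move=> g1; apply/matrixP => t l.
  have := mulC_coord F g1 (cE (k, l)) => /colP/(_ t); rewrite !mxE => <-.
  by apply: eq_bigr => r _; rewrite !mxE.
have CE k : mulC F m 'X_k = mulC F m M *m C k.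
  by rewrite AC //; apply/matrixP => t l; rewrite !mxE /m; congr (lam _); ring.
have E k l : mulC F m 'X_k *m invmx (mulC F m M) *m mulC F m 'X_l = mulC F m 'X_k *m C l.
  by rewrite (CE l) -!mulmxA mulKmx.
by rewrite !E !AC ?homogX //; apply/matrixP => t l; rewrite !mxE; congr (lam _); ring.
Qed.

(** In degree 1 there is no room to write both [m l] as multiples of [M]. Instead all [A x_i], and
    [A M] too, are combinations of [A m0] and [A m1]; solving for one of these in terms of [A M] and
    the other gives [Q m0 m1 = Q m1 m0]. *)
Lemma corank2_base_point0 h : frame 1 lam L h 2 ->
  spans (H 1) (annL 0) 2 -> spans (H 2) (annL 1) 2 -> base_point 1 lam.
Proof.
move=> F sp1 sp2; have sJ' := annL_subspace lam L 1.
have [M M1 Mgen] := codim2_restrict sJ' sp2.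
have [m mk mE] := spans2_ord sp1.
have Mu := mulC_unit F mE M1 Mgen.
apply: (corank2_pencil mE Mu).
pose A := mulC F m; rewrite -/A in Mu *.
have Agen g : g \is 1.-homog -> exists c : 'cV[R]_2, A g = \sum_l c l 0 *: A (m l).
  move=> g1; have [c Jc] := mE g g1; exists c; apply/matrixP => k l.
  have := annL_fu F k (mk l) Jc; rewrite summxE !mxE mulrBr mulrBl linearB /= => /eqP.
  rewrite subr_eq0 [m l * g]mulrC => /eqP ->.
  rewrite mulr_sumr mulr_suml linear_sum; apply: eq_bigr => r _.
  by rewrite !mxE -scalerAr -scalerAl linearZ /= [m l * _]mulrC.
pose Q x y := A x *m invmx (A M) *m A y.
have [mu muE] := Agen M M1.
pose m0 := m ord0; pose m1 := m ord_max.
have sum2 (c : 'cV[R]_2) : \sum_l c l 0 *: A (m l) = c ord0 0 *: A m0 + c ord_max 0 *: A m1.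
  by rewrite big_ord_recl big_ord1; congr (_ + _ *: A (m _)); [congr (c _ _)|]; apply: val_inj.
have Q01 : Q m0 m1 = Q m1 m0.
  rewrite sum2 in muE; set a := mu ord0 0 in muE; set b := mu ord_max 0 in muE.
  have [a0|a0] := eqVneq a 0.
    have b0 : b != 0.
      apply: contraTneq Mu => b0; rewrite muE a0 b0 !scale0r addr0.
      by rewrite unitmxE det0 unitr0.
    have A1 : A m1 = b^-1 *: A M.
      by rewrite muE a0 scale0r add0r scalerA mulVf // scale1r.
    rewrite /Q A1 -scalemxAr -!scalemxAl mulmxV // mul1mx.
    by rewrite -mulmxA mulVmx // mulmx1.
  have A0 : A m0 = a^-1 *: A M - (a^-1 * b) *: A m1.
    by rewrite muE scalerDr !scalerA mulVf // scale1r addrK.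
  rewrite /Q A0 !mulmxBl mulmxBr -!scalemxAl -!scalemxAr mulmxV // mul1mx.
  by rewrite -!mulmxA mulVmx // mulmx1.
move=> i j; have [a aE] := Agen _ (homogX R i); have [b bE] := Agen _ (homogX R j).
rewrite aE bE !sum2 !mulmxDl !mulmxDr -!scalemxAl -!scalemxAr.
rewrite -/(Q m0 m0) -/(Q m0 m1) -/(Q m1 m0) -/(Q m1 m1) Q01.
move: (Q m0 m0) (Q m1 m0) (Q m1 m1) (a ord0 0) (a ord_max 0) (b ord0 0) (b ord_max 0).
by move=> Q1 Q2 Q3 a0 a1 b0 b1; apply/matrixP => x y; rewrite !mxE; ring.
Qed.

End Corank2Main.

(** * Base points from the rank bound *)

Section SmallRank.
Variables (R : realType) (n : nat) (lam : {scalar {mpoly R[n]}}).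
Implicit Types (p q f g L M : {mpoly R[n]}).
Local Notation H k := (fun f : {mpoly R[n]} => is_true (f \is k.-homog)).
Local Notation ann := (ann lam).

Section FrameCount.
Variables (e h c : nat) (L : {mpoly R[n]}) (F : frame e lam L h c).
Hypothesis L1 : L \is 1.-homog.

Let uu i := if insub i is Some j then fu F j else 0.

Let uuE (j : 'I_c) : uu j = fu F j.
Proof. by rewrite /uu valK. Qed.

Lemma frame_spans : spans (H e.+1) (annL lam L e) c.
Proof.
exists uu => [i ic|f fD]; first by rewrite (uuE (Ordinal ic)); apply: fu_homog.
exists (fun i => lam (f * uu i)); exists (\sum_i lam (f * (L * fp F i)) *: fp F i).
  by apply: rpred_sum => i _; rewrite rpredZ ?fp_homog.
have := fu_gen F fD; congr ann; rewrite addrAC; congr (_ - _ - _).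
  by apply: eq_bigr => i _; rewrite uuE.
by rewrite mulr_sumr; apply: eq_bigr => i _; rewrite scalerAr.
Qed.

Lemma frame_indep : indep (H e.+1) (annL lam L e) c.
Proof.
exists uu => [i ic|a [q qe ac] i ic]; first by rewrite (uuE (Ordinal ic)); apply: fu_homog.
have := ac (fu F (Ordinal ic)); rewrite mulrBl linearB /= fpu_orth // subr0 => <-.
rewrite lam_sum (bigD1 (Ordinal ic)) //= (uuE (Ordinal ic)) fu_orth eqxx mulr1 big1 ?addr0 // => l li.
by rewrite uuE fu_orth (negPf li) mulr0.
Qed.

Lemma frame_le j : spans (H e.+1) (annL lam L e) j -> (c <= j)%N.
Proof.
move=> spj; rewrite leqNgt; apply/negP => jc.
have c0 : c = c.-1.+1 by rewrite (ltn_predK jc).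
have := frame_indep; rewrite c0; apply: spans_dep; first exact: annL_subspace.
by apply: spansW spj; [exact: rpred0 | rewrite -ltnS -c0].
Qed.
End FrameCount.

Lemma corank0_base_point e h L : L \is 1.-homog -> frame e lam L h 0 ->
  (exists f, f \is e.+1.-homog /\ ~ ann f) -> base_point e lam.
Proof.
move=> L1 F [f [fD Nf]]; have h0 : (0 < h)%N.
  case: h F => // F; case: Nf; have := fu_gen F fD.
  by rewrite !big_ord0 !subr0.
apply: (base_point_commuting L1 (F := F) (b := fun=> 0)); first by rewrite addn0.
move=> i j; rewrite /comm_mx !mulmx_block op_comm.
by congr block_mx; apply/matrixP => x y; [case: y | case: x | case: y].
Qed.

Theorem small_rank_base_point d :
  (forall e f, f \is e.-homog -> e <> (2 * d)%N -> lam f = 0) ->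
  (forall p, p \is d.-homog -> 0 <= lam (p * p)) ->
  (exists f, f \is d.-homog /\ ~ ann f) ->
  (3 <= d)%N /\ (forall k, indep (H d) ann k -> (k <= 3 * d - 3)%N) \/
  d = 2 /\ (forall k, indep (H d) ann k -> (k <= 5)%N) ->
  base_point d.-1 lam.
Proof.
move=> lamh psd nz dN.
have [e de] : exists e, d = e.+2.
  by case: dN => -[d2 _]; [exists d.-2; case: d d2 {lamh psd nz} => [|[|]] | exists 0%N].
subst d; rewrite [e.+2.-1]/=.
have [N rankN] : exists N, forall k, indep (H e.+2) ann k -> (k <= N)%N.
  by case: dN => -[_ HN]; eexists; exact: HN.
have [L L1 Lnzd] := exists_nzd lamh psd rankN (erefl e.+2).
have [h [c [F]]] := frame_exists lamh psd rankN L1 Lnzd.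
have low := @indep_step _ _ _ lam lamh e.+1 L erefl L1 Lnzd.
have c_ind := frame_indep F.
have [sp1|Nsp1] := pselect (spans (H e.+1) (annL lam L e) 1).
  have c1 := frame_le F (growth1 sp1).
  case: c F c1 c_ind => [F _ _|[F _ _|//]]; first exact: corank0_base_point F nz.
  by apply: (corank1_base_point lamh psd L1 F sp1); left.
have [sp2|Nsp2] := pselect (spans (H e.+1) (annL lam L e) 2).
  have c2 : (c <= 2)%N.
    case: e lamh psd nz rankN dN L1 Lnzd F low c_ind Nsp1 sp2 =>
      [|e] lamh psd nz rankN dN L1 Lnzd F low c_ind Nsp1 sp2.
      case: dN => -[// _ N5].
      (* [growth2] does not apply from degree 1 to degree 2; here [1 + 2 + c <= 5] bounds [c]. *)
      have i1 := not_spans_indep (homog_subspace _ _ _) (annL_subspace lam L 0) Nsp1.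
      rewrite -(leq_add2l 3).
      exact: N5 _ (low _ _ _ (leqnn _) (low _ _ _ (leq0n _) (not_ann1 nz) i1) c_ind).
    exact: (frame_le F (growth2 sp2)).
  case: c F c2 c_ind => [F _ _|[F _ _|[F _ _|//]]]; first exact: corank0_base_point F nz.
    by apply: (corank1_base_point lamh psd L1 F sp2); left.
  case: e lamh psd nz rankN dN L1 Lnzd F low Nsp1 sp2 =>
    [|e] lamh psd nz rankN dN L1 Lnzd F low Nsp1 sp2.
    exact: corank2_base_point0 F sp2 (frame_spans F).
  exact: corank2_base_point F sp2.
(* From here on [c_(d-1) >= 3]. For [d >= 3], [indep_growth] yields [3 (d - 1)] in degree [d-1], and
   [3 (d - 1) + c <= 3 d - 3] forces [c = 0]. *)
case: dN => -[d3 HN].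
  have ie : indep (H e.+1) ann (3 * e.+1).
    apply: (indep_growth lamh erefl L1 Lnzd _ nz); first by rewrite leqnn.
    by rewrite eqSS -[e == 0%N]negbK -lt0n; move: d3; rewrite !ltnS => ->.
  have := HN _ (low _ _ _ (leqnn _) ie c_ind).
  rewrite (mulnS 3 e.+1) addKn -[leqRHS]addn0 leq_add2l leqn0.
  by move=> /eqP c0; subst c; apply: corank0_base_point F nz.
case: d3 => e0; subst e.
(* For [d = 2], [1 + 3 + c <= 5] leaves [c <= 1]; when [c = 1], a fourth independent linear form
   would already give rank 6. *)
have i3 := not_spans_indep (homog_subspace _ _ _) (annL_subspace lam L 0) Nsp2.
have c1 : (c <= 1)%N.
  rewrite -(leq_add2l 4).
  exact: HN _ (low _ _ _ (leqnn _) (low _ _ _ (leq0n _) (not_ann1 nz) i3) c_ind).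
case: c F c1 c_ind => [F _ _|[F _ c_ind|//]]; first exact: corank0_base_point F nz.
have sp3 : spans (H 1) (annL lam L 0) 3.
  apply: contrapT => Nsp3.
  have i4 := not_spans_indep (homog_subspace _ _ _) (annL_subspace lam L 0) Nsp3.
  by have := HN _ (low _ _ _ (leqnn _) (low _ _ _ (leq0n _) (not_ann1 nz) i4) c_ind).
by apply: (corank1_base_point lamh psd L1 F sp3); right.
Qed.

End SmallRank.

(** * Extremality *)

Section Extension.
Variables (R : realType) (n d : nat) (l : {scalar dhomog n R (2 * d)}).

(** Extension by zero in the degrees other than [2 d], so that [l] applies to products of
    polynomials without carrying homogeneity proofs. *)
Definition extend (f : {mpoly R[n]}) : R := l (DHomog (pihomogP mdeg (2 * d) f)).

Fact extend_linear : linear_for *%R extend.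
Proof.
move=> a f g; rewrite /extend -linearP; congr (l _); apply: val_inj.
by rewrite /= linearP.
Qed.

HB.instance Definition _ :=
  GRing.isLinear.Build R {mpoly R[n]} R _ extend extend_linear.

Lemma extendE (f : dhomog n R (2 * d)) : extend f = l f.
Proof.
rewrite /extend; congr (l _); apply: val_inj => /=.
by rewrite pihomog_dE // dhomog_is_dhomog.
Qed.

Lemma extend_homog e f : f \is e.-homog -> e <> (2 * d)%N -> extend f = 0.
Proof.
move=> fe ne; rewrite /extend (_ : DHomog _ = 0) ?linear0 //; apply: val_inj => /=.
by rewrite (pihomog_ne0 _ fe) //; apply/eqP.
Qed.

Lemma QformE (p : dhomog n R d) : Qform l p = extend ((p : {mpoly R[n]}) * (p : {mpoly R[n]})).
Proof. by rewrite /Qform -extendE /= expr2. Qed.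

Lemma polar_QformE (p q : dhomog n R d) :
  polar (Qform l) p q = extend ((p : {mpoly R[n]}) * (q : {mpoly R[n]})).
Proof.
rewrite /polar !QformE; pose P : {mpoly R[n]} := p; pose Q : {mpoly R[n]} := q.
have -> : ((p + q)%R : {mpoly R[n]}) * ((p + q)%R : {mpoly R[n]}) = P * P + (P * Q + P * Q) + Q * Q.
  by rewrite -[(p + q)%R : {mpoly R[n]}]/(P + Q); ring.
by rewrite -/P -/Q !linearD /=; field.
Qed.

Lemma monom_span f : f \is d.-homog ->
  exists a : monom_index n d -> R, f = \sum_i a i *: (monom R i : {mpoly R[n]}).
Proof.
move: f; apply: homog_ind => [|f g [a ->] [b ->]|c f [a ->]|m md].
- by exists (fun=> 0); rewrite big1 // => i _; rewrite scale0r.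
- exists (fun i => a i + b i); rewrite -big_split; apply: eq_bigr => i _.
  by rewrite scalerDl.
- exists (fun i => c * a i); rewrite scaler_sumr; apply: eq_bigr => i _.
  by rewrite scalerA.
have md1 : (mdeg m < d.+1)%N by rewrite md.
have mdE : mdeg (BMultinom md1) == d by rewrite /= md.
pose im : monom_index n d := exist _ (BMultinom md1) mdE.
exists (fun i => (i == im)%:R); rewrite (bigD1 im) //= eqxx scale1r big1 ?addr0 // => i.
by move=> /negPf->; rewrite scale0r.
Qed.

(** The matrix in monomials is [P B P^T]. Surjectivity of [phi] gives [P] a left inverse, so [B] is
    recovered from it and the ranks agree. *)
Lemma gram_rank r (phi : {mpoly R[n]} -> 'rV[R]_r) (B : 'M[R]_r) :
  (forall a f g, phi (a *: f + g) = a *: phi f + phi g) ->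
  (forall v, exists2 f, f \is d.-homog & phi f = v) ->
  (forall f g, f \is d.-homog -> g \is d.-homog ->
    extend (f * g) = (phi f *m B *m (phi g)^T) 0 0) ->
  qrank (Qform l) = \rank B.
Proof.
move=> phiL phi_surj phiB; rewrite /qrank.
set G := \matrix_(_, _) _.
pose mon (i : 'I_#|{: monom_index n d}|) : {mpoly R[n]} := monom R (enum_val i).
pose P := \matrix_(i < #|{: monom_index n d}|) phi (mon i).
have GE : G = P *m B *m P^T.
  apply/matrixP => i j; rewrite mxE polar_QformE phiB ?dhomog_is_dhomog //.
  have phiP k : phi (mon k) = row k P by rewrite rowK.
  rewrite -/(mon i) -/(mon j) !phiP tr_row colE !mulmxA -!row_mul -colE.
  by rewrite !mxE.
have phi0 : phi 0 = 0.
  by have := phiL (-1) 0 0; rewrite scaler0 addr0 scaleN1r addNr.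
have phi_sum I (s : seq I) c F : phi (\sum_(i <- s) c i *: F i) = \sum_(i <- s) c i *: phi (F i).
  elim: s => [|i s IH]; first by rewrite !big_nil.
  by rewrite !big_cons phiL IH.
have Pfull : row_full P.
  rewrite -sub1mx; apply/row_subP => k; have [f fd <-] := phi_surj (row k 1%:M).
  have [a ->] := monom_span fd; rewrite phi_sum summx_sub // => i _.
  apply: scalemx_sub; have -> : phi (monom R i) = row (enum_rank i) P.
    by rewrite rowK /mon enum_rankK.
  exact: row_sub.
rewrite GE; apply/eqP; rewrite eqn_leq; apply/andP; split.
  by apply: leq_trans (mxrankM_maxl _ _) _; apply: mxrankM_maxr.
have PK := mulVpmx Pfull.
have BE : B = pinvmx P *m (P *m B *m P^T) *m (pinvmx P)^T.
  by rewrite !mulmxA PK mul1mx -mulmxA -trmx_mul PK trmx1 mulmx1.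
by rewrite {1}BE; apply: leq_trans (mxrankM_maxl _ _) _; apply: mxrankM_maxr.
Qed.

Lemma indep_le_qrank k :
  indep (fun f => is_true (f \is d.-homog)) (ann extend) k -> (k <= qrank (Qform l))%N.
Proof.
move=> [m mk mind]; rewrite /qrank; set G := \matrix_(_, _) _.
have /boolp.choice [a aE] : forall i : 'I_k, exists a : monom_index n d -> R,
    m i = \sum_j a j *: (monom R j : {mpoly R[n]}).
  by move=> i; apply/monom_span/mk.
pose A := \matrix_(i < k, j < #|{: monom_index n d}|) a i (enum_val j).
suff AGfree : row_free (A *m G).
  by move: AGfree; rewrite /row_free => /eqP {1}<-; apply: mxrankM_maxr.
apply: inj_row_free => c cAG.
pose c' i := if insub i is Some j then c 0 j else 0.
have cE (i : 'I_k) : c' i = c 0 i by rewrite /c' valK.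
pose f := \sum_(i < k) c' i *: m i.
have fd : f \is d.-homog by apply: rpred_sum => i _; rewrite rpredZ ?mk.
have fmon (j : monom_index n d) : extend (f * monom R j) = 0.
  have /rowP/(_ (enum_rank j)) := cAG; rewrite mulmxA !mxE => E0.
  rewrite -[RHS]E0 mulr_suml linear_sum /=.
  under [RHS]eq_bigr do rewrite !mxE mulr_suml.
  rewrite exchange_big; apply: eq_bigr => i _ /=.
  rewrite cE aE -scalerAl linearZ /= mulr_suml linear_sum mulr_sumr.
  rewrite [RHS](reindex (@enum_rank _)) /=; last exact/onW_bij/enum_rank_bij.
  apply: eq_bigr => t _; rewrite !mxE !enum_rankK polar_QformE -scalerAl linearZ /=.
  by rewrite mulrA.
have af : ann extend f.
  apply: (ann_homog extend_homog (e := d) fd); first by rewrite mul2n addnn.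
  move=> q /monom_span [b ->]; rewrite mulr_sumr linear_sum big1 // => j _.
  by rewrite -scalerAr linearZ /= fmon mulr0.
by apply/rowP => i; rewrite mxE -cE; apply: mind af _ (ltn_ord i).
Qed.
End Extension.

(** * From a complex base point to a real evaluation *)

Section ExtremePoint.
Variables (R : realType) (n : nat).
Local Notation C := R[i].
Local Notation ev z := (mmap (real_complex R) z).

Lemma mmap_homog (S : comNzRingType) (phi : {rmorphism R -> S}) (a : S) (y : 'I_n -> R) k f :
  f \is k.-homog -> mmap phi (fun i => a * phi (y i)) f = a ^+ k * phi (f.@[y]).
Proof.
move: f; apply: homog_ind => [|f g fE gE|c f fE|m mk].
- by rewrite !raddf0 mulr0.
- by rewrite mmapD mevalD rmorphD fE gE mulrDr.
- by rewrite mmapZ mevalZ rmorphM fE mulrCA.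
rewrite mmapX mevalX /mmap1 rmorph_prod -mk mdegE -prodrXr -big_split.
by apply: eq_bigr => i _; rewrite exprMn rmorphXn.
Qed.

Lemma root_exists (t : R) k : 0 <= t -> (0 < k)%N -> exists s, s ^+ k = t.
Proof.
move=> t0 k0; have [||s _ /rootP] := @poly_ivt R ('X^k - t%:P) 0 (t + 1).
- by rewrite addr_ge0.
- rewrite !hornerE ?hornerXn expr0n gtn_eqF //= sub0r oppr_le0 t0 /=.
  rewrite subr_ge0.
  have t1 : 1 <= t + 1 by rewrite lerDr.
  apply: le_trans (_ : t + 1 <= _); first by rewrite lerDl ler01.
  by rewrite -[leLHS]expr1 ler_weXn2l.
by rewrite !hornerE ?hornerXn => /eqP; rewrite subr_eq0 => /eqP; exists s.
Qed.

Variables (d : nat) (l : {scalar dhomog n R (2 * d)}).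
Hypothesis d_gt0 : (0 < d)%N.
Hypothesis l_extreme : spans_extreme_ray l.
Local Notation lam := (extend l).

Lemma extend_psd p : p \is d.-homog -> 0 <= lam (p * p).
Proof.
move=> pd; have [_ l0 _] := l_extreme.
rewrite -[p]/(val (DHomog pd)) -QformE; apply: l0.
by exists [:: DHomog pd]; rewrite big_seq1.
Qed.

(* Both [(l + th / K) / 2] and [(l - th / K) / 2] lie in the dual cone. *)
Lemma extreme_multiple (th : {scalar dhomog n R (2 * d)}) K : 0 < K ->
  (forall p : dhomog n R d, `|th (form_sqr p)| <= K * lam ((p : {mpoly R[n]}) * (p : {mpoly R[n]}))) ->
  exists c, forall f, th f = c * l f.
Proof.
move=> K0 thK; have [_ l0 lext] := l_extreme.
pose l' (s : R) (f : dhomog n R (2 * d)) := (l f + s * K^-1 * th f) / 2.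
have l'L s : linear_for *%R (l' s).
  by move=> a f g; rewrite /l' !linearP /=; field; apply/lt0r_neq0.
pose L1 s : {scalar _} := HB.pack (l' s) (GRing.isLinear.Build _ _ _ _ (l' s) (l'L s)).
have L0 s : `|s| <= 1 -> in_sos_dual (L1 s).
  move=> s1 f [sq ->]; rewrite linear_sum sumr_ge0 // => p _.
  rewrite /= /l' divr_ge0 ?ler0n // -[l _]/(Qform l p) QformE.
  set t := lam _; have : `|s * K^-1 * th (form_sqr p)| <= t.
    rewrite !normrM normfV (gtr0_norm K0) -mulrA.
    apply: le_trans (_ : 1 * (K^-1 * (K * t)) <= _); last by rewrite mul1r mulKf ?lt0r_neq0.
    rewrite ler_pM //; first by rewrite mulr_ge0 // invr_ge0 ltW.
    by rewrite ler_wpM2l // ?invr_ge0 ?ltW.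
  by rewrite ler_norml => /andP [t1 _]; rewrite -lerBlDl sub0r.
have [|||[c _ cE] _] := lext (L1 1) (L1 (-1)).
- by apply: L0; rewrite normr1.
- by apply: L0; rewrite normrN1.
- by move=> f /=; rewrite /l'; field; apply/lt0r_neq0.
exists (K * (2 * c - 1)) => f; have := cE f; rewrite /= /l' => E0.
have -> : th f = K * (2 * ((l f + 1 * K^-1 * th f) / 2) - l f).
  by field; apply/lt0r_neq0.
by rewrite E0; ring.
Qed.

(** Evaluation at [z] factors through the coordinates [lam (p * P i)] of [p] in an orthonormal
    basis, each of absolute value at most the square root of [lam (p * p)]. *)
Lemma eval_bound (z : 'I_n -> C) : (forall f, f \is d.-homog -> ann lam f -> ev z f = 0) ->
  exists2 K, 0 < K & forall p, p \is d.-homog ->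
    complex.Re (ev z p) ^+ 2 + complex.Im (ev z p) ^+ 2 <= K * lam (p * p).
Proof.
move=> zann; have [r [P [PD P1 Pg]]] := @orthonormal_basis _ _ d _ _ (@extend_homog _ _ _ l)
  extend_psd (@indep_le_qrank _ _ _ l) _ (@homog_subspace R n d) (fun f fd => fd).
pose A := \sum_(i < r) `|complex.Re (ev z (P i))|.
pose B := \sum_(i < r) `|complex.Im (ev z (P i))|.
have A0 : 0 <= A by apply: sumr_ge0.
have B0 : 0 <= B by apply: sumr_ge0.
exists (A ^+ 2 + B ^+ 2 + 1); first by rewrite ltr_wpDl // addr_ge0 // sqr_ge0.
move=> p pd; pose x i := lam (p * P i).
have lam_pP q : q \is d.-homog -> lam (p * q) = \sum_(i < r) x i * lam (q * P i).
  move=> qd; have := Pg p pd q; rewrite mulrBl linearB /= lam_sum => /eqP.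
  by rewrite subr_eq0 => /eqP ->; apply: eq_bigr => i _; rewrite [q * _]mulrC.
set t := lam (p * p); have t0 : 0 <= t by apply: extend_psd.
have xt i : (i < r)%N -> `|x i| <= Num.sqrt t.
  move=> ir; rewrite -sqrtr_sqr ler_sqrt // /t lam_pP // (bigD1 (Ordinal ir)) //=.
  by rewrite expr2 lerDl sumr_ge0 // => j _; rewrite -expr2 sqr_ge0.
have evp : ev z p = \sum_(i < r) real_complex R (x i) * ev z (P i).
  have sd : \sum_(i < r) x i *: P i \is d.-homog.
    by apply: rpred_sum => i _; rewrite rpredZ ?PD.
  have := zann _ (rpredB pd sd) (Pg p pd); rewrite raddfB /= => /eqP.
  rewrite subr_eq0 => /eqP ->; rewrite rmorph_sum /=.
  by apply: eq_bigr => i _; rewrite mmapZ.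
have bnd (u : nat -> R) S : S = \sum_(i < r) x i * u i ->
    S ^+ 2 <= (\sum_(i < r) `|u i|) ^+ 2 * t.
  move=> ->; rewrite -real_normK ?num_real // -[t in leRHS]sqr_sqrtr // -exprMn.
  rewrite ler_sqr ?nnegrE ?mulr_ge0 ?sqrtr_ge0 ?sumr_ge0 //.
  apply: le_trans (ler_norm_sum _ _ _) _; rewrite mulr_suml ler_sum // => i _.
  by rewrite normrM mulrC ler_wpM2l ?xt.
have ReM (c : R) (w : C) : complex.Re (real_complex R c * w) = c * complex.Re w.
  by case: w => a b /=; rewrite mul0r subr0.
have ImM (c : R) (w : C) : complex.Im (real_complex R c * w) = c * complex.Im w.
  by case: w => a b /=; rewrite mul0r addr0.
rewrite !mulrDl mul1r -[leLHS]addr0 lerD // lerD //.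
  apply: (bnd (fun i => complex.Re (ev z (P i)))).
  rewrite evp (big_morph (@complex.Re R) (id1 := 0) (op1 := +%R)) // => [|[? ?] [? ?]//].
  by apply: eq_bigr => i _; rewrite ReM.
apply: (bnd (fun i => complex.Im (ev z (P i)))).
rewrite evp (big_morph (@complex.Im R) (id1 := 0) (op1 := +%R)) // => [|[? ?] [? ?]//].
  by apply: eq_bigr => i _; rewrite ImM.
Qed.

Lemma norm_Re_sqr (w : C) : `|complex.Re (w ^+ 2)| <= complex.Re w ^+ 2 + complex.Im w ^+ 2.
Proof.
case: w => x y; have -> : complex.Re (Complex x y ^+ 2) = x ^+ 2 - y ^+ 2 by rewrite !expr2.
rewrite /= ler_norml; have := sqr_ge0 x; have := sqr_ge0 y.
by move=> ? ?; apply/andP; split; lra.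
Qed.

Lemma norm_Im_sqr (w : C) : `|complex.Im (w ^+ 2)| <= complex.Re w ^+ 2 + complex.Im w ^+ 2.
Proof.
case: w => x y; have -> : complex.Im (Complex x y ^+ 2) = 2 * (x * y) by rewrite expr2 /=; ring.
rewrite /= ler_norml; have := sqr_ge0 (x + y); have := sqr_ge0 (x - y).
rewrite sqrrB sqrrD => H1 H2; apply/andP; split; lra.
Qed.

(** By extremality [f(z) = ga * l f] with [ga] complex. Comparing [x_j^(2d-1) x_i] with [x_j^(2d)]
    shows that [z_i / z_j = t_i / t_j] is real. The factor [t_j], positive as the value at a square,
    is absorbed into the point through its [2 d]-th root. *)
Lemma extreme_base_point (z : 'I_n -> C) : (exists i, z i != 0) ->
  (forall f, f \is d.-homog -> ann lam f -> ev z f = 0) -> point_evaluation l.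
Proof.
move=> [j zj] zann; have [K K0 Kb] := eval_bound zann.
pose thR (f : dhomog n R (2 * d)) := complex.Re (ev z f).
pose thI (f : dhomog n R (2 * d)) := complex.Im (ev z f).
have thRL : linear_for *%R thR.
  move=> a f g; rewrite /thR mmapD mmapZ raddfD /=; congr (_ + _).
  by case: (ev z f) => x y /=; rewrite mul0r subr0.
have thIL : linear_for *%R thI.
  move=> a f g; rewrite /thI mmapD mmapZ raddfD /=; congr (_ + _).
  by case: (ev z f) => x y /=; rewrite mul0r addr0.
pose TR : {scalar _} := HB.pack thR (GRing.isLinear.Build _ _ _ _ thR thRL).
pose TI : {scalar _} := HB.pack thI (GRing.isLinear.Build _ _ _ _ thI thIL).
have [|c1 c1E] := @extreme_multiple TR K K0.
  move=> p; apply: le_trans _ (Kb p (dhomog_is_dhomog p)).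
  by rewrite /= /thR /= rmorphXn; apply: norm_Re_sqr.
have [|c2 c2E] := @extreme_multiple TI K K0.
  move=> p; apply: le_trans _ (Kb p (dhomog_is_dhomog p)).
  by rewrite /= /thI /= rmorphXn; apply: norm_Im_sqr.
pose ga : C := Complex c1 c2.
have evE f : f \is (2 * d).-homog -> ev z f = ga * real_complex R (lam f).
  move=> fd.
  have E1 : complex.Re (ev z f) = c1 * lam f by rewrite -[RHS]/(c1 * lam (DHomog fd)) extendE -c1E.
  have E2 : complex.Im (ev z f) = c2 * lam f by rewrite -[RHS]/(c2 * lam (DHomog fd)) extendE -c2E.
  move: E1 E2; case: (ev z f) => x y /= -> ->.
  by apply/eqP; rewrite eq_complex /= !mulr0 subr0 add0r !eqxx.
have [e dE] : exists e, (2 * d = e.+1)%N by exists (2 * d).-1; rewrite prednK // muln_gt0.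
pose t i := lam ('X_j ^+ e * 'X_i).
have tE i : z j ^+ e * z i = ga * real_complex R (t i).
  rewrite -evE; last first.
    by have := dhomogM (homogXn R j e) (homogX R i); rewrite dE addn1.
  by rewrite rmorphM rmorphXn /= !mmapX !mmap1U.
have t0 : 0 < t j.
  have tj : t j = lam ('X_j ^+ d * 'X_j ^+ d).
    by rewrite /t -exprSr -exprD addnn -mul2n dE.
  rewrite lt_neqAle tj extend_psd ?homogXn // andbT -tj; apply/eqP => tj0.
  have /eqP := tE j; rewrite -tj0 rmorph0 mulr0 -exprSr expf_eq0 (negPf zj).
  by rewrite andbF.
have t0' : real_complex R (t j) != 0 by rewrite fmorph_eq0 gt_eqF.
pose y i := t i / t j.
have zE i : z i = z j * real_complex R (y i).
  apply: (mulfI (expf_neq0 e zj)); rewrite tE mulrA tE -mulrA -rmorphM.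
  by rewrite /y mulrCA mulfV ?gt_eqF // mulr1.
have d2 : (0 < 2 * d)%N by rewrite muln_gt0.
have [s sE] := root_exists (ltW t0) d2; exists (fun i => s * y i) => f; have fd := dhomog_is_dhomog f.
have -> : (f : {mpoly R[n]}).@[fun i => s * y i] = s ^+ (2 * d) * (f : {mpoly R[n]}).@[y].
  exact: (mmap_homog idfun s y fd).
have gaE : ga = z j ^+ (2 * d) / real_complex R (t j).
  by rewrite dE exprSr tE mulfK.
have := evE _ fd; rewrite extendE (_ : ev z f = ev (fun i => z j * real_complex R (y i)) f).
  rewrite (mmap_homog (real_complex R) (z j) y fd) gaE -mulrA => /(mulfI (expf_neq0 _ zj)).
  move=> E0; apply: (fmorph_inj (real_complex R)).
  by rewrite sE rmorphM E0 mulrA mulfV // mul1r.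
by congr (mmap _ _ _); apply: funext.
Qed.

End ExtremePoint.

(** Otherwise [ann_step] descends from degree [d] to degree 0 and puts 1 in the annihilator. *)
Lemma extend_neq0 (R : realType) n d (l : {scalar dhomog n R (2 * d)}) : (0 < d)%N ->
  (exists f, l f != 0) -> exists f, f \is d.-homog /\ ~ ann (extend l) f.
Proof.
move=> d0 [g lg]; apply: contrapT => /forallNP H.
have annH k : (k <= d)%N -> forall f, f \is k.-homog -> ann (extend l) f.
  move=> kd; rewrite -(subKn kd); elim: (d - k)%N (leq_subr k d) => [|j IHj] jd f fj.
    by apply: contrapT => Nf; apply: (H f); rewrite subn0 in fj.
  apply: (ann_step (@extend_homog _ _ _ l) fj) => [|i].
    by apply: leq_ltn_trans (leq_subr _ _) _; rewrite mul2n -addnn -[ltnLHS]addn0 ltn_add2l.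
  by apply: IHj; [exact: ltnW | rewrite -(subnSK jd); apply: homogXM].
have := annH 0%N (leq0n _) 1 (dhomog1 _ _) g.
by rewrite mul1r => g0; case/negP: lg; rewrite -extendE; apply/eqP.
Qed.

Theorem small_rank_point_evaluation (R : realType) n d (l : {scalar dhomog n R (2 * d)}) :
  spans_extreme_ray l ->
  ((3 <= d)%N /\ (qrank (Qform l) <= 3 * d - 3)%N) \/ (d = 2%N /\ (qrank (Qform l) <= 5)%N) ->
  point_evaluation l.
Proof.
move=> lext dr; have [l0 _ _] := lext.
have d0 : (0 < d)%N by case: dr => -[d3 _]; [exact: leq_trans d3 | rewrite d3].
have [|z [z0 zann]] := small_rank_base_point (@extend_homog _ _ _ l)
    (extend_psd lext) (extend_neq0 d0 l0).
  case: dr => -[d3 lr]; [left | right]; split=> // k /indep_le_qrank k_le;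
    exact: leq_trans k_le lr.
by rewrite prednK // in zann; apply: (extreme_base_point d0 lext z0).
Qed.

(** * Extreme rays from point configurations *)

Section PointConfiguration.
Variables (R : realType) (n d m : nat).
Variables (v : 'I_m.+1 -> 'I_n -> R) (wt : 'I_m.+1 -> R).
Hypothesis m_ge3 : (2 < m)%N.
Hypothesis wt_neq0 : forall k, wt k != 0.
Hypothesis wt_rel : forall f, f \is d.-homog -> \sum_k wt k * f.@[v k] = 0.
Hypothesis wt_uniq : forall ka : 'I_m.+1 -> R,
  (forall f, f \is d.-homog -> \sum_k ka k * f.@[v k] = 0) ->
  exists t, forall k, ka k = t * wt k.
Hypothesis eval_gen : forall g : {scalar dhomog n R (2 * d)},
  (forall p q, p \is d.-homog -> q \is d.-homog -> (forall k, p.@[v k] = 0) ->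
     extend g (p * q) = 0) ->
  exists ka : 'I_m.+1 -> R, forall f, g f = \sum_k ka k * (f : {mpoly R[n]}).@[v k].

Local Notation nx := (lift ord0 : 'I_m -> 'I_m.+1).

(* By [wt_rel], the form in the coordinates [x_k = wt k p(v k)], [k <> 0], is
   [\sum x_k^2 - (\sum x_k)^2 / m]: it is positive semidefinite with kernel
   spanned by [(1, ..., 1)]. *)
Definition pt_coef k : R := if unlift ord0 k is Some _ then wt k ^+ 2 else - (wt k ^+ 2 / m%:R).

Definition pt_fun (f : dhomog n R (2 * d)) : R := \sum_k pt_coef k * (f : {mpoly R[n]}).@[v k].

Fact pt_fun_linear : linear_for *%R pt_fun.
Proof.
move=> a f g; rewrite /pt_fun mulr_sumr -big_split; apply: eq_bigr => k _ /=.
by rewrite mevalD mevalZ mulrDr mulrCA.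
Qed.

HB.instance Definition _ :=
  GRing.isLinear.Build R (dhomog n R (2 * d)) R _ pt_fun pt_fun_linear.

Definition pt_lin : {scalar dhomog n R (2 * d)} := pt_fun.

Lemma extend_pt f : f \is (2 * d).-homog -> extend pt_lin f = \sum_k pt_coef k * f.@[v k].
Proof. by move=> fd; rewrite -[f]/(val (DHomog fd)) extendE. Qed.

Definition pt_row (f : {mpoly R[n]}) : 'rV[R]_m := \row_k (wt (nx k) * f.@[v (nx k)]).

Lemma pt_row_linear a f g : pt_row (a *: f + g) = a *: pt_row f + pt_row g.
Proof. by apply/rowP => k; rewrite !mxE mevalD mevalZ mulrDr mulrCA. Qed.

(** A relation among the coordinates is a relation among the evaluations with coefficient 0 at
    [ord0]; it is [t * wt], and [t = 0] because the weight there is nonzero. *)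
Lemma pt_row_surj (w : 'rV[R]_m) : exists2 f, f \is d.-homog & pt_row f = w.
Proof.
pose N := #|{: monom_index n d}|.
pose P := \matrix_(i < N) pt_row (monom R (enum_val i : monom_index n d)).
have Pfull : row_full P.
  have : row_free P^T.
    apply: inj_row_free => c cP.
    pose ka k := if unlift ord0 k is Some j then c 0 j * wt k else 0.
    have kaE f : \sum_k ka k * f.@[v k] = (pt_row f *m c^T) 0 0.
      rewrite big_ord_recl {1}/ka unlift_none mul0r add0r mxE.
      by apply: eq_bigr => k _; rewrite /ka liftK !mxE; ring.
    have [f fd|t tE] := wt_uniq (ka := ka).
      have [a ->] := monom_span fd; rewrite kaE.
      elim/big_rec: _ => [|i g _ IH].
        by rewrite mxE big1 // => k _; rewrite !mxE meval0 mulr0 mul0r.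
      rewrite pt_row_linear mulmxDl -scalemxAl.
      have ci := congr1 (fun M : 'rV_N => M 0 (enum_rank i)) cP; rewrite !mxE in ci.
      rewrite (_ : pt_row (monom R i) *m c^T = 0) ?scaler0 ?add0r ?IH //.
      apply/matrixP => x y; rewrite !ord1 [RHS]mxE -[RHS]ci mxE.
      by apply: eq_bigr => k _; rewrite !mxE enum_rankK [LHS]mulrC.
    have t0 : t = 0.
      have := tE ord0; rewrite /ka unlift_none => /esym/eqP.
      by rewrite mulf_eq0 (negPf (wt_neq0 _)) orbF => /eqP.
    apply/rowP => k; rewrite mxE; have := tE (nx k); rewrite /ka liftK t0 mul0r => /eqP.
    by rewrite mulf_eq0 (negPf (wt_neq0 _)) orbF => /eqP.
  by rewrite /row_free /row_full mxrank_tr.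
have /submxP [c ->] : (w <= P)%MS by apply: submx_full.
exists (\sum_i c 0 i *: (monom R (enum_val i : monom_index n d) : {mpoly R[n]})).
  by apply: rpred_sum => i _; rewrite rpredZ ?dhomog_is_dhomog.
rewrite mulmx_sum_row; elim/big_rec2: _ => [|i y1 y2 _ <-].
  by apply/rowP => k; rewrite !mxE meval0 mulr0.
by rewrite pt_row_linear rowK.
Qed.

Definition centering : 'M[R]_m := 1%:M - m%:R^-1 *: const_mx 1.

Let m_neq0 : m%:R != 0 :> R.
Proof. by rewrite pnatr_eq0 -lt0n (ltn_trans _ m_ge3). Qed.

Lemma row_const (x : 'rV[R]_m) : x *m const_mx 1 = (\sum_k x 0 k) *: const_mx 1 :> 'rV_m.
Proof.
apply/rowP => k; rewrite !mxE mulr1; apply: eq_bigr => j _.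
by rewrite mxE mulr1.
Qed.

Lemma rank_centering : \rank centering = m.-1.
Proof.
apply/eqP; rewrite eqn_leq; apply/andP; split.
  have m1 : m.-1.+1 = m by rewrite prednK // (ltn_trans _ m_ge3).
  rewrite -ltnS m1.
  rewrite ltnNge; apply/negP => full.
  have /(row_free_inj (A := centering)) inj : row_free centering.
    by rewrite /row_free eqn_leq rank_leq_row.
  have /rowP/(_ (Ordinal (ltn_trans (isT : (0 < 2)%N) m_ge3))) : (const_mx 1 : 'rV[R]_m) = 0.
    apply: inj; rewrite mul0mx mulmxBr mulmx1 -scalemxAr row_const scalerA.
    rewrite (eq_bigr (fun=> 1)) => [|k _]; last by rewrite mxE.
    by rewrite sumr_const card_ord mulVf // scale1r subrr.
  by move/eqP; rewrite !mxE oner_eq0.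
pose J : 'M[R]_m := const_mx 1.
have E : 1%:M = centering + m%:R^-1 *: J by rewrite subrK.
have := mxrank_add centering (m%:R^-1 *: J); rewrite -E mxrank1.
have : (\rank (m%:R^-1 *: J) <= 1)%N.
  have -> : m%:R^-1 *: J = (const_mx m%:R^-1 : 'cV[R]_m) *m (const_mx 1 : 'rV[R]_m).
    by apply/matrixP => i j; rewrite !mxE big_ord1 !mxE mulr1.
  by apply: leq_trans (mxrankM_maxl _ _) _; apply: rank_leq_col.
by move=> r1 rm; rewrite -subn1 leq_subLR addnC (leq_trans rm) // leq_add2l.
Qed.

Lemma extend_pt_row p q : p \is d.-homog -> q \is d.-homog ->
  extend pt_lin (p * q) = (pt_row p *m centering *m (pt_row q)^T) 0 0.
Proof.
move=> pd qd.
have pqd : p * q \is (2 * d).-homog by rewrite mul2n -addnn; apply: dhomogM.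
have sum0 f : f \is d.-homog -> wt ord0 * f.@[v ord0] = - \sum_k pt_row f 0 k.
  move=> /wt_rel /eqP; rewrite big_ord_recl addr_eq0 => /eqP ->; congr (- _).
  by apply: eq_bigr => k _; rewrite mxE.
rewrite extend_pt // big_ord_recl /pt_coef unlift_none mevalM.
have -> : - (wt ord0 ^+ 2 / m%:R) * (p.@[v ord0] * q.@[v ord0]) =
    - m%:R^-1 * ((wt ord0 * p.@[v ord0]) * (wt ord0 * q.@[v ord0])) by field.
rewrite !sum0 // mulrNN mulmxBr mulmx1 -scalemxAr row_const scalerA mulmxBl -scalemxAl.
rewrite [RHS]mxE addrC; congr (_ + _).
  rewrite !mxE mulNr mulrA; congr (- (_ * _)).
  by apply: eq_bigr => k _; rewrite !mxE mul1r.
by rewrite mxE; apply: eq_bigr => k _; rewrite liftK mevalM !mxE; ring.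
Qed.

(** The variance identity, which makes both the positivity and the kernel visible. *)
Lemma extend_pt_sqr p : p \is d.-homog -> extend pt_lin (p * p) =
  \sum_k (pt_row p 0 k - m%:R^-1 * \sum_j pt_row p 0 j) ^+ 2.
Proof.
move=> pd; rewrite extend_pt_row // mulmxBr mulmx1 -scalemxAr row_const scalerA mulmxBl -scalemxAl.
set S := \sum_j _; set mu := m%:R^-1 * S.
transitivity (\sum_k pt_row p 0 k * pt_row p 0 k - mu * S).
  rewrite !mxE; congr (_ - _ * _); apply: eq_bigr => k _; first by rewrite [_^T _ _]mxE.
  by rewrite !mxE mul1r.
transitivity (\sum_k (pt_row p 0 k * pt_row p 0 k + (- (2 * mu)) * pt_row p 0 k + mu * mu)).
  rewrite !big_split /= -mulr_sumr -/S sumr_const card_ord -mulr_natr /mu.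
  by field.
by apply: eq_bigr => k _; ring.
Qed.

Lemma pt_psd p : p \is d.-homog -> 0 <= extend pt_lin (p * p).
Proof. by move=> pd; rewrite extend_pt_sqr // sumr_ge0 // => k _; rewrite sqr_ge0. Qed.

Lemma pt_delta (i j : 'I_m) p q : p \is d.-homog -> q \is d.-homog ->
  pt_row p = delta_mx 0 i -> pt_row q = delta_mx 0 j ->
  extend pt_lin (p * q) = (i == j)%:R - m%:R^-1.
Proof.
move=> pd qd pE qE; rewrite extend_pt_row // pE qE mulmxBr mulmx1 -scalemxAr row_const.
rewrite (_ : \sum_k _ = 1); last first.
  by rewrite (bigD1 i) //= big1 ?addr0 ?mxE ?eqxx // => k ki; rewrite mxE (negPf ki).
rewrite scale1r trmx_delta mulmxBl -scalemxAl -!colE !mxE eqxx mulr1.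
by rewrite eq_sym.
Qed.

(** A summand [l1] inherits the kernel. This contains the forms vanishing at the points, so [l1] is
    a combination of evaluations with coefficients [ka]. It also contains [g] with
    [wt k * g(v k) = 1] off [ord0], so the [ka k * g(v k)] form a relation in degree [d]; by
    [wt_uniq] it is [t * wt], which fixes [ka] up to [t]. *)
Lemma pt_extreme : spans_extreme_ray pt_lin.
Proof.
pose i0 : 'I_m := Ordinal (ltn_trans (isT : (0 < 2)%N) m_ge3).
have [p pd pE] := pt_row_surj (delta_mx 0 i0).
have m_gt1 : 1 < m%:R :> R by rewrite ltr1n (ltn_trans _ m_ge3).
have pp : 0 < extend pt_lin (p * p).
  by rewrite (pt_delta pd pd pE pE) eqxx subr_gt0 invf_lt1 // (lt_trans ltr01).
have psqr q (qd : q \is d.-homog) (l : {scalar dhomog n R (2 * d)}) :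
    extend l (q * q) = l (form_sqr (DHomog qd)).
  by rewrite -[q in LHS]/(val (DHomog qd)) -QformE.
have dual_psd (l : {scalar dhomog n R (2 * d)}) : in_sos_dual l ->
    forall q, q \is d.-homog -> 0 <= extend l (q * q).
  by move=> l0 q qd; rewrite psqr; apply: l0; exists [:: DHomog qd]; rewrite big_seq1.
have mult (l1 l2 : {scalar dhomog n R (2 * d)}) : in_sos_dual l1 -> in_sos_dual l2 ->
    (forall f, pt_lin f = l1 f + l2 f) -> exists2 c, 0 <= c & forall f, l1 f = c * pt_lin f.
  move=> l10 l20 lE.
  have ker q : q \is d.-homog -> extend pt_lin (q * q) = 0 -> ann (extend l1) q.
    move=> qd q0; apply: (ann_sqr (@extend_homog _ _ _ l1) (dual_psd _ l10)) => //.
    have h1 := dual_psd _ l10 q qd; have h2 := dual_psd _ l20 q qd.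
    have h12 : extend l1 (q * q) + extend l2 (q * q) = 0.
      by rewrite !psqr -lE -psqr.
    lra.
  have [ka kaE] : exists ka : 'I_m.+1 -> R, forall f, l1 f = \sum_k ka k * (f : {mpoly R[n]}).@[v k].
    apply: eval_gen => q r qd rd q0; apply: ker => //.
    rewrite extend_pt_sqr // big1 // => k _; rewrite mxE q0 mulr0.
    by rewrite big1 ?mulr0 ?subrr ?expr0n // => j _; rewrite mxE q0 mulr0.
  have [g gd gE] := pt_row_surj (const_mx 1).
  have g1 k : wt (nx k) * g.@[v (nx k)] = 1.
    by have /rowP/(_ k) := gE; rewrite !mxE.
  have g0 : wt ord0 * g.@[v ord0] = - m%:R.
    have /eqP := wt_rel gd; rewrite big_ord_recl addr_eq0 => /eqP ->.
    by rewrite (eq_bigr (fun=> 1)) ?sumr_const ?card_ord // => k _; rewrite g1.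
  have ag : ann (extend l1) g.
    apply: ker => //; rewrite extend_pt_sqr // big1 // => k _; rewrite gE mxE.
    rewrite (eq_bigr (fun=> 1)) => [|j _]; last by rewrite mxE.
    by rewrite sumr_const card_ord mulVf // subrr expr0n.
  have [f fd|t tE] := wt_uniq (ka := fun k => ka k * g.@[v k]).
    have gfd : g * f \is (2 * d).-homog by rewrite mul2n -addnn; apply: dhomogM.
    have agf : extend l1 (g * f) = 0 := ag f.
    rewrite -[g * f]/(val (DHomog gfd)) extendE kaE in agf; rewrite -[RHS]agf.
    by apply: eq_bigr => k _; rewrite /= mevalM mulrA.
  have kaP k : ka k = t * pt_coef k.
    have [j ->|->] := unliftP ord0 k; rewrite /pt_coef ?liftK ?unlift_none.
      by have := tE (nx j) => /(congr1 (fun x => wt (nx j) * x)); rewrite mulrCA g1 mulr1 => ->;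
        ring.
    have := tE ord0 => /(congr1 (fun x => wt ord0 * x)); rewrite mulrCA g0 => E.
    have -> : ka ord0 = - (ka ord0 * - m%:R) / m%:R by field.
    by rewrite E; field.
  have lE' f : l1 f = t * pt_lin f.
    by rewrite kaE [pt_lin f]/(pt_fun f) /pt_fun mulr_sumr; apply: eq_bigr => k _; rewrite kaP mulrA.
  exists t => //; have := dual_psd _ l10 p pd; rewrite !psqr lE' in pp *.
  by rewrite pmulr_lge0.
split.
- exists (form_sqr (DHomog pd)); rewrite -psqr; exact: lt0r_neq0.
- move=> f [s ->]; rewrite linear_sum sumr_ge0 // => q _.
  by have := pt_psd (dhomog_is_dhomog q); rewrite -QformE.
move=> l1 l2 l10 l20 lE; split; first exact: mult lE.
by apply: (mult l2 l1) => // f; rewrite addrC.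
Qed.

Lemma pt_rank : qrank (Qform pt_lin) = m.-1.
Proof.
rewrite -rank_centering; apply: (gram_rank pt_row_linear pt_row_surj).
exact: extend_pt_row.
Qed.

(** An evaluation has rank at most one, so its minor on two unit vectors vanishes:
    [(1 - 1/m)^2 = (1/m)^2], that is [m = 2], against [m_ge3]. *)
Lemma pt_not_evaluation : ~ point_evaluation pt_lin.
Proof.
move=> [y yE]; pose i0 : 'I_m := Ordinal (ltn_trans (isT : (0 < 2)%N) m_ge3).
pose i1 : 'I_m := Ordinal (ltn_trans (isT : (1 < 2)%N) m_ge3).
have [p pd pE] := pt_row_surj (delta_mx 0 i0).
have [q qd qE] := pt_row_surj (delta_mx 0 i1).
have ev f g : f \is d.-homog -> g \is d.-homog -> extend pt_lin (f * g) = f.@[y] * g.@[y].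
  move=> fd gd; have fgd : f * g \is (2 * d).-homog by rewrite mul2n -addnn; apply: dhomogM.
  by rewrite -[f * g]/(val (DHomog fgd)) extendE yE /= mevalM.
have := ev _ _ pd pd; have := ev _ _ pd qd; have := ev _ _ qd qd.
rewrite (pt_delta pd pd pE pE) (pt_delta pd qd pE qE) (pt_delta qd qd qE qE) !eqxx.
rewrite (_ : i0 == i1 = false) // sub0r; set a := p.@[y]; set b := q.@[y] => bb ab aa.
have m2 : (2 : R) < m%:R by rewrite ltr_nat.
have mi : m%:R * m%:R^-1 = 1 :> R by rewrite mulfV.
move: (m%:R : R) (m%:R^-1 : R) mi m2 aa bb ab => M x Mx M2 aa bb ab.
have E : (1 - x) * (1 - x) = x * x.
  by rewrite {1}aa bb -[RHS]mulrNN ab; ring.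
have x2 : x = 1 / 2.
  have : 1 - 2 * x = (1 - x) * (1 - x) - x * x by ring.
  by rewrite E subrr => ?; lra.
have M2' : M = 2.
  by transitivity (M * x * 2); [rewrite x2; field | rewrite Mx mul1r].
by rewrite M2' ltxx in M2.
Qed.

Theorem extreme_ray_of_points : exists l : {scalar dhomog n R (2 * d)},
  [/\ spans_extreme_ray l, qrank (Qform l) = m.-1 & ~ point_evaluation l].
Proof.
exists pt_lin; split; [exact: pt_extreme | exact: pt_rank | exact: pt_not_evaluation].
Qed.

End PointConfiguration.

(** * Sums over dependent products *)

Section ProductSums.

Lemma sum_fprod (R : comNzRingType) (I : finType) (T : I -> finType) (P : forall i, T i -> R) :
  \sum_(t : fprod T) \prod_i P i (t i) = \prod_i \sum_j P i j.
Proof.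
pose F i : {ffun T i -> R} := [ffun j => P i j].
transitivity (\sum_(t : fprod T) \prod_i F i (t i)).
  by apply: eq_bigr => t _; apply: eq_bigr => i _; rewrite ffunE.
rewrite (big_fprod _ _ F).
transitivity (\prod_i \sum_(j in tagged_with T i) untag 0 (F i) j).
  by rewrite bigA_distr_big_dep.
apply: eq_bigr => i _; rewrite -(big_tag (fun i j => F i j) i).
by apply: eq_bigr => j _; rewrite ffunE.
Qed.

Lemma prod_fprod_delta (R : comNzRingType) (I : finType) (T : I -> finType) (t u : fprod T) :
  \prod_i (t i == u i)%:R = (t == u)%:R :> R.
Proof.
have [->|tu] := eqVneq t u; first by rewrite big1 // => i _; rewrite eqxx.
have [i ti] : exists i, t i != u i.
  apply/existsP; rewrite -negb_forall; apply: contra tu => /forallP tu.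
  by apply/eqP/fprodP => i; apply/eqP/tu.
by rewrite (bigD1 i) //= (negPf ti) mul0r.
Qed.

End ProductSums.

(** * Grids of points *)

Section InverseVandermonde.
Variables (R : realFieldType) (s : nat).

Definition node_mx : 'M[R]_s := \matrix_(a, j) (j : nat)%:R ^+ a.

Lemma node_mx_unit : node_mx \in unitmx.
Proof.
have -> : node_mx = Vandermonde s (\row_j (j : nat)%:R).
  by apply/matrixP => a j; rewrite !mxE.
rewrite unitmxE det_Vandermonde unitfE prodf_seq_neq0; apply/allP => i _.
rewrite prodf_seq_neq0; apply/allP => j _; apply/implyP => ij.
by rewrite !mxE subr_eq0 eqr_nat gtn_eqF.
Qed.

Definition node_inv (j a : 'I_s) : R := invmx node_mx j a.

Lemma node_invL (a b : 'I_s) : \sum_(j < s) (j : nat)%:R ^+ a * node_inv j b = (a == b)%:R.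
Proof.
have /matrixP/(_ a b) := mulmxV node_mx_unit; rewrite !mxE => <-.
by apply: eq_bigr => j _; rewrite mxE.
Qed.

Lemma node_invR (j k : 'I_s) : \sum_(a < s) node_inv j a * (k : nat)%:R ^+ a = (j == k)%:R.
Proof.
have /matrixP/(_ j k) := mulVmx node_mx_unit; rewrite !mxE => <-.
by apply: eq_bigr => a _; rewrite mxE.
Qed.

(* The last column of the inverse holds the divided difference weights: it
   sends a polynomial of degree < s to its coefficient of degree s-1. *)
Lemma node_inv_neq0 (j t : 'I_s) : t.+1 = s -> node_inv j t != 0.
Proof.
move=> ts; pose P : {poly R} := \prod_(k < s | k != j) ('X - (k : nat)%:R%:P).
have Psize : size P = s.
  rewrite /P -big_filter size_prod_XsubC -sum1_size big_filter sum1_card.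
  by rewrite cardC1 card_ord prednK // -ts.
have Pt : P`_t = 1.
  have : P \is monic by apply: monic_prod => k _; apply: monicXsubC.
  have s1 : s.-1 = t by rewrite -[s in s.-1]ts.
  by rewrite monicE lead_coefE Psize s1 => /eqP.
have : \sum_(k < s) P.[(k : nat)%:R] * node_inv k t = 1.
  under eq_bigr do rewrite (horner_coef_wide _ (_ : size P <= s)%N) ?Psize // mulr_suml.
  rewrite exchange_big /= -[RHS]Pt (bigD1 t) //= [X in _ + X]big1 ?addr0.
    by under eq_bigr do rewrite -mulrA; rewrite -mulr_sumr node_invL eqxx mulr1.
  move=> a at'; under eq_bigr do rewrite -mulrA; rewrite -mulr_sumr node_invL.
  by rewrite (negPf at') mulr0.
rewrite (bigD1 j) //= big1 ?addr0 => [E|k kj].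
  by apply: contra_eq_neq E => ->; rewrite mulr0 eq_sym oner_eq0.
rewrite horner_prod (bigD1 k) //= hornerXsubC subrr mul0r mul0r.
by [].
Qed.

End InverseVandermonde.

Lemma extreme_ray_of_finite (R : realType) (n d : nat) (K : finType)
  (v : K -> 'I_n -> R) (wt : K -> R) : (3 < #|K|)%N -> (forall k, wt k != 0) ->
  (forall f, f \is d.-homog -> \sum_k wt k * f.@[v k] = 0) ->
  (forall ka : K -> R, (forall f, f \is d.-homog -> \sum_k ka k * f.@[v k] = 0) ->
     exists t, forall k, ka k = t * wt k) ->
  (forall h : {scalar dhomog n R (2 * d)},
     (forall p q, p \is d.-homog -> q \is d.-homog -> (forall k, p.@[v k] = 0) ->
        extend h (p * q) = 0) ->
     exists ka : K -> R, forall f, h f = \sum_k ka k * (f : {mpoly R[n]}).@[v k]) ->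
  exists l : {scalar dhomog n R (2 * d)},
    [/\ spans_extreme_ray l, qrank (Qform l) = (#|K| - 2)%N & ~ point_evaluation l].
Proof.
move=> K3 wt0 rel uniq gen; pose m := #|K|.-1.
have mE : m.+1 = #|K| by rewrite prednK // (ltn_trans _ K3).
pose vl (k : 'I_m.+1) : K := enum_val (cast_ord mE k).
pose rk (x : K) : 'I_m.+1 := cast_ord (esym mE) (enum_rank x).
have vlK : cancel vl rk by move=> k; rewrite /vl /rk enum_valK cast_ordK.
have rkK : cancel rk vl by move=> x; rewrite /vl /rk cast_ordKV enum_rankK.
have sumE (F : K -> R) : \sum_k F k = \sum_(k < m.+1) F (vl k).
  by rewrite (reindex vl) //; apply/onW_bij; exists rk.
have -> : (#|K| - 2)%N = m.-1 by rewrite -mE subn2.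
apply: (@extreme_ray_of_points R n d m (fun k => v (vl k)) (fun k => wt (vl k))).
- by rewrite -ltnS mE.
- by move=> k; apply: wt0.
- by move=> f /rel; rewrite sumE.
- move=> ka kaE; have [f /kaE|t tE] := uniq (ka \o rk).
    by rewrite sumE => E0; rewrite -[RHS]E0; apply: eq_bigr => k _; rewrite /= vlK.
  by exists t => k; rewrite -tE /= vlK.
move=> h hE; have [|ka kaE] := gen h.
  by move=> p q pd qd p0; apply: hE.
by exists (ka \o vl) => f; rewrite kaE sumE.
Qed.

Section Grid.
Variables (R : realType) (n d q : nat) (s : 'I_q -> nat) (z : 'I_n) (g : 'I_q -> 'I_n).
Hypothesis d_gt0 : (0 < d)%N.
Hypothesis g_inj : injective g.
Hypothesis gz : forall i, g i != z.
Hypothesis s_ge2 : forall i, (1 < s i)%N.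
Hypothesis s_led : forall i, (s i <= d)%N.
Hypothesis s_sum : (\sum_i (s i).-1)%N = d.+1.

Local Notation K := (fprod (fun i => 'I_(s i))).

(** [z] is the homogenizing variable, the variable [g i] takes the values [0, ..., s i - 1], and all
    other variables vanish on the grid. *)
Definition grid_pt (t : K) (j : 'I_n) : R :=
  if j == z then 1 else \sum_i (g i == j)%:R * (t i : nat)%:R.

Local Notation y := grid_pt.

Lemma grid_pt_z t : y t z = 1. Proof. by rewrite /y eqxx. Qed.

Lemma grid_pt_g t i : y t (g i) = (t i : nat)%:R.
Proof.
rewrite /y (negPf (gz i)) (bigD1 i) //= eqxx mul1r big1 ?addr0 // => k ki.
by rewrite (inj_eq g_inj) (negPf ki) mul0r.
Qed.

Lemma grid_pt_off t j : j != z -> (forall i, g i != j) -> y t j = 0.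
Proof.
move=> jz jg; rewrite /y (negPf jz) big1 // => i _.
by rewrite (negPf (jg i)) mul0r.
Qed.

Lemma grid_eval t (m : 'X_{1..n}) : (forall j, j != z -> (forall i, g i != j) -> m j = 0%N) ->
  'X_[m].@[y t] = \prod_i (t i : nat)%:R ^+ m (g i) :> R.
Proof.
move=> m0; rewrite mevalX (bigID (mem [set g i | i in [set: 'I_q]])) /=.
rewrite [X in _ * X]big1 ?mulr1 => [|j jg].
  rewrite big_imset /=; last by move=> i j _ _; apply: g_inj.
  by apply: eq_big => [i|i _]; rewrite ?inE // grid_pt_g.
have [->|jz] := eqVneq j z; first by rewrite grid_pt_z expr1n.
rewrite m0 ?expr0 // => i; apply: contra jg => /eqP <-.
by apply: imset_f; rewrite inE.
Qed.

Lemma grid_eval_off t (m : 'X_{1..n}) j : j != z -> (forall i, g i != j) -> m j != 0%N ->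
  'X_[m].@[y t] = 0 :> R.
Proof.
move=> jz jg mj; rewrite mevalX (bigD1 j) //= grid_pt_off // expr0n.
by rewrite (negPf mj) mul0r.
Qed.

Let s_gt0 i : (0 < s i)%N. Proof. exact: ltnW. Qed.

Fact grid_top_lt i : ((s i).-1 < s i)%N. Proof. by rewrite ltn_predL. Qed.

Definition grid_top i : 'I_(s i) := Ordinal (grid_top_lt i).

(** The product of the divided differences in each coordinate: on polynomials with exponents below
    the [s i] it returns the coefficient of the top monomial. *)
Definition grid_wt (t : K) : R := \prod_i node_inv R (t i) (grid_top i).

Lemma grid_wt_neq0 t : grid_wt t != 0.
Proof.
apply/prodf_neq0 => i _; apply: node_inv_neq0.
by rewrite /= prednK.
Qed.

Lemma grid_power_sum i (b : 'I_(s i)) : \sum_(j < s i) node_inv R j (grid_top i) * (j : nat)%:R ^+ b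
  = (b == grid_top i)%:R.
Proof. by rewrite -node_invL; apply: eq_bigr => j _; rewrite mulrC. Qed.

(** The top exponents add up to [d + 1], so a monomial of degree [d] in the grid variables and [z]
    has some exponent below [s i - 1], and the divided difference in that coordinate kills it. *)
Lemma grid_rel f : f \is d.-homog -> \sum_t grid_wt t * f.@[y t] = 0.
Proof.
move: f; apply: homog_ind => [|f h fE hE|a f fE|m md].
- by rewrite big1 // => t _; rewrite meval0 mulr0.
- by under eq_bigr do rewrite mevalD mulrDr; rewrite big_split /= fE hE addr0.
- by under eq_bigr do rewrite mevalZ mulrCA; rewrite -mulr_sumr fE mulr0.
have [/forallP m0|] := boolP [forall j, (j != z) && [forall i, g i != j] ==> (m j == 0%N)]; last first.
  rewrite negb_forall => /existsP [j]; rewrite negb_imply => /andP [/andP [jz /forallP jg] mj].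
  by rewrite big1 // => t _; rewrite (grid_eval_off _ jz) ?mulr0.
have mon t : 'X_[m].@[y t] = \prod_i (t i : nat)%:R ^+ m (g i) :> R.
  apply: grid_eval => j jz jg; apply/eqP; have := m0 j; rewrite jz /= => /implyP; apply.
  exact/forallP.
under eq_bigr do rewrite mon -big_split /=.
rewrite (sum_fprod (fun i (j : 'I_(s i)) => node_inv R j (grid_top i) * (j : nat)%:R ^+ m (g i))).
have [i mi] : exists i, (m (g i) < (s i).-1)%N.
  apply/existsP; rewrite -[X in is_true X]negbK negb_exists; apply/negP => /forallP ms.
  have : (\sum_i (s i).-1 <= mdeg m)%N.
    rewrite mdegE (bigID (mem [set g i | i in [set: 'I_q]])) /= big_imset /=; last first.
      by move=> i j _ _; apply: g_inj.
    apply: leq_trans (leq_addr _ _); apply: leq_trans (_ : \sum_i m (g i) <= _)%N.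
      by apply: leq_sum => i _; rewrite leqNgt ms.
    by rewrite leq_eqVlt; apply/orP; left; apply/eqP/eq_bigl => i; rewrite inE.
  by rewrite s_sum md ltnn.
rewrite (bigD1 i) //= (grid_power_sum (Ordinal (leq_trans mi (leq_pred _)))) -val_eqE /=.
by rewrite ltn_eqF // mul0r.
Qed.

(* The form of degree [k] dehomogenizing to the monomial with exponents [a]. *)
Definition grid_mon k (a : K) : 'X_{1..n} :=
  [multinom (if j == z then k - \sum_i (a i : nat) else \sum_i (g i == j) * a i)%N | j < n].

Lemma grid_mon_g k (a : K) i : grid_mon k a (g i) = a i.
Proof.
rewrite mnmE (negPf (gz i)) (bigD1 i) //= eqxx mul1n big1 ?addn0 // => l li.
by rewrite (inj_eq g_inj) (negPf li).
Qed.

Lemma grid_mon_off k (a : K) j : j != z -> (forall i, g i != j) -> grid_mon k a j = 0%N.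
Proof.
move=> jz jg; rewrite mnmE (negPf jz) big1 // => i _.
by rewrite (negPf (jg i)).
Qed.

Lemma grid_mon_eval k (a : K) t : 'X_[grid_mon k a].@[y t] = \prod_i (t i : nat)%:R ^+ a i :> R.
Proof.
rewrite grid_eval => [|j]; last exact: grid_mon_off.
by apply: eq_bigr => i _; rewrite grid_mon_g.
Qed.

Lemma mdeg_grid (m : 'X_{1..n}) : (forall j, j != z -> (forall i, g i != j) -> m j = 0%N) ->
  mdeg m = (m z + \sum_i m (g i))%N.
Proof.
move=> m0; rewrite mdegE (bigD1 z) //=; congr (_ + _)%N.
rewrite (bigID (mem [set g i | i in [set: 'I_q]])) /= [X in (_ + X)%N]big1 ?addn0 => [|j /andP [jz jg]].
  transitivity (\sum_(j in [set g i | i in [set: 'I_q]]) m j)%N.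
    apply: eq_bigl => j; apply: andb_idl => /imsetP [i _ ->]; exact: gz.
  rewrite big_imset /=; last by move=> i j _ _; apply: g_inj.
  by apply: eq_bigl => i; rewrite inE.
apply: m0 => // i; apply: contra jg => /eqP <-; by apply: imset_f; rewrite inE.
Qed.

Lemma grid_mon_deg k (a : K) : (\sum_i (a i : nat) <= k)%N -> mdeg (grid_mon k a) = k.
Proof.
move=> ak; rewrite mdeg_grid => [|j]; last exact: grid_mon_off.
by rewrite {1}mnmE eqxx (eq_bigr _ (fun i _ => grid_mon_g k a i)) subnK.
Qed.

Lemma grid_exp_lt (a : K) : a != [fprod i => grid_top i] -> (\sum_i (a i : nat) <= d)%N.
Proof.
move=> atop; have [i ai] : exists i, a i != grid_top i.
  apply/existsP; rewrite -negb_forall; apply: contra atop => /forallP at'.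
  by apply/eqP/fprodP => i; rewrite fprodE; apply/eqP.
rewrite -ltnS -s_sum (bigD1 i) //= [X in (_ < X)%N](bigD1 i) //= -addSn leq_add //.
  by rewrite ltn_neqAle -[X in _ && X]ltnS prednK // ltn_ord andbT.
by apply: leq_sum => j _; rewrite -ltnS prednK.
Qed.

(** The inverse of the tensor product of the Vandermonde matrices recovers [ka] from its moments. *)
Lemma grid_inv (ka : K -> R) (u : K) : ka u =
  \sum_(a : K) (\prod_i node_inv R (u i) (a i)) * \sum_(t : K) ka t * \prod_i (t i : nat)%:R ^+ a i.
Proof.
under eq_bigr do rewrite mulr_sumr; rewrite exchange_big /=.
rewrite (eq_bigr (fun t => ka t * (u == t)%:R)) => [|t _].
  rewrite (bigD1 u) //= eqxx mulr1 big1 ?addr0 // => t tu.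
  by rewrite eq_sym (negPf tu) mulr0.
rewrite -(prod_fprod_delta R u t) -(eq_bigr _ (fun i _ => node_invR R (u i) (t i))).
rewrite -(sum_fprod (fun i (b : 'I_(s i)) => node_inv R (u i) b * (t i : nat)%:R ^+ b)).
rewrite mulr_sumr; apply: eq_bigr => a _; rewrite big_split /=; ring.
Qed.

(** By [grid_exp_lt] every moment except the top one is a sum over a form of degree [d], hence zero;
    in [grid_inv] only the column of [grid_wt] remains. *)
Lemma grid_uniq (ka : K -> R) : (forall f, f \is d.-homog -> \sum_t ka t * f.@[y t] = 0) ->
  exists c, forall t, ka t = c * grid_wt t.
Proof.
move=> ka0; pose top : K := [fprod i => grid_top i].
exists (\sum_t ka t * \prod_i (t i : nat)%:R ^+ top i) => u.
rewrite {1}(grid_inv ka u) (bigD1 top) //= [X in _ + X]big1 ?addr0.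
  rewrite mulrC; congr (_ * _).
  by rewrite /grid_wt; apply: eq_bigr => i _; rewrite fprodE.
move=> a atop; rewrite (_ : \sum_t _ = 0) ?mulr0 //.
have md : ('X_[grid_mon d a] : {mpoly R[n]}) \is d.-homog by rewrite dhomogX /= grid_mon_deg // grid_exp_lt.
by rewrite -[RHS](ka0 _ md); apply: eq_bigr => t _; rewrite grid_mon_eval.
Qed.

Section Generation.
Variable h : {scalar dhomog n R (2 * d)}.
Hypothesis h_van : forall p r, p \is d.-homog -> r \is d.-homog ->
  (forall t, p.@[y t] = 0) -> extend h (p * r) = 0.

(** Lagrange interpolation: the coefficients for which the evaluations agree with [h] on each
    [grid_mon]. *)
Definition grid_coef (u : K) : R :=
  \sum_(a : K) extend h 'X_[grid_mon (2 * d) a] * \prod_i node_inv R (u i) (a i).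

(* Vanishes on the forms [p r] with [p] zero on the grid.  Reducing with
   [\prod_(j < s i) (x_i - j x_z)], every form of degree [2 d] becomes a
   combination of the [grid_mon], on which [grid_diff] is zero too. *)
Definition grid_diff (f : {mpoly R[n]}) : R :=
  extend h f - \sum_t grid_coef t * f.@[y t].

Fact grid_diff_linear : linear_for *%R grid_diff.
Proof.
move=> a f f'; rewrite /grid_diff linearP /=.
under eq_bigr do rewrite mevalD mevalZ mulrDr mulrCA.
by rewrite big_split /= -mulr_sumr; ring.
Qed.

HB.instance Definition _ :=
  GRing.isLinear.Build R {mpoly R[n]} R _ grid_diff grid_diff_linear.

(** Variables are moved from [r] to [p] until [p] has degree [d], where [h_van] applies. *)
Lemma grid_diff_vanish e p r : (e <= d)%N -> p \is e.-homog -> r \is (2 * d - e).-homog ->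
  (forall t, p.@[y t] = 0) -> grid_diff (p * r) = 0.
Proof.
move=> ed; rewrite -(subKn ed).
elim: (d - e)%N (leq_subr e d) p r => [|j IHj] jd p r.
  rewrite subn0 mul2n -addnn addnK => pd rd p0.
  rewrite /grid_diff h_van // big1 ?subr0 // => t _.
  by rewrite mevalM p0 mul0r mulr0.
move=> pd rd p0; have dj : (2 * d - (d - j.+1) = (2 * d - (d - j)).+1)%N by lia.
rewrite dj in rd; have [r' r'd ->] := homog_gen rd.
rewrite mulr_sumr linear_sum big1 // => i _.
rewrite mulrA [p * _]mulrC; apply: IHj => //; first exact: ltnW.
  by rewrite -(subnSK jd); apply: homogXM.
by move=> t; rewrite mevalM p0 mulr0.
Qed.

Lemma grid_diff_mon (b : K) : grid_diff 'X_[grid_mon (2 * d) b] = 0.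
Proof.
rewrite /grid_diff; apply/eqP; rewrite subr_eq0; apply/eqP.
under eq_bigr do rewrite grid_mon_eval /grid_coef mulr_suml.
rewrite exchange_big /= (bigD1 b) //= [X in _ + X]big1 ?addr0 => [|a ab].
  under eq_bigr do rewrite -mulrA; rewrite -mulr_sumr.
  rewrite [X in _ * X](_ : _ = 1) ?mulr1 //.
  under eq_bigr do rewrite -big_split /=.
  rewrite (sum_fprod (fun i (j : 'I_(s i)) => node_inv R j (b i) * (j : nat)%:R ^+ b i)).
  apply: big1 => i _; under eq_bigr do rewrite mulrC.
  by rewrite node_invL eqxx.
under eq_bigr do rewrite -mulrA; rewrite -mulr_sumr.
rewrite [X in _ * X](_ : _ = 0) ?mulr0 //.
under eq_bigr do rewrite -big_split /=.
rewrite (sum_fprod (fun i (j : 'I_(s i)) => node_inv R j (a i) * (j : nat)%:R ^+ b i)).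
rewrite -[RHS](_ : (b == a)%:R = 0); last by rewrite eq_sym (negPf ab).
rewrite -prod_fprod_delta; apply: eq_bigr => i _; rewrite -node_invL.
by apply: eq_bigr => j _; rewrite mulrC.
Qed.

Definition grid_line i c : {mpoly R[n]} := \prod_(j < c) ('X_(g i) - (j : nat)%:R *: 'X_z).

Lemma grid_line_homog i c : grid_line i c \is c.-homog.
Proof.
elim: c => [|c IHc]; first by rewrite /grid_line big_ord0 dhomog1.
rewrite /grid_line big_ord_recr /= mulrC; apply: homogM1 => //.
by rewrite rpredB ?rpredZ ?homogX.
Qed.

Lemma grid_line_vanish i t : (grid_line i (s i)).@[y t] = 0.
Proof.
rewrite /grid_line rmorph_prod (bigD1 (t i)) //= mevalB mevalZ !mevalXU.
by rewrite grid_pt_g grid_pt_z mulr1 subrr mul0r.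
Qed.

Lemma grid_line_lead i c : exists2 w : {mpoly R[n]}, w \is c.-homog &
  grid_line i c.+1 = 'X_(g i) ^+ c.+1 + 'X_z * w.
Proof.
elim: c => [|c [w wc wE]].
  exists 0; first exact: rpred0.
  by rewrite /grid_line big_ord1 scale0r subr0 mulr0 addr0 expr1.
exists (w * 'X_(g i) - c.+1%:R *: 'X_(g i) ^+ c.+1 - c.+1%:R *: ('X_z * w)).
  by rewrite !rpredB ?rpredZ ?homogXn ?homogXM // mulrC homogXM.
rewrite /grid_line big_ord_recr -/(grid_line i c.+1) wE /= (exprS _ c.+1) -!mul_mpolyC.
by move: ('X_(g i) ^+ c.+1) (c.+1%:R%:MP) => X C; ring.
Qed.

(** Descending induction on the power of [x_z]. A monomial with an exponent of at least [s i] is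
    reduced by [grid_line], whose lower terms all carry a further factor [x_z]; by [s_led] its
    degree is within reach of [grid_diff_vanish]. The monomials that cannot be reduced are the
    [grid_mon]. *)
Lemma grid_diff_z k f : (k <= 2 * d)%N -> f \is (2 * d - k).-homog -> grid_diff ('X_z ^+ k * f) = 0.
Proof.
move=> kd; rewrite -(subKn kd); elim: (2 * d - k)%N (leq_subr k (2 * d)) f => [|j IHj] jd f.
  rewrite subn0 subnn => f0; pose a0 : K := [fprod i => Ordinal (s_gt0 i)].
  have fE : f = f@_0%MM *: 1.
    apply/mpolyP => m; rewrite mcoeffZ mcoeff1; case: eqVneq => [->|m0].
      by rewrite mulr1.
    by rewrite mulr0 (dhomog_nemf_coeff f0) //= mdeg_eq0.
  rewrite fE -scalerAr mulr1 linearZ /= (_ : 'X_z ^+ _ = 'X_[grid_mon (2 * d) a0]).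
    by rewrite grid_diff_mon mulr0.
  rewrite mpolyXn; congr 'X_[_]; apply/mnmP => l; rewrite mulmnE mnm1E mnmE eq_sym.
  case: eqP => [_|lz].
    by rewrite mul1n big1 ?subn0 // => i _; rewrite fprodE.
  by rewrite mul0n big1 // => i _; rewrite fprodE muln0.
have kj : (2 * d - (2 * d - j.+1) = j.+1)%N by rewrite subKn.
rewrite kj; set k' := (2 * d - j.+1)%N.
have k'j : (2 * d - j = k'.+1)%N by rewrite /k' subnSK.
have IH f' : f' \is j.-homog -> grid_diff ('X_z ^+ k' * ('X_z * f')) = 0.
  move=> f'j; rewrite mulrA -exprSr -k'j; apply: IHj; first exact: ltnW.
  by rewrite subKn // ltnW.
move: f; apply: homog_ind => [|f f' fE f'E|a f fE|m md].
- by rewrite mulr0 linear0.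
- by rewrite mulrDr linearD /= fE f'E addr0.
- by rewrite -scalerAr linearZ /= fE mulr0.
have mU l : m l != 0%N -> exists2 f : {mpoly R[n]}, f \is j.-homog & 'X_[m] = 'X_l * f.
  move=> ml; have lem : (U_(l) <= m)%MM by rewrite lep1mP.
  exists 'X_[m - U_(l)]; last by rewrite -mpolyXD addmC submK.
  rewrite dhomogX /=; apply/eqP; have := md; rewrite -[in LHS](submK lem) mdegD mdeg1 addn1.
  by case.
have [mz|mz] := eqVneq (m z) 0%N; last by have [f fj ->] := mU z mz; apply: IH.
have [/forallP m0|] := boolP [forall l, (l != z) && [forall i, g i != l] ==> (m l == 0%N)]; last first.
  rewrite negb_forall => /existsP [l]; rewrite negb_imply => /andP [/andP [lz /forallP lg] ml].
  have [f fj ->] := mU l ml; rewrite mulrCA; apply: (grid_diff_vanish d_gt0) => [|| t].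
  - exact: homogX.
  - by rewrite (_ : 2 * d - 1 = k' + j)%N; [apply: dhomogM => //; exact: homogXn | lia].
  - by rewrite mevalXU grid_pt_off.
have {}m0 l : l != z -> (forall i, g i != l) -> m l = 0%N.
  move=> lz lg; apply/eqP; have := m0 l; rewrite lz /= => /implyP; apply.
  exact/forallP.
have [ms|/existsNP [i /negP]] := pselect (forall i, (m (g i) < s i)%N).
  pose b : K := [fprod i => Ordinal (ms i)].
  have -> : 'X_z ^+ k' * 'X_[m] = 'X_[grid_mon (2 * d) b] :> {mpoly R[n]}.
    rewrite mpolyXn -mpolyXD; congr 'X_[_]; apply/mnmP => l.
    have mE := mdeg_grid m0; rewrite md mz add0n in mE.
    rewrite mnmDE mulmnE mnm1E; have [zl|lz] := eqVneq z l.
      rewrite -zl mz mul1n addn0 mnmE eqxx /k' mE; congr (_ - _)%N.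
      by apply: eq_bigr => i _; rewrite fprodE.
    rewrite mul0n add0n.
    have [/existsP [i /eqP <-]|] := boolP [exists i, g i == l].
      by rewrite grid_mon_g fprodE.
    rewrite negb_exists => /forallP lg; rewrite m0 ?grid_mon_off // eq_sym //.
  exact: grid_diff_mon.
rewrite -leqNgt => si.
have [c sc] : exists c, s i = c.+1 by exists (s i).-1; rewrite prednK.
have lem : (U_(g i) *+ s i <= m)%MM.
  apply/mnm_lepP => l; rewrite mulmnE mnm1E.
  by case: eqP => [<-|_]; rewrite ?mul1n ?mul0n.
pose m' := (m - U_(g i) *+ s i)%MM.
have mE : 'X_[m] = 'X_(g i) ^+ s i * 'X_[m'] :> {mpoly R[n]}.
  by rewrite mpolyXn -mpolyXD addmC submK.
have m'd : (s i + mdeg m' = j.+1)%N.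
  by rewrite -md -(submK lem) mdegD mdegMn mdeg1 mul1n addnC.
have [w wc wE] := grid_line_lead i c.
have -> : 'X_z ^+ k' * 'X_[m] = grid_line i (s i) * ('X_z ^+ k' * 'X_[m']) -
    'X_z ^+ k' * ('X_z * (w * 'X_[m'])).
  by rewrite mE sc wE; ring.
rewrite linearB /= IH ?subr0; last first.
  have -> : j = (c + mdeg m')%N by apply: succn_inj; rewrite -m'd sc.
  by apply: dhomogM => //; rewrite dhomogX.
apply: (grid_diff_vanish (s_led i)) => [||t]; last exact: grid_line_vanish.
  exact: grid_line_homog.
rewrite (_ : 2 * d - s i = k' + mdeg m')%N; last by lia.
by apply: dhomogM; [exact: homogXn | rewrite dhomogX].
Qed.

Lemma grid_gen : exists ka : K -> R,
  forall f, h f = \sum_t ka t * (f : {mpoly R[n]}).@[y t].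
Proof.
exists grid_coef => f; apply/eqP; rewrite -subr_eq0 -extendE -/(grid_diff f).
rewrite -[f : {mpoly R[n]}]mul1r -(expr0 'X_z) grid_diff_z // subn0.
exact: dhomog_is_dhomog.
Qed.

End Generation.

Theorem extreme_ray_of_grid : (3 < \prod_i s i)%N ->
  exists l : {scalar dhomog n R (2 * d)},
    [/\ spans_extreme_ray l, qrank (Qform l) = (\prod_i s i - 2)%N & ~ point_evaluation l].
Proof.
have KE : #|{: K}| = (\prod_i s i)%N.
  by rewrite card_fprod; apply: eq_bigr => i _; rewrite card_ord.
rewrite -KE => K3; apply: (extreme_ray_of_finite (v := y) K3 grid_wt_neq0).
- exact: grid_rel.
- exact: grid_uniq.
exact: grid_gen.
Qed.

End Grid.

Theorem corollary2p2 (R : realType) :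
  (forall (n d : nat) (l : {scalar dhomog n R (2 * d)}),
     spans_extreme_ray l ->
     ((3 <= d)%N /\ (qrank (Qform l) <= 3 * d - 3)%N) \/
       (d = 2%N /\ (qrank (Qform l) <= 5)%N) ->
     point_evaluation l)
  /\
  (forall n d : nat, (3 <= d)%N -> (3 <= n)%N ->
     exists l : {scalar dhomog n R (2 * d)},
       [/\ spans_extreme_ray l,
           qrank (Qform l) = (3 * d - 2)%N &
           ~ point_evaluation l])
  /\
  (forall n : nat, (4 <= n)%N ->
     exists l : {scalar dhomog n R (2 * 2)},
       [/\ spans_extreme_ray l,
           qrank (Qform l) = 6%N &
           ~ point_evaluation l]).
Proof.
split; first by move=> n d l; apply: small_rank_point_evaluation.
have emb q n (qn : (q < n)%N) : exists z (g : 'I_q -> 'I_n),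
    injective g /\ forall i, g i != z.
  exists (Ordinal (leq_ltn_trans (leq0n q) qn)).
  exists (fun i => Ordinal (leq_ltn_trans (ltn_ord i) qn)); split.
    by move=> i k [ik]; apply: val_inj.
  by move=> i; rewrite -val_eqE.
split=> [n d d3 n3|n n4].
  have [z [g [g_inj gz]]] := emb 2 n n3.
  (* Two coordinates require [s_1 + s_2 = d + 3]; under [s_i <= d] the product is least for the most
     uneven split, [3] and [d]. *)
  pose s (i : 'I_2) := if i == ord0 then 3 else d.
  have prods : (\prod_i s i = 3 * d)%N by rewrite big_ord_recl big_ord1.
  rewrite -prods; apply: (@extreme_ray_of_grid R n _ _ s z g) => //.
  - exact: leq_trans d3.
  - by move=> i; rewrite /s; case: eqP => // _; apply: leq_trans d3.
  - by move=> i; rewrite /s; case: eqP.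
  - rewrite big_ord_recl big_ord1 /s /=; lia.
  by rewrite prods; lia.
have [z [g [g_inj gz]]] := emb 3 n n4.
(* For [d = 2] the bounds force [s_i = 2], and [\sum_i (s_i - 1) = 3] takes three coordinates
   besides [z], whence [n >= 4]. *)
pose s (i : 'I_3) := 2%N.
have prods : (\prod_i s i = 8)%N by rewrite !big_ord_recl big_ord0.
have -> : 6%N = (\prod_i s i - 2)%N by rewrite prods.
apply: (@extreme_ray_of_grid R n _ _ s z g) => //.
  by rewrite !big_ord_recl big_ord0.
by rewrite prods.
Qed.
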